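(* Let $R$ be a principal ideal domain and let $A_*$, $B_*$ be chain complexes of $R$-modules with $A_**_RB_*$ acyclic. Let $T\colon A_*\otimes_RB_*\to B_*\otimes_RA_*$, $T(x\otimes y)=(-1)^{|x||y|}y\otimes x$. Then the following maps form a commutative diagram (a map of short exact sequences) from the Künneth sequence of $(A_*,B_* )$ to that of $(B_*,A_* )$, for every $n$: (left) $\bigoplus_{i+j=n}(-1)^{ij}I\colon\bigoplus_{i+j=n}H_i(A_* )\otimes_RH_j(B_* )\to\bigoplus_{i+j=n}H_j(B_* )\otimes_RH_i(A_* )$; (middle) $T_*\colon H_n(A_*\otimes_RB_* )\to H_n(B_*\otimes_RA_* )$; (right) $\bigoplus_{i+j=n-1}(-1)^{ij+1}I\colon\bigoplus_{i+j=n-1}H_i(A_* )*_RH_j(B_* )\to\bigoplus_{i+j=n-1}H_j(B_* )*_RH_i(A_* )$. That is, $T_*\circ\times=\times\circ\bigoplus(-1)^{ij}I$ and $\beta\circ T_*=\bigl(\bigoplus(-1)^{ij+1}I\bigr)\circ\beta$. Moreover the splittings can be chosen to make the diagram commute: there are right inverses $\sigma$ of $\beta$ for $(A_*,B_* )$ and $\sigma'$ of $\beta$ for $(B_*,A_* )$ with $T_*\circ\sigma=\sigma'\circ\bigoplus(-1)^{ij+1}I$.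
   Context: Chain complexes are indexed by $\mathbb{Z}$, differential of degree $-1$; $\partial(x\otimes y)=\partial x\otimes y+(-1)^{|x|}x\otimes\partial y$. $\mathbf Z_n$, $\mathbf B_n$ denote cycles and boundaries. $M*_RN=\mathrm{Tor}_1^R(M,N)$; $A_**_RB_*$ is the complex with degree-$n$ part $\bigoplus_{i+j=n}A_i*_RB_j$, defined like the tensor product complex. For a free resolution $0\to K\to F\to M\to0$, $M*_RN=\ker(K\otimes_RN\to F\otimes_RN)$; for $ar=0$, $rb=0$ the elementary tor $\langle a,r,b\rangle$ is $(\tilde ar)\otimes b$ with $\tilde a\in F$ a lift of $a$; elementary tors generate $M*_RN$ additively. $I$ denotes both natural isomorphisms $M\otimes_RN\cong N\otimes_RM$, $I(a\otimes b)=b\otimes a$, and $M*_RN\cong N*_RM$, $I(\langle a,r,b\rangle)=\langle b,r,a\rangle$. Künneth sequence: when $A_**_RB_*$ is acyclic there is a natural, split short exact sequence $0\to\bigoplus_{i+j=n}H_i(A_* )\otimes_RH_j(B_* )\xrightarrow{\times}H_n(A_*\otimes_RB_* )\xrightarrow{\beta}\bigoplus_{i+j=n-1}H_i(A_* )*_RH_j(B_* )\to0$, $[x]\times[y]=[x\otimes y]$. For free complexes $\beta$ is induced by the differential of the first factor tensored with the identity, with values in $\bigoplus\ker(\mathbf B_i(A_* )\otimes H_j(B_* )\to\mathbf Z_i(A_* )\otimes H_j(B_* ))=\bigoplus H_i(A_* )*_RH_j(B_* )$; in general $\beta$ is transported from free complexes along quasi-isomorphisms $F^A_*\to A_*$,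 $F^B_*\to B_*$ with $F^A_*,F^B_*$ free. *)

(* Defs.v *)
From HB Require Import structures.
From mathcomp Require Import all_boot ssralg ssrint.
From mathcomp Require Import generic_quotient ring_quotient boolp.

Set Implicit Arguments.
Unset Strict Implicit.
Unset Printing Implicit Defensive.
Import GRing.Theory.
Local Open Scope ring_scope.

Section LinearMaps.
Variable R : idomainType.
Implicit Types U V W : lmodType R.

Definition mklin U V (f : U -> V) (fL : linear f) : {linear U -> V} :=
  HB.pack f (GRing.isLinear.Build R U V *:%R f fL).

Lemma lcomp_subproof U V W (g : {linear V -> W}) (f : {linear U -> V}) :
  linear (fun x => g (f x)).
Proof. by move=> a x y; rewrite !linearP. Qed.

Definition lcomp U V W (g : {linear V -> W}) (f : {linear U -> V}) :
  {linear U -> W} := mklin (lcomp_subproof g f).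

Lemma lid_subproof U : linear (fun x : U => x).
Proof. by []. Qed.

Definition lid U : {linear U -> U} := mklin (@lid_subproof U).

Lemma lzero_subproof U V : linear (fun _ : U => 0 : V).
Proof. by move=> a x y; rewrite scaler0 addr0. Qed.

Definition lzero U V : {linear U -> V} := mklin (@lzero_subproof U V).

Lemma ladd_subproof U V (f g : {linear U -> V}) : linear (fun x => f x + g x).
Proof. by move=> a x y; rewrite !linearP scalerDr addrACA. Qed.

Definition ladd U V (f g : {linear U -> V}) : {linear U -> V} :=
  mklin (ladd_subproof f g).

Lemma lscale_subproof U V c (f : {linear U -> V}) : linear (fun x => c *: f x).
Proof. by move=> a x y; rewrite linearP scalerDr !scalerA mulrC. Qed.

Definition lscale U V c (f : {linear U -> V}) : {linear U -> V} :=
  mklin (lscale_subproof c f).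

(* Definite description: the linear map with property P (0 if there is none). *)
Definition the_linear U V (P : {linear U -> V} -> Prop) : {linear U -> V} :=
  match pselect (exists f, P f) with
  | left ex => projT1 (cid ex)
  | right _ => lzero U V
  end.

End LinearMaps.

Section Submodules.
Variable R : idomainType.
Implicit Types U V W : lmodType R.

Record submodule V := Submodule {
  smem : {pred V};
  smem_closed : submod_closed smem }.

HB.instance Definition _ V (S : submodule V) :=
  GRing.isSubmodClosed.Build R V (smem S) (smem_closed S).

Record subm V (S : submodule V) := Subm {
  smval : V;
  smvalP : smval \in smem S }.

HB.instance Definition _ V (S : submodule V) := [isSub for @smval V S].
HB.instance Definition _ V (S : submodule V) := [Choice of subm S by <:].
HB.instance Definition _ V (S : submodule V) :=
  [SubChoice_isSubLmodule of subm S by <:].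

Lemma incl_subproof V (S : submodule V) : linear (@smval V S).
Proof. exact: (linearP (val : {linear subm S -> V})). Qed.

Definition incl V (S : submodule V) : {linear subm S -> V} :=
  mklin (@incl_subproof V S).

Lemma incl_inj V (S : submodule V) : injective (incl S).
Proof. exact: val_inj. Qed.

Lemma corestr_subproof U V (S : submodule V) (f : {linear U -> V})
  (fS : forall x, f x \in smem S) : linear (fun x => Subm (fS x)).
Proof. by move=> a x y; apply: incl_inj; rewrite [RHS]linearP /= linearP. Qed.

Definition corestr U V (S : submodule V) (f : {linear U -> V})
  (fS : forall x, f x \in smem S) : {linear U -> subm S} :=
  mklin (corestr_subproof fS).

Lemma ker_subproof U V (f : {linear U -> V}) :
  submod_closed [pred x | f x == 0].
Proof.
split=> [|a x y]; rewrite !inE ?linear0 // => /eqP fx /eqP fy.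
by rewrite linearP fx fy scaler0 addr0.
Qed.

Definition lker U V (f : {linear U -> V}) : submodule U :=
  Submodule (ker_subproof f).

Lemma lkerP U V (f : {linear U -> V}) x : reflect (f x = 0) (x \in smem (lker f)).
Proof. exact: eqP. Qed.

Lemma preim_subproof U V (f : {linear U -> V}) (S : submodule V) :
  submod_closed [pred x | f x \in smem S].
Proof.
split=> [|a x y]; rewrite !inE ?linear0 ?rpred0 // => fx fy.
by rewrite linearP rpredD // rpredZ.
Qed.

Definition preim_submodule U V (f : {linear U -> V}) (S : submodule V) :
  submodule U := Submodule (preim_subproof f S).

Lemma span_subproof V (G : V -> Prop) :
  submod_closed [pred x | `[< forall S : submodule V,
    (forall g, G g -> g \in smem S) -> x \in smem S >]].
Proof.
split=> [|a x y]; rewrite !inE; first by apply/asboolP=> S _; rewrite rpred0.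
move=> /asboolP xS /asboolP yS; apply/asboolP => S GS.
by rewrite rpredD ?rpredZ ?xS ?yS.
Qed.

Definition span_submodule V (G : V -> Prop) : submodule V :=
  Submodule (span_subproof G).

Lemma mem_span V (G : V -> Prop) g : G g -> g \in smem (span_submodule G).
Proof. by move=> Gg; apply/asboolP=> S; apply. Qed.

Lemma span_lker U V (f : {linear U -> V}) (G : U -> Prop) :
  (forall g, G g -> f g = 0) ->
  forall x, x \in smem (span_submodule G) -> f x = 0.
Proof.
move=> fG x /asboolP /(_ (lker f)) xG; apply/lkerP; apply: xG => g Gg.
by apply/lkerP; exact: fG.
Qed.

Definition quotm V (S : submodule V) := Quotient.quot (smem S).

HB.instance Definition _ V (S : submodule V) := GRing.Zmodule.on (quotm S).

Section Quotient.
Variables (V : lmodType R) (S : submodule V).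

Definition qproj_fun (x : V) : quotm S := (\pi_(Quotient.quot (smem S)) x)%qT.
Definition qrepr (q : quotm S) : V := generic_quotient.repr (q : Quotient.quot (smem S)).

Lemma qreprK q : qproj_fun (qrepr q) = q.
Proof. exact: reprK. Qed.

Lemma qproj_eq x y : (qproj_fun x = qproj_fun y) <-> (x - y \in smem S).
Proof.
rewrite Quotient.idealrBE; split=> [e|/eqP //]; exact/eqP.
Qed.

Lemma qprojD x y : qproj_fun (x + y) = qproj_fun x + qproj_fun y.
Proof. exact: (raddfD (\pi_(Quotient.quot (smem S)))%qT). Qed.

Definition qscale (a : R) (q : quotm S) : quotm S := qproj_fun (a *: qrepr q).

Lemma qscaleE a x : qscale a (qproj_fun x) = qproj_fun (a *: x).
Proof.
apply/qproj_eq; rewrite -scalerBr rpredZ //.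
by apply/qproj_eq; rewrite qreprK.
Qed.

Lemma qscaleA a b q : qscale a (qscale b q) = qscale (a * b) q.
Proof. by rewrite -[q]qreprK !qscaleE scalerA. Qed.
Lemma qscale1 : left_id 1 qscale.
Proof. by move=> q; rewrite -[q]qreprK qscaleE scale1r. Qed.
Lemma qscaleDr : right_distributive qscale +%R.
Proof.
move=> a p q; rewrite -[p]qreprK -[q]qreprK.
by rewrite -qprojD !qscaleE scalerDr qprojD.
Qed.
Lemma qscaleDl q a b : qscale (a + b) q = qscale a q + qscale b q.
Proof. by rewrite -[q]qreprK !qscaleE scalerDl qprojD. Qed.

HB.instance Definition _ := GRing.Zmodule_isLmodule.Build R (quotm S)
  qscaleA qscale1 qscaleDr qscaleDl.

Lemma qproj_subproof : linear qproj_fun.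
Proof. by move=> a x y; rewrite qprojD -qscaleE. Qed.

Definition qproj : {linear V -> quotm S} := mklin qproj_subproof.

Lemma qproj0 x : (qproj x = 0) <-> (x \in smem S).
Proof. by rewrite -(linear0 qproj) qproj_eq subr0. Qed.

Lemma qproj_surj q : exists x, q = qproj x.
Proof. by exists (qrepr q); rewrite /= qreprK. Qed.

Section Lift.
Variables (W : lmodType R) (f : {linear V -> W}).
Hypothesis fS : forall x, x \in smem S -> f x = 0.

Lemma qlift_fun_qproj x : f (qrepr (qproj x)) = f x.
Proof.
by apply/eqP; rewrite -subr_eq0 -linearB fS //; apply/qproj_eq; rewrite qreprK.
Qed.

Lemma qlift_subproof : linear (fun q => f (qrepr q)).
Proof.
move=> a p q; have [x ->] := qproj_surj p; have [y ->] := qproj_surj q.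
by rewrite -linearP !qlift_fun_qproj linearP.
Qed.

Definition qlift : {linear quotm S -> W} := mklin qlift_subproof.

Lemma qlift_qproj x : qlift (qproj x) = f x.
Proof. exact: qlift_fun_qproj. Qed.

End Lift.
End Quotient.

Definition is_pid :=
  forall I : submodule R^o, exists a : R,
    forall x : R, (x \in smem I) <-> (exists r : R, x = r * a).

End Submodules.

Arguments qproj {R V} S.
Arguments incl {R V} S.

Section DirectSum.
Variables (R : idomainType) (I : eqType).
Implicit Type M : I -> lmodType R.

Record dsum M := DSum {
  dfun :> forall i, M i;
  dfunP : exists s : seq I, forall i, i \notin s -> dfun i = 0 }.

HB.instance Definition _ M := gen_eqMixin (dsum M).
HB.instance Definition _ M := gen_choiceMixin (dsum M).

Lemma dsum_eq M (x y : dsum M) : (forall i, x i = y i) -> x = y.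
Proof.
case: x y => [f fP] [g gP] /= fg.
have e : f = g by exact: functional_extensionality_dep.
by subst g; rewrite (Prop_irrelevance fP gP).
Qed.

Section Lmod.
Variable M : I -> lmodType R.

Lemma dzeroP : exists s : seq I, forall i, i \notin s -> (0 : M i) = 0.
Proof. by exists [::]. Qed.
Lemma doppP (x : dsum M) : exists s : seq I, forall i, i \notin s -> - x i = 0.
Proof. by have [s xs] := dfunP x; exists s => i /xs ->; rewrite oppr0. Qed.
Lemma daddP (x y : dsum M) :
  exists s : seq I, forall i, i \notin s -> x i + y i = 0.
Proof.
have [s xs] := dfunP x; have [t yt] := dfunP y; exists (s ++ t) => i.
by rewrite mem_cat negb_or => /andP[/xs -> /yt ->]; rewrite addr0.
Qed.
Lemma dscaleP a (x : dsum M) :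
  exists s : seq I, forall i, i \notin s -> a *: x i = 0.
Proof. by have [s xs] := dfunP x; exists s => i /xs ->; rewrite scaler0. Qed.

Definition dzero := DSum dzeroP.
Definition dopp x := DSum (doppP x).
Definition dadd x y := DSum (daddP x y).
Definition dscale a x := DSum (dscaleP a x).

Lemma daddA : associative dadd.
Proof. by move=> x y z; apply: dsum_eq => i; rewrite /= addrA. Qed.
Lemma daddC : commutative dadd.
Proof. by move=> x y; apply: dsum_eq => i; rewrite /= addrC. Qed.
Lemma dadd0 : left_id dzero dadd.
Proof. by move=> x; apply: dsum_eq => i; rewrite /= add0r. Qed.
Lemma daddN : left_inverse dzero dopp dadd.
Proof. by move=> x; apply: dsum_eq => i; rewrite /= addNr. Qed.

HB.instance Definition _ := GRing.isZmodule.Build (dsum M) daddA daddC dadd0 daddN.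

Lemma dscaleA a b x : dscale a (dscale b x) = dscale (a * b) x.
Proof. by apply: dsum_eq => i; rewrite /= scalerA. Qed.
Lemma dscale1 : left_id 1 dscale.
Proof. by move=> x; apply: dsum_eq => i; rewrite /= scale1r. Qed.
Lemma dscaleDr : right_distributive dscale +%R.
Proof. by move=> a x y; apply: dsum_eq => i; rewrite /= scalerDr. Qed.
Lemma dscaleDl x a b : dscale (a + b) x = dscale a x + dscale b x.
Proof. by apply: dsum_eq => i; rewrite /= scalerDl. Qed.

HB.instance Definition _ := GRing.Zmodule_isLmodule.Build R (dsum M)
  dscaleA dscale1 dscaleDr dscaleDl.

Lemma dcomp_subproof i : linear (fun x : dsum M => x i).
Proof. by []. Qed.
Definition dcomp i : {linear dsum M -> M i} := mklin (@dcomp_subproof i).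

Lemma dsum_sum (J : Type) (s : seq J) (F : J -> dsum M) i :
  (\sum_(j <- s) F j : dsum M) i = \sum_(j <- s) F j i.
Proof. exact: (raddf_sum (dcomp i)). Qed.

Lemma din_supp i (x : M i) : exists s : seq I,
  forall j, j \notin s -> dfwith (fun k => 0 : M k) x j = 0.
Proof.
by exists [:: i] => j; rewrite inE eq_sym => ij; rewrite dfwith_out.
Qed.

Lemma din_subproof i : linear (fun x : M i => DSum (din_supp x)).
Proof.
move=> a x y; apply: dsum_eq => j /=.
have [e|ij] := eqVneq i j; first by case: _ / e; rewrite !dfwith_in.
by rewrite !dfwith_out // scaler0 addr0.
Qed.

Definition din i : {linear M i -> dsum M} := mklin (@din_subproof i).

Lemma din_same i (x : M i) : din i x i = x.
Proof. by rewrite /= dfwith_in. Qed.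
Lemma din_other i j (x : M i) : i != j -> din i x j = 0.
Proof. by move=> ij; rewrite /= dfwith_out. Qed.

Definition dsupp (x : dsum M) : seq I := undup (projT1 (cid (dfunP x))).

Lemma dsupp_out (x : dsum M) i : i \notin dsupp x -> x i = 0.
Proof. by rewrite mem_undup; case: (cid _) => /= s; apply. Qed.

Section Lift.
Variables (P : lmodType R) (F : forall i, {linear M i -> P}).

Lemma sum_supp (x : dsum M) (s t : seq I) : uniq s -> uniq t ->
  (forall i, i \notin s -> x i = 0) -> {subset s <= t} ->
  \sum_(i <- s) F i (x i) = \sum_(i <- t) F i (x i).
Proof.
move=> us ut xs st; rewrite [RHS](bigID (mem s)) /= [X in _ + X]big1 ?addr0.
  rewrite -[RHS]big_filter; apply: perm_big; apply: uniq_perm => //.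
    by rewrite filter_uniq.
  by move=> i; rewrite mem_filter /=; case: (boolP (i \in s)) => // /st.
by move=> i /xs ->; rewrite linear0.
Qed.

Definition dlift_fun (x : dsum M) : P := \sum_(i <- dsupp x) F i (x i).

Lemma dlift_funE (x : dsum M) (s : seq I) : uniq s ->
  (forall i, i \notin s -> x i = 0) -> dlift_fun x = \sum_(i <- s) F i (x i).
Proof.
move=> us xs; rewrite /dlift_fun.
pose t := undup (dsupp x ++ s).
rewrite (@sum_supp x (dsupp x) t) ?undup_uniq //; last first.
- by move=> i xi; rewrite mem_undup mem_cat xi.
- exact: dsupp_out.
rewrite (@sum_supp x s t) ?undup_uniq //.
by move=> i xi; rewrite mem_undup mem_cat xi orbT.
Qed.

Lemma dlift_subproof : linear dlift_fun.
Proof.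
move=> a x y; pose s := undup (dsupp x ++ dsupp y).
have us : uniq s by exact: undup_uniq.
have sx i : i \notin s -> x i = 0.
  by rewrite mem_undup mem_cat negb_or => /andP[/dsupp_out].
have sy i : i \notin s -> y i = 0.
  by rewrite mem_undup mem_cat negb_or => /andP[_ /dsupp_out].
rewrite (dlift_funE us sx) (dlift_funE us sy) (@dlift_funE _ s) //; last first.
  by move=> i si /=; rewrite sx // sy // scaler0 addr0.
rewrite scaler_sumr -big_split /=; apply: eq_bigr => i _.
by rewrite linearP.
Qed.

Definition dlift : {linear dsum M -> P} := mklin dlift_subproof.

Lemma dlift_din i (x : M i) : dlift (din i x) = F i x.
Proof.
rewrite /= (@dlift_funE _ [:: i]) //; last first.
  by move=> j; rewrite inE eq_sym => ij; rewrite din_other.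
by rewrite big_seq1 din_same.
Qed.

End Lift.

Lemma dsumE (x : dsum M) : x = \sum_(i <- dsupp x) din i (x i).
Proof.
apply: dsum_eq => j; rewrite dsum_sum.
have [js|js] := boolP (j \in dsupp x); last first.
  rewrite dsupp_out // big_seq big1 // => i ix; rewrite din_other //.
  by apply: contraNneq js => <-.
rewrite (bigD1_seq j) ?undup_uniq //= dfwith_in big1 ?addr0 // => i ij.
by rewrite dfwith_out.
Qed.

Lemma dsum_ext (P : lmodType R) (f g : {linear dsum M -> P}) :
  (forall i x, f (din i x) = g (din i x)) -> forall x, f x = g x.
Proof.
move=> fg x; rewrite [x]dsumE !raddf_sum; apply: eq_bigr => i _; exact: fg.
Qed.

End Lmod.

Definition dmap (M N : I -> lmodType R) (F : forall i, {linear M i -> N i}) :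
  {linear dsum M -> dsum N} := dlift (fun i => lcomp (@din N i) (F i)).

Lemma dmap_din (M N : I -> lmodType R) (F : forall i, {linear M i -> N i}) i x :
  dmap F (@din M i x) = @din N i (F i x).
Proof. exact: dlift_din. Qed.

Lemma dmapE (M N : I -> lmodType R) (F : forall i, {linear M i -> N i}) x i : dmap F x i = F i (x i).
Proof.
apply: (@dsum_ext M _ (lcomp (@dcomp N i) (dmap F))
                     (lcomp (F i) (@dcomp M i)) _ x) => j y.
change (dmap F (@din M j y) i = F i (@din M j y i)); rewrite dmap_din.
have [e|ij] := eqVneq j i; first by case: _ / e; rewrite !din_same.
by rewrite !din_other // linear0.
Qed.

End DirectSum.

Arguments din {R I} M i.
Arguments dcomp {R I} M i.

Section FreeModules.
Variable R : idomainType.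

Definition freem (X : eqType) : lmodType R := dsum (fun _ : X => R^o).

Definition fgen (X : eqType) (x : X) : freem X :=
  din (fun _ : X => R^o) x (1 : R).

Lemma scale_at_subproof (V : lmodType R) (v : V) :
  linear (fun r : R^o => (r : R) *: v).
Proof. by move=> a r s; rewrite scalerDl scalerA. Qed.

Definition scale_at (V : lmodType R) (v : V) : {linear R^o -> V} :=
  mklin (@scale_at_subproof V v).

Definition flift (X : eqType) (V : lmodType R) (h : X -> V) :
  {linear freem X -> V} := dlift (fun x => scale_at (h x)).

Lemma flift_fgen (X : eqType) (V : lmodType R) (h : X -> V) x :
  flift h (fgen x) = h x.
Proof. by rewrite /flift /fgen dlift_din /= scale1r. Qed.

Lemma freem_ext (X : eqType) (V : lmodType R) (f g : {linear freem X -> V}) :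
  (forall x, f (fgen x) = g (fgen x)) -> forall u, f u = g u.
Proof.
move=> fg; apply: dsum_ext => x r.
have -> : din (fun _ : X => R^o) x r = r *: fgen x.
  rewrite /fgen -[in RHS]linearZ; congr (din (fun _ : X => R^o) x _).
  by rewrite -[LHS]mulr1.
by rewrite !linearZ fg.
Qed.

Definition is_free (V : lmodType R) : Prop :=
  exists (X : eqType) (f : {linear freem X -> V}), bijective f.

End FreeModules.

Section TensorProduct.
Variable R : idomainType.
Implicit Types M N P : lmodType R.

Inductive tensor_rel M N : freem R (M * N)%type -> Prop :=
| TensorAddl m m' n :
    tensor_rel (fgen R (m + m', n) - fgen R (m, n) - fgen R (m', n))
| TensorAddr m n n' :
    tensor_rel (fgen R (m, n + n') - fgen R (m, n) - fgen R (m, n'))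
| TensorScalel a m n : tensor_rel (fgen R (a *: m, n) - a *: fgen R (m, n))
| TensorScaler a m n : tensor_rel (fgen R (m, a *: n) - a *: fgen R (m, n)).

Definition tensor M N : lmodType R := quotm (span_submodule (@tensor_rel M N)).

Definition tens M N (m : M) (n : N) : tensor M N :=
  qproj (span_submodule (@tensor_rel M N)) (fgen R (m, n)).

Lemma tens_subproof (V : lmodType R) (x y z w : V) :
  x - (w + z) = (x - y - z) + (y - w).
Proof. by rewrite addrA [_ + y]addrAC subrK -addrA -opprD [z + w]addrC. Qed.

Lemma tens_linearl M N (n : N) : linear (fun m : M => tens m n).
Proof.
move=> a m m'; rewrite /tens -linearP; apply/qproj_eq.
rewrite (tens_subproof _ (fgen R (a *: m, n))) rpredD //; apply: mem_span.
  exact: TensorAddl.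
exact: TensorScalel.
Qed.

Lemma tens_linearr M N (m : M) : linear (fun n : N => tens m n).
Proof.
move=> a n n'; rewrite /tens -linearP; apply/qproj_eq.
rewrite (tens_subproof _ (fgen R (m, a *: n))) rpredD //; apply: mem_span.
  exact: TensorAddr.
exact: TensorScaler.
Qed.

Definition tensl M N (n : N) : {linear M -> tensor M N} :=
  mklin (@tens_linearl M N n).
Definition tensr M N (m : M) : {linear N -> tensor M N} :=
  mklin (@tens_linearr M N m).

Lemma tens0l M N (n : N) : tens (0 : M) n = 0.
Proof. exact: (linear0 (tensl M n)). Qed.
Lemma tens0r M N (m : M) : tens m (0 : N) = 0.
Proof. exact: (linear0 (tensr N m)). Qed.
Lemma tensZl M N a (m : M) (n : N) : tens (a *: m) n = a *: tens m n.
Proof. exact: (linearZ_LR (tensl M n)). Qed.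
Lemma tensZr M N a (m : M) (n : N) : tens m (a *: n) = a *: tens m n.
Proof. exact: (linearZ_LR (tensr N m)). Qed.

Lemma tensor_ext M N P (f g : {linear tensor M N -> P}) :
  (forall m n, f (tens m n) = g (tens m n)) -> forall u, f u = g u.
Proof.
move=> fg u; have [v ->] := qproj_surj u.
by apply: (@freem_ext _ _ _ (lcomp f (qproj _)) (lcomp g (qproj _))) => -[m n]; exact: fg.
Qed.

Section Lift.
Variables (M N P : lmodType R) (b : M -> N -> P).
Hypothesis bl : forall n, linear (b^~ n).
Hypothesis br : forall m, linear (b m).

Lemma tlift_subproof u : u \in smem (span_submodule (@tensor_rel M N)) ->
  flift (fun p => b p.1 p.2) u = 0.
Proof.
apply: span_lker => _ [m m' n|m n n'|a m n|a m n];
  rewrite !linearB ?linearZ_LR !flift_fgen /=.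
- by have := bl n 1 m m'; rewrite !scale1r => ->; rewrite -addrA -opprD subrr.
- by have := br m 1 n n'; rewrite !scale1r => ->; rewrite -addrA -opprD subrr.
- have /= -> := linearZ_LR (mklin (bl n)) a m.
  by rewrite scalerN subrr.
- have /= -> := linearZ_LR (mklin (br m)) a n.
  by rewrite scalerN subrr.
Qed.

Definition tlift : {linear tensor M N -> P} := qlift tlift_subproof.

Lemma tlift_tens m n : tlift (tens m n) = b m n.
Proof. by rewrite /tlift /tens qlift_qproj flift_fgen. Qed.

End Lift.

Section Map.
Variables (M N M' N' : lmodType R).
Variables (f : {linear M -> M'}) (g : {linear N -> N'}).

Lemma tmap_linearl n : linear (fun m => tens (f m) (g n)).
Proof. by move=> a m m'; rewrite linearP tens_linearl. Qed.
Lemma tmap_linearr m : linear (fun n => tens (f m) (g n)).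
Proof. by move=> a n n'; rewrite linearP tens_linearr. Qed.

Definition tmap : {linear tensor M N -> tensor M' N'} :=
  tlift tmap_linearl tmap_linearr.

Lemma tmap_tens m n : tmap (tens m n) = tens (f m) (g n).
Proof. exact: tlift_tens. Qed.

End Map.

Definition tswap M N : {linear tensor M N -> tensor N M} :=
  tlift (b := fun m n => tens n m) (@tens_linearr N M) (@tens_linearl N M).

Lemma tswap_tens M N (m : M) (n : N) : tswap M N (tens m n) = tens n m.
Proof. exact: tlift_tens. Qed.

Lemma tmap_comp M N M' N' M2 N2 (f : {linear M -> M'}) (g : {linear N -> N'})
  (f' : {linear M' -> M2}) (g' : {linear N' -> N2}) u :
  tmap f' g' (tmap f g u) = tmap (lcomp f' f) (lcomp g' g) u.
Proof.
by apply: (@tensor_ext _ _ _ (lcomp (tmap f' g') (tmap f g))) => m n;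
  rewrite /= -/(tmap _ _); change (tmap f' g' (tmap f g (tens m n)) = tmap (lcomp f' f) (lcomp g' g) (tens m n)); rewrite !tmap_tens.
Qed.

Lemma tmap_eq M N M' N' (f f' : {linear M -> M'}) (g g' : {linear N -> N'}) :
  f =1 f' -> g =1 g' -> tmap f g =1 tmap f' g'.
Proof.
by move=> ff gg; apply: tensor_ext => m n; rewrite !tmap_tens ff gg.
Qed.

Lemma tmap0l M N M' N' (f : {linear M -> M'}) (g : {linear N -> N'}) u :
  (forall x, f x = 0) -> tmap f g u = 0.
Proof.
move=> f0; apply: (@tensor_ext _ _ _ (tmap f g) (lzero _ _)) => m n.
by rewrite tmap_tens f0 tens0l.
Qed.

Lemma tmap0r M N M' N' (f : {linear M -> M'}) (g : {linear N -> N'}) u :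
  (forall x, g x = 0) -> tmap f g u = 0.
Proof.
move=> g0; apply: (@tensor_ext _ _ _ (tmap f g) (lzero _ _)) => m n.
by rewrite tmap_tens g0 tens0r.
Qed.

Lemma tswap_tmap M N M' N' (h : {linear M -> M'}) (k : {linear N -> N'})
  (x : tensor M N) :
  tswap _ _ (tmap h k x) = tmap k h (tswap _ _ x).
Proof.
apply: (@tensor_ext _ _ _ (lcomp (tswap _ _) (tmap h k)) (lcomp (tmap k h) (tswap _ _))) => m n.
change (tswap _ _ (tmap h k (tens m n)) = tmap k h (tswap _ _ (tens m n))).
by rewrite tswap_tens !tmap_tens tswap_tens.
Qed.

End TensorProduct.

Section Torsion.
Variable R : idomainType.
Implicit Types M N : lmodType R.

(* The standard free resolution of M: the free module on the set M, and the
   kernel of its augmentation, which is free when R is a PID. *)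
Definition faug M : {linear freem R M -> M} := flift (fun m : M => m).
Definition frel M : submodule (freem R M) := lker (faug M).

Lemma faug_fgen M (m : M) : faug M (fgen R m) = m.
Proof. exact: flift_fgen. Qed.

Lemma faug_frel M (k : subm (frel M)) : faug M (incl (frel M) k) = 0.
Proof. by case: k => k kP; exact: (elimT (lkerP _ _) kP). Qed.

Definition tor_ker M N : submodule (tensor (subm (frel M)) N) :=
  lker (tmap (incl (frel M)) (lid N)).

Definition tor M N : lmodType R := subm (tor_ker M N).

Section ElementaryTor.
Variables (M N : lmodType R) (a : M) (r : R) (b : N).
Hypotheses (ra : r *: a = 0) (rb : r *: b = 0).

Lemma lift_frel (x : freem R M) :
  faug M x = a -> r *: x \in smem (frel M).
Proof. by move=> xa; apply/lkerP; rewrite linearZ_LR xa. Qed.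

Lemma etor_subproof (x : freem R M) (xa : faug M x = a) :
  tens (Subm (lift_frel xa)) b \in smem (tor_ker M N).
Proof. by apply/lkerP; rewrite tmap_tens /= tensZl -tensZr rb tens0r. Qed.

(* <a, r, b>, computed with the lift [a] of a; see etor_lift for other lifts. *)
Definition etor : tor M N := Subm (etor_subproof (faug_fgen a)).

Lemma etor_lift (x : freem R M) (xa : faug M x = a) :
  etor = Subm (etor_subproof xa).
Proof.
apply: val_inj => /=; apply/eqP; rewrite -subr_eq0.
have dP : fgen R a - x \in smem (frel M).
  by apply/lkerP; rewrite linearB faug_fgen xa subrr.
rewrite -[X in X == _](linearB (tensl _ b)) /=.
have -> : Subm (lift_frel (faug_fgen a)) - Subm (lift_frel xa) = r *: Subm dP.
  apply: val_inj; rewrite linearZ linearB.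
  by change (r *: fgen R a - r *: x = r *: (fgen R a - x)); rewrite scalerBr.
by rewrite tensZl -tensZr rb tens0r.
Qed.

End ElementaryTor.

Section Map.
Variables (M M' : lmodType R) (f : {linear M -> M'}).

Definition fmap : {linear freem R M -> freem R M'} :=
  flift (fun m => fgen R (f m)).

Lemma fmap_fgen m : fmap (fgen R m) = fgen R (f m).
Proof. exact: flift_fgen. Qed.

Lemma faug_fmap x : faug M' (fmap x) = f (faug M x).
Proof.
apply: (@freem_ext _ _ _ (lcomp (faug M') fmap) (lcomp f (faug M))) => m.
by change (faug M' (fmap (fgen R m)) = f (faug M (fgen R m)));
  rewrite fmap_fgen !faug_fgen.
Qed.

Lemma rmap_subproof (k : subm (frel M)) :
  lcomp fmap (incl (frel M)) k \in smem (frel M').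
Proof.
by apply/lkerP; change (faug M' (fmap (incl _ k)) = 0); rewrite faug_fmap faug_frel linear0.
Qed.

Definition rmap : {linear subm (frel M) -> subm (frel M')} :=
  corestr rmap_subproof.

Lemma incl_rmap k : incl (frel M') (rmap k) = fmap (incl (frel M) k).
Proof. by []. Qed.

Variables (N N' : lmodType R) (g : {linear N -> N'}).

Lemma tor_map_subproof (t : tor M N) :
  lcomp (tmap rmap g) (incl (tor_ker M N)) t \in smem (tor_ker M' N').
Proof.
case: t => t tK; have t0 := elimT (lkerP _ _) tK; apply/lkerP.
change (tmap (incl (frel M')) (lid N') (tmap rmap g t) = 0).
rewrite tmap_comp (@tmap_eq _ _ _ _ _ _ (lcomp fmap (incl (frel M))) _ (lcomp g (lid N))) //.
by rewrite -tmap_comp t0 linear0.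
Qed.

Definition tor_map : {linear tor M N -> tor M' N'} := corestr tor_map_subproof.

Lemma incl_tor_map t : incl (tor_ker M' N') (tor_map t) = tmap rmap g (incl (tor_ker M N) t).
Proof. by []. Qed.

End Map.

Lemma tor_map_comp M M' M2 N N' N2 (f : {linear M -> M'}) (g : {linear N -> N'})
  (f' : {linear M' -> M2}) (g' : {linear N' -> N2}) t :
  tor_map f' g' (tor_map f g t) = tor_map (lcomp f' f) (lcomp g' g) t.
Proof.
apply: incl_inj; rewrite !incl_tor_map tmap_comp; apply: tmap_eq => // k.
apply: incl_inj; rewrite incl_rmap.
change (fmap f' (fmap f (incl (frel M) k)) = fmap (lcomp f' f) (incl (frel M) k)).
apply: (@freem_ext _ _ _ (lcomp (fmap f') (fmap f))) => m.
by change (fmap f' (fmap f (fgen R m)) = fmap (lcomp f' f) (fgen R m)); rewrite !fmap_fgen.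
Qed.

Lemma tor_map_eq M M' N N' (f f' : {linear M -> M'}) (g g' : {linear N -> N'}) :
  f =1 f' -> g =1 g' -> tor_map f g =1 tor_map f' g'.
Proof.
move=> ff gg t; apply: incl_inj; rewrite !incl_tor_map; apply: tmap_eq => // k.
apply: incl_inj; rewrite !incl_rmap; apply: freem_ext => m.
by rewrite !fmap_fgen ff.
Qed.

Lemma tor_map0r M M' N N' (f : {linear M -> M'}) (g : {linear N -> N'}) t :
  (forall x, g x = 0) -> tor_map f g t = 0.
Proof.
by move=> g0; apply: incl_inj; rewrite incl_tor_map tmap0r // linear0.
Qed.

Lemma tor_map0l M M' N N' (f : {linear M -> M'}) (g : {linear N -> N'}) t :
  (forall x, f x = 0) -> tor_map f g t = 0.
Proof.
move=> f0; apply: incl_inj; rewrite incl_tor_map linear0.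
have g0K : fgen R (0 : M') \in smem (frel M') by apply/lkerP; rewrite faug_fgen.
pose s : {linear R^o -> subm (frel M')} := scale_at (Subm g0K).
pose e : {linear freem R M -> R^o} := flift (fun _ : M => 1 : R^o).
have rmapE k : rmap f k = lcomp s (lcomp e (incl (frel M))) k.
  apply: incl_inj; rewrite incl_rmap.
  apply: (@freem_ext _ _ _ (fmap f) (lcomp (lcomp (incl (frel M')) s) e)) => m.
  change (fmap f (fgen R m) = incl (frel M') (s (e (fgen R m)))).
  by rewrite fmap_fgen f0 /e flift_fgen /s /= scale1r.
rewrite (tmap_eq rmapE (g' := lcomp g (lid N))) // -tmap_comp.
have -> : tmap (lcomp e (incl (frel M))) (lid N) (incl (tor_ker M N) t) =
          tmap e (lid N) (tmap (incl (frel M)) (lid N) (incl (tor_ker M N) t)).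
  by rewrite tmap_comp; apply: tmap_eq.
have -> : tmap (incl (frel M)) (lid N) (incl (tor_ker M N) t) = 0.
  by case: t => t tP; exact: (elimT (lkerP _ _) tP).
by rewrite !linear0.
Qed.

(* The natural isomorphism, determined by its values on elementary tors, since
   these generate. *)
Definition tor_swap M N : {linear tor M N -> tor N M} :=
  the_linear (fun I : {linear tor M N -> tor N M} =>
    forall (a : M) (r : R) (b : N) (ra : r *: a = 0) (rb : r *: b = 0),
      I (etor ra rb) = etor rb ra).

End Torsion.

Section Signs.
Variable R : idomainType.

Definition ksign (i : int) : R := (-1) ^ i.

Lemma ksignD i j : ksign (i + j) = ksign i * ksign j.
Proof. by rewrite /ksign exprzDr // unitrN unitr1. Qed.

Lemma ksign1 : ksign 1 = -1. Proof. by []. Qed.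

Lemma ksignN i : ksign (- i) = ksign i.
Proof. by rewrite /ksign -invr_expz expfV invrN invr1. Qed.

Lemma ksignB1 i : ksign (i - 1) = - ksign i.
Proof. by rewrite ksignD ksignN ksign1 mulrN1. Qed.

Lemma ksign2 i : ksign i * ksign i = 1.
Proof. by rewrite -[X in X * _]ksignN -ksignD addNr. Qed.

End Signs.

Record bideg (n : int) := Bideg {
  deg1 : int;
  deg2 : int;
  degE : deg1 + deg2 = n }.

HB.instance Definition _ n := gen_eqMixin (bideg n).

Section BidegreeShifts.
Variables (n : int) (p : bideg n).

Lemma bidegl_subproof : deg1 p - 1 + deg2 p = n - 1.
Proof. by rewrite addrAC degE. Qed.
Lemma bidegr_subproof : deg1 p + (deg2 p - 1) = n - 1.
Proof. by rewrite addrA degE. Qed.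
Lemma bidegs_subproof : deg2 p + deg1 p = n.
Proof. by rewrite addrC degE. Qed.

Definition bidegl : bideg (n - 1) := Bideg bidegl_subproof.
Definition bidegr : bideg (n - 1) := Bideg bidegr_subproof.
Definition bidegs : bideg n := Bideg bidegs_subproof.

End BidegreeShifts.

Section ChainComplexes.
Variable R : idomainType.

Record chainComplex := ChainComplex {
  cobj :> int -> lmodType R;
  cdiff : forall n, {linear cobj n -> cobj (n - 1)};
  cdiffK : forall n x, cdiff (n - 1) (cdiff n x) = 0 }.

Implicit Types A B C : chainComplex.

Record chainMap A B := ChainMap {
  cmap :> forall n, {linear A n -> B n};
  cmapd : forall n x, cdiff B n (cmap n x) = cmap (n - 1) (cdiff A n x) }.

Definition is_free_complex A := forall n, is_free (A n).

Section Homology.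
Variable A : chainComplex.

Definition cyc n : submodule (A n) := lker (cdiff A n).

Inductive is_boundary : forall n, A n -> Prop :=
  Boundary n (y : A n) : is_boundary (cdiff A n y).

Lemma is_boundaryP n (x : A n) : is_boundary x <->
  exists m (e : m - 1 = n) (y : A m), x = ecast k (A k) e (cdiff A m y).
Proof.
split; first by case=> m y; exists m, erefl, y.
by case=> m [e [y ->]]; case: _ / e.
Qed.

Lemma bnd_subproof n : submod_closed [pred x : A n | `[< is_boundary x >]].
Proof.
split=> [|a x y]; rewrite !inE.
  apply/asboolP/is_boundaryP; exists (n + 1), (addrK 1 n), 0.
  by rewrite linear0; have ecast0 m k (e : m = k) : 0 = ecast j (A j) e 0;
    [by case: _ / e|exact: ecast0].
move=> /asboolP/is_boundaryP [m [e [x' ->]]].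
move=> /asboolP/is_boundaryP [m' [e' [y' ->]]].
have mm : m' = m by rewrite -[m'](subrK 1) e' -e subrK.
subst m'; rewrite (eq_irrelevance e' e); subst n => /=.
by apply/asboolP; rewrite -linearP; exact: Boundary.
Qed.

Definition bnd n : submodule (A n) := Submodule (@bnd_subproof n).

Lemma bndP n (x : A n) : reflect (is_boundary x) (x \in smem (bnd n)).
Proof. exact: asboolP. Qed.

Lemma bdry_subproof n (x : A n) : cdiff A n x \in smem (bnd (n - 1)).
Proof. by apply/bndP; exact: Boundary. Qed.

Definition bdry n : {linear A n -> subm (bnd (n - 1))} :=
  corestr (@bdry_subproof n).

Lemma bnd_cyc_subproof n (x : subm (bnd n)) : incl (bnd n) x \in smem (cyc n).
Proof.
case: x => x xB; apply/lkerP; change (cdiff A n x = 0).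
by have {xB} := elimT (bndP _) xB; case: x / => m y; rewrite cdiffK.
Qed.

Definition bnd_cyc n : {linear subm (bnd n) -> subm (cyc n)} :=
  corestr (@bnd_cyc_subproof n).

Definition hbnd n : submodule (subm (cyc n)) :=
  preim_submodule (incl (cyc n)) (bnd n).

Definition homology n : lmodType R := quotm (hbnd n).

Definition hclass n : {linear subm (cyc n) -> homology n} := qproj (hbnd n).

Lemma hclass0 n (z : subm (cyc n)) :
  hclass n z = 0 <-> is_boundary (incl (cyc n) z).
Proof. by rewrite qproj0; split=> /bndP. Qed.

End Homology.

Definition acyclic A := forall n (h : homology A n), h = 0.

Section HomologyMap.
Variables (A B : chainComplex) (f : chainMap A B) (n : int).

Lemma cycmap_subproof (z : subm (cyc A n)) :
  lcomp (f n) (incl (cyc A n)) z \in smem (cyc B n).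
Proof.
case: z => z zC; apply/lkerP; change (cdiff B n (f n z) = 0).
by rewrite cmapd (elimT (lkerP _ _) zC) linear0.
Qed.

Definition cycmap : {linear subm (cyc A n) -> subm (cyc B n)} :=
  corestr cycmap_subproof.

Lemma cmap_boundary (x : A n) : is_boundary x -> is_boundary (f n x).
Proof. by case: x / => m y; rewrite -cmapd; exact: Boundary. Qed.

Lemma hmap_subproof (z : subm (cyc A n)) :
  z \in smem (hbnd A n) -> lcomp (hclass B n) cycmap z = 0.
Proof.
by move=> /bndP zB; apply/hclass0; exact: cmap_boundary.
Qed.

Definition hmap : {linear homology A n -> homology B n} := qlift hmap_subproof.

Lemma hmap_hclass z : hmap (hclass A n z) = hclass B n (cycmap z).
Proof. exact: qlift_qproj. Qed.

End HomologyMap.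

Definition quasi_iso A B (f : chainMap A B) := forall n, bijective (hmap f n).

(* The two differentials commute; the sign is put in tdiff. *)
Record doubleComplex := DoubleComplex {
  dobj :> int -> int -> lmodType R;
  dh : forall i j, {linear dobj i j -> dobj (i - 1) j};
  dv : forall i j, {linear dobj i j -> dobj i (j - 1)};
  dhh : forall i j x, dh (i - 1) j (dh i j x) = 0;
  dvv : forall i j x, dv i (j - 1) (dv i j x) = 0;
  dhv : forall i j x, dh i (j - 1) (dv i j x) = dv (i - 1) j (dh i j x) }.

Section Total.
Variable D : doubleComplex.

Definition tobj n : lmodType R := dsum (fun p : bideg n => D (deg1 p) (deg2 p)).

Definition tin n (p : bideg n) : {linear D (deg1 p) (deg2 p) -> tobj n} :=
  din (fun p : bideg n => D (deg1 p) (deg2 p)) p.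

Lemma tin_eq n i j (e e' : i + j = n) (x : D i j) :
  tin (Bideg e) x = tin (Bideg e') x.
Proof. by rewrite (eq_irrelevance e e'). Qed.

Definition tdiff n : {linear tobj n -> tobj (n - 1)} :=
  dlift (fun p : bideg n =>
    ladd (lcomp (tin (bidegl p)) (dh D (deg1 p) (deg2 p)))
         (lscale (ksign R (deg1 p))
            (lcomp (tin (bidegr p)) (dv D (deg1 p) (deg2 p))))).

Lemma tdiff_tin n (p : bideg n) x : tdiff n (tin p x) =
  tin (bidegl p) (dh D (deg1 p) (deg2 p) x) +
  ksign R (deg1 p) *: tin (bidegr p) (dv D (deg1 p) (deg2 p) x).
Proof. exact: dlift_din. Qed.

Lemma tdiffK n x : tdiff (n - 1) (tdiff n x) = 0.
Proof.
apply: (@dsum_ext _ _ _ _ (lcomp (tdiff (n - 1)) (tdiff n)) (lzero _ _)) => p y.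
change (tdiff (n - 1) (tdiff n (tin p y)) = 0).
have hh := @dhh D (deg1 p) (deg2 p) y; have vv := @dvv D (deg1 p) (deg2 p) y.
have hv := @dhv D (deg1 p) (deg2 p) y.
rewrite tdiff_tin linearD linearZ_LR !tdiff_tin.
rewrite [X in tin _ X](hh : dh D (deg1 (bidegl p)) _ _ = 0).
rewrite [X in _ + _ *: (_ + _ *: tin _ X)](vv : dv D _ (deg2 (bidegr p)) _ = 0).
rewrite [X in _ + _ *: (tin _ X + _)](hv : dh D (deg1 (bidegr p)) _ _ = _).
rewrite !(linear0, scaler0, add0r, addr0) [ksign R (deg1 (bidegl p))]ksignB1 scaleNr.
apply/eqP; rewrite [X in X == _]addrC subr_eq0; apply/eqP; congr (_ *: _).
exact: (@tin_eq _ (deg1 p - 1) (deg2 p - 1)).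
Qed.

Definition total : chainComplex := ChainComplex tdiffK.

End Total.

Section TensorComplex.
Variables A B : chainComplex.

Lemma tensorD_hh i j (x : tensor (A i) (B j)) :
  tmap (cdiff A (i - 1)) (lid (B j)) (tmap (cdiff A i) (lid (B j)) x) = 0.
Proof. by rewrite tmap_comp tmap0l //; exact: cdiffK. Qed.

Lemma tensorD_vv i j (x : tensor (A i) (B j)) :
  tmap (lid (A i)) (cdiff B (j - 1)) (tmap (lid (A i)) (cdiff B j) x) = 0.
Proof. by rewrite tmap_comp tmap0r //; exact: cdiffK. Qed.

Lemma tensorD_hv i j (x : tensor (A i) (B j)) :
  tmap (cdiff A i) (lid (B (j - 1))) (tmap (lid (A i)) (cdiff B j) x) =
  tmap (lid (A (i - 1))) (cdiff B j) (tmap (cdiff A i) (lid (B j)) x).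
Proof. by rewrite !tmap_comp; exact: tmap_eq. Qed.

Definition tensorD : doubleComplex :=
  DoubleComplex tensorD_hh tensorD_vv tensorD_hv.

Definition tensorC : chainComplex := total tensorD.

Lemma torD_hh i j (x : tor (A i) (B j)) :
  tor_map (cdiff A (i - 1)) (lid (B j)) (tor_map (cdiff A i) (lid (B j)) x) = 0.
Proof. by rewrite tor_map_comp tor_map0l //; exact: cdiffK. Qed.

Lemma torD_vv i j (x : tor (A i) (B j)) :
  tor_map (lid (A i)) (cdiff B (j - 1)) (tor_map (lid (A i)) (cdiff B j) x) = 0.
Proof. by rewrite tor_map_comp tor_map0r //; exact: cdiffK. Qed.

Lemma torD_hv i j (x : tor (A i) (B j)) :
  tor_map (cdiff A i) (lid (B (j - 1))) (tor_map (lid (A i)) (cdiff B j) x) =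
  tor_map (lid (A (i - 1))) (cdiff B j) (tor_map (cdiff A i) (lid (B j)) x).
Proof. by rewrite !tor_map_comp; exact: tor_map_eq. Qed.

Definition torD : doubleComplex := DoubleComplex torD_hh torD_vv torD_hv.

Definition torC : chainComplex := total torD.

End TensorComplex.

Section TensorMap.
Variables (A A' B B' : chainComplex) (f : chainMap A A') (g : chainMap B B').

Definition tensor_cmap_fun n : {linear tensorC A B n -> tensorC A' B' n} :=
  dmap (fun p : bideg n => tmap (f (deg1 p)) (g (deg2 p))).

Lemma tensor_cmap_tin n (p : bideg n) x :
  tensor_cmap_fun n (tin (tensorD A B) p x) =
  tin (tensorD A' B') p (tmap (f (deg1 p)) (g (deg2 p)) x).
Proof. exact: dmap_din. Qed.

Lemma tensor_cmap_subproof n x : cdiff (tensorC A' B') n (tensor_cmap_fun n x) =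
  tensor_cmap_fun (n - 1) (cdiff (tensorC A B) n x).
Proof.
apply: (@dsum_ext _ _ _ _
  (lcomp (cdiff (tensorC A' B') n) (tensor_cmap_fun n))
  (lcomp (tensor_cmap_fun (n - 1)) (cdiff (tensorC A B) n))) => p y.
change (tdiff (tensorD A' B') n (tensor_cmap_fun n (tin (tensorD A B) p y)) =
  tensor_cmap_fun (n - 1) (tdiff (tensorD A B) n (tin (tensorD A B) p y))).
rewrite tensor_cmap_tin !tdiff_tin linearD linearZ_LR !tensor_cmap_tin.
congr (_ + _ *: _); apply: (congr1 (tin (tensorD A' B') _));
  rewrite [LHS]tmap_comp [RHS]tmap_comp; apply: tmap_eq => // u; exact: cmapd.
Qed.

Definition tensor_cmap : chainMap (tensorC A B) (tensorC A' B') :=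
  ChainMap tensor_cmap_subproof.

End TensorMap.

Section Twist.
Variables A B : chainComplex.

Definition twist_fun n : {linear tensorC A B n -> tensorC B A n} :=
  dlift (fun p : bideg n => lscale (ksign R (deg1 p * deg2 p))
    (lcomp (tin (tensorD B A) (bidegs p)) (tswap (A (deg1 p)) (B (deg2 p))))).

Lemma twist_tin n (p : bideg n) x : twist_fun n (tin (tensorD A B) p x) =
  ksign R (deg1 p * deg2 p) *: tin (tensorD B A) (bidegs p) (tswap _ _ x).
Proof. exact: dlift_din. Qed.

Lemma twist_subproof n x : cdiff (tensorC B A) n (twist_fun n x) =
  twist_fun (n - 1) (cdiff (tensorC A B) n x).
Proof.
apply: (@dsum_ext _ _ _ _
  (lcomp (cdiff (tensorC B A) n) (twist_fun n))
  (lcomp (twist_fun (n - 1)) (cdiff (tensorC A B) n))) => p y.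
change (tdiff (tensorD B A) n (twist_fun n (tin (tensorD A B) p y)) =
  twist_fun (n - 1) (tdiff (tensorD A B) n (tin (tensorD A B) p y))).
rewrite twist_tin linearZ_LR !tdiff_tin [RHS]linearD [in RHS]linearZ_LR !twist_tin.
rewrite scalerDr !scalerA [LHS]addrC; congr (_ + _).
- congr (_ *: _).
    by change (ksign R (deg1 p * deg2 p) * ksign R (deg2 p) =
      ksign R ((deg1 p - 1) * deg2 p)); rewrite mulrBl mul1r ksignD ksignN.
  transitivity (tin (tensorD B A) (bidegr (bidegs p))
    (tswap _ _ (tmap (cdiff A (deg1 p)) (lid (B (deg2 p))) y))).
    by congr (tin _ _ _); rewrite tswap_tmap.
  exact: (@tin_eq (tensorD B A) _ (deg2 p) (deg1 p - 1)).
- congr (_ *: _).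
    change (ksign R (deg1 p * deg2 p) =
      ksign R (deg1 p) * ksign R (deg1 p * (deg2 p - 1))).
    by rewrite mulrBr mulr1 ksignD ksignN mulrCA ksign2 mulr1.
  transitivity (tin (tensorD B A) (bidegl (bidegs p))
    (tswap _ _ (tmap (lid (A (deg1 p))) (cdiff B (deg2 p)) y))).
    by congr (tin _ _ _); rewrite tswap_tmap.
  exact: (@tin_eq (tensorD B A) _ (deg2 p - 1) (deg1 p)).
Qed.

Definition twist : chainMap (tensorC A B) (tensorC B A) :=
  ChainMap twist_subproof.

End Twist.
End ChainComplexes.

Section Kunneth.
Variable R : idomainType.
Implicit Types A B FA FB : chainComplex R.

Section Cross.
Variables (A B : chainComplex R) (n : int) (p : bideg n).
Local Notation i := (deg1 p).
Local Notation j := (deg2 p).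

Lemma cross_cyc_subproof (z : subm (cyc A i)) (w : subm (cyc B j)) :
  tin (tensorD A B) p (tens (incl _ z) (incl _ w)) \in smem (cyc (tensorC A B) n).
Proof.
case: z w => z zC [w wC]; apply/lkerP.
change (tdiff (tensorD A B) n (tin (tensorD A B) p (tens z w)) = 0).
rewrite tdiff_tin.
have -> : dh (tensorD A B) i j (tens z w) = 0.
  by rewrite [LHS]tmap_tens (elimT (lkerP _ _) zC) tens0l.
have -> : dv (tensorD A B) i j (tens z w) = 0.
  by rewrite [LHS]tmap_tens (elimT (lkerP _ _) wC) tens0r.
by rewrite !linear0 add0r.
Qed.

Definition cross_cyc z w : subm (cyc (tensorC A B) n) :=
  Subm (cross_cyc_subproof z w).

Lemma cross_cyc_linearl w : linear (fun z => cross_cyc z w).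
Proof.
move=> a z z'; apply: incl_inj; rewrite [RHS]linearP.
change (tin (tensorD A B) p (tens (incl _ (a *: z + z')) (incl _ w)) =
  a *: tin (tensorD A B) p (tens (incl _ z) (incl _ w)) +
  tin (tensorD A B) p (tens (incl _ z') (incl _ w))).
by rewrite linearP tens_linearl linearP.
Qed.

Lemma cross_cyc_linearr z : linear (cross_cyc z).
Proof.
move=> a w w'; apply: incl_inj; rewrite [RHS]linearP.
change (tin (tensorD A B) p (tens (incl _ z) (incl _ (a *: w + w'))) =
  a *: tin (tensorD A B) p (tens (incl _ z) (incl _ w)) +
  tin (tensorD A B) p (tens (incl _ z) (incl _ w'))).
by rewrite linearP tens_linearr linearP.
Qed.

End Cross.

Lemma is_boundaryZ A n a (x : A n) : is_boundary x -> is_boundary (a *: x).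
Proof. by move/bndP=> xB; apply/bndP; rewrite rpredZ. Qed.

Lemma cross_boundaryl A B n i j (e : i + j = n) (x : A i) (y : B j) :
  is_boundary x -> cdiff B j y = 0 ->
  is_boundary (A := tensorC A B) (tin (tensorD A B) (Bideg e) (tens x y)).
Proof.
move=> xB; move: e y; case: i x / xB => i x e y y0.
have en : i + j - 1 = n by rewrite -e addrAC.
case: n / en e => e; pose u := tin (tensorD A B) (Bideg (erefl (i + j))) (tens x y).
have -> : tin (tensorD A B) (Bideg e) (tens (cdiff A i x) y) =
    cdiff (tensorC A B) (i + j) u; last exact: Boundary.
rewrite [RHS]tdiff_tin.
have -> : dv (tensorD A B) i j (tens x y) = 0.
  by rewrite [LHS]tmap_tens y0 tens0r.
have -> : dh (tensorD A B) i j (tens x y) = tens (cdiff A i x) y.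
  by rewrite [LHS]tmap_tens.
rewrite linear0 scaler0 addr0; exact: (@tin_eq _ (tensorD A B) _ (i - 1) j).
Qed.

Lemma cross_boundaryr A B n i j (e : i + j = n) (x : A i) (y : B j) :
  cdiff A i x = 0 -> is_boundary y ->
  is_boundary (A := tensorC A B) (tin (tensorD A B) (Bideg e) (tens x y)).
Proof.
move=> x0 yB; move: e x x0; case: j y / yB => j y e x x0.
have en : i + j - 1 = n by rewrite -e addrA.
case: n / en e => e; pose u := tin (tensorD A B) (Bideg (erefl (i + j))) (tens x y).
have -> : tin (tensorD A B) (Bideg e) (tens x (cdiff B j y)) =
    ksign R i *: cdiff (tensorC A B) (i + j) u.
  rewrite [X in _ *: X]tdiff_tin.
  have -> : dh (tensorD A B) i j (tens x y) = 0.
    by rewrite [LHS]tmap_tens x0 tens0l.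
  have -> : dv (tensorD A B) i j (tens x y) = tens x (cdiff B j y).
    by rewrite [LHS]tmap_tens.
  rewrite linear0 add0r scalerA ksign2 scale1r.
  exact: (@tin_eq _ (tensorD A B) _ i (j - 1)).
by apply: is_boundaryZ; exact: Boundary.
Qed.

Section CrossHomology.
Variables (A B : chainComplex R) (n : int) (p : bideg n).
Local Notation i := (deg1 p).
Local Notation j := (deg2 p).

(* [x] x [y] = [x (x) y], computed on representatives; see cross_hclass. *)
Definition cross (h : homology A i) (k : homology B j) :
    homology (tensorC A B) n :=
  hclass (tensorC A B) n (cross_cyc (qrepr h) (qrepr k)).

Lemma cross_hclass z w :
  cross (hclass A i z) (hclass B j w) = hclass (tensorC A B) n (cross_cyc z w).
Proof.
rewrite /cross; set z' := qrepr _; set w' := qrepr _.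
have zz : is_boundary (incl _ (z' - z)).
  by apply/hclass0; rewrite linearB /= qreprK subrr.
have ww : is_boundary (incl _ (w' - w)).
  by apply/hclass0; rewrite linearB /= qreprK subrr.
transitivity (hclass (tensorC A B) n (cross_cyc z w')).
  apply/eqP; rewrite -subr_eq0 -linearB; apply/eqP/hclass0.
  have -> : cross_cyc z' w' - cross_cyc z w' = cross_cyc (z' - z) w'.
    exact: esym (linearB (mklin (cross_cyc_linearl w')) z' z).
  case: p z w z' w' zz ww => i' j' e /= z w z' w' zz ww.
  by apply: cross_boundaryl => //; exact: (elimT (lkerP _ _) (smvalP _)).
apply/eqP; rewrite -subr_eq0 -linearB; apply/eqP/hclass0.
have -> : cross_cyc z w' - cross_cyc z w = cross_cyc z (w' - w).
  exact: esym (linearB (mklin (cross_cyc_linearr z)) w' w).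
case: p z w z' w' zz ww => i' j' e /= z w z' w' zz ww.
by apply: cross_boundaryr => //; exact: (elimT (lkerP _ _) (smvalP _)).
Qed.

Lemma cross_linearl k : linear (cross ^~ k).
Proof.
move=> a h h'; have [z ->] := qproj_surj h; have [z' ->] := qproj_surj h'.
have [w ->] := qproj_surj k; rewrite -linearP.
by rewrite !cross_hclass cross_cyc_linearl linearP.
Qed.

Lemma cross_linearr h : linear (cross h).
Proof.
move=> a k k'; have [w ->] := qproj_surj k; have [w' ->] := qproj_surj k'.
have [z ->] := qproj_surj h; rewrite -linearP.
by rewrite !cross_hclass cross_cyc_linearr linearP.
Qed.

End CrossHomology.

Definition tensorH A B (n : int) : lmodType R :=
  dsum (fun p : bideg n => tensor (homology A (deg1 p)) (homology B (deg2 p))).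

Definition torH A B (n : int) : lmodType R :=
  dsum (fun p : bideg n => tor (homology A (deg1 p)) (homology B (deg2 p))).

Definition kunneth_cross A B n :
    {linear tensorH A B n -> homology (tensorC A B) n} :=
  dlift (fun p : bideg n =>
    tlift (@cross_linearl A B n p) (@cross_linearr A B n p)).

Lemma kunneth_cross_hclass A B n (p : bideg n) z w :
  kunneth_cross A B n
    (din (fun q : bideg n => tensor (homology A (deg1 q)) (homology B (deg2 q)))
       p (tens (hclass A (deg1 p) z) (hclass B (deg2 p) w))) =
  hclass (tensorC A B) n (cross_cyc z w).
Proof. by rewrite [LHS]dlift_din tlift_tens cross_hclass. Qed.

(* The map of chain complexes A (x) B -> B(A)[-1] (x) B induced by the
   differential of A, where B(A) denotes the boundaries. *)
Definition partial_tensor A B n : {linear tensorC A B n ->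
    dsum (fun p : bideg (n - 1) => tensor (subm (bnd A (deg1 p))) (B (deg2 p)))} :=
  dlift (fun p : bideg n => lcomp
    (din (fun q : bideg (n - 1) => tensor (subm (bnd A (deg1 q))) (B (deg2 q)))
       (bidegl p))
    (tmap (bdry A (deg1 p)) (lid (B (deg2 p))))).

(* For a free resolution 0 -> K -> F -> M -> 0, the identification of
   ker (K (x) N -> F (x) N) with M * N: u corresponds to t when some comparison
   map from this resolution to the standard one carries u to t. *)
Definition tor_comparison (M N K F : lmodType R) (iota : {linear K -> F})
    (pi : {linear F -> M}) (u : tensor K N) (t : tor M N) : Prop :=
  tmap iota (lid N) u = 0 /\
  exists (phi : {linear F -> freem R M}) (psi : {linear K -> subm (frel M)}),
    [/\ forall x, faug M (phi x) = pi x,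
        forall k, incl (frel M) (psi k) = phi (iota k) &
        incl (tor_ker M N) t = tmap psi (lid N) u].

(* The graph of beta for free complexes: c is the class of a cycle z, the
   element partial_tensor z lifts to w in the sum of the B_i(A) (x) Z_j(B), and
   t is the image of w in the sum of the B_i(A) (x) H_j(B), whose components
   lie in ker (B_i(A) (x) H_j(B) -> Z_i(A) (x) H_j(B)) = H_i(A) * H_j(B). *)
Definition beta_free A B n (c : homology (tensorC A B) n)
    (t : torH A B (n - 1)) : Prop :=
  exists (z : subm (cyc (tensorC A B) n))
         (w : dsum (fun p : bideg (n - 1) =>
                tensor (subm (bnd A (deg1 p))) (subm (cyc B (deg2 p))))),
    [/\ hclass (tensorC A B) n z = c,
        dmap (fun p => tmap (lid (subm (bnd A (deg1 p)))) (incl (cyc B (deg2 p)))) w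
        = partial_tensor A B n (incl _ z) &
        forall p, tor_comparison (bnd_cyc A (deg1 p)) (hclass A (deg1 p))
          (tmap (lid (subm (bnd A (deg1 p)))) (hclass B (deg2 p)) (w p)) (t p)].

(* The graph of beta in general: transport along quasi-isomorphisms from free
   complexes. *)
Definition beta_graph A B n (c : homology (tensorC A B) n)
    (t : torH A B (n - 1)) : Prop :=
  exists (FA FB : chainComplex R) (f : chainMap FA A) (g : chainMap FB B)
         (c' : homology (tensorC FA FB) n) (t' : torH FA FB (n - 1)),
    [/\ is_free_complex FA /\ is_free_complex FB,
        quasi_iso f /\ quasi_iso g,
        beta_free c' t',
        hmap (tensor_cmap f g) n c' = c &
        dmap (fun p => tor_map (hmap f (deg1 p)) (hmap g (deg2 p))) t' = t].

Definition kunneth_beta A B n :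
    {linear homology (tensorC A B) n -> torH A B (n - 1)} :=
  the_linear (fun beta : {linear homology (tensorC A B) n -> torH A B (n - 1)} =>
    forall c, beta_graph c (beta c)).

Definition tensorH_swap A B n : {linear tensorH A B n -> tensorH B A n} :=
  dlift (fun p : bideg n => lscale (ksign R (deg1 p * deg2 p))
    (lcomp (din (fun q : bideg n =>
                   tensor (homology B (deg1 q)) (homology A (deg2 q))) (bidegs p))
           (tswap (homology A (deg1 p)) (homology B (deg2 p))))).

Definition torH_swap A B n : {linear torH A B n -> torH B A n} :=
  dlift (fun p : bideg n => lscale (ksign R (deg1 p * deg2 p + 1))
    (lcomp (din (fun q : bideg n =>
                   tor (homology B (deg1 q)) (homology A (deg2 q))) (bidegs p))
           (tor_swap (homology A (deg1 p)) (homology B (deg2 p))))).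

End Kunneth.

(* Main.v *)
(* Over a PID submodules of free modules are free, so every complex receives a
   surjective quasi-isomorphism from a free complex, chain maps out of free
   complexes lift strictly through such resolutions, and free acyclic complexes
   are contractible.  If K is the kernel of a resolution F -> A, then
     0 -> A * B -> K (x) B -> F (x) B -> A (x) B -> 0
   is exact; when A * B is acyclic, so are the first two terms, and the last map
   is a quasi-isomorphism.  Hence beta can be computed on one pair of free
   resolutions, and the other pairs give the same value by strict lifting.

   For free A and B and a cycle z, the component in A_i (x) B_j of (d (x) 1) z is
   -(-1)^i times that of (1 (x) d) z.  It therefore comes from an element w of
   B_i(A) (x) Z_j(B) and from an element x of Z_i(A) (x) B_j(B) with the same image
   in Z_i(A) (x) Z_j(B).  The class of w is beta(z), the class of x is beta(T z) up
   to the sign (-1)^(ij+1), and chasing in the tensor product of two resolutions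
   shows that I exchanges the two classes.  The values of I on elementary tors
   determine it because these generate Tor over a PID.

   Conversely, if s_A and s_B are sections of the differentials, such a pair (w, x)
   gives the cycle (s_A (x) 1) w - (-1)^i (1 (x) s_B) x, which defines a section
   sigma of beta; then T sigma I^-1 is a compatible section for (B, A). *)

Require Import Defs.
From mathcomp Require Import all_boot ssralg ssrint.
From mathcomp Require Import boolp wochoice.

Set Implicit Arguments.
Unset Strict Implicit.
Unset Printing Implicit Defensive.
Import GRing.Theory.
Local Open Scope ring_scope.

(* Hidden by the [frel] of eqtype. *)
Local Notation frel := Defs.frel.

(** * Modules over a principal ideal domain *)

Section WellOrder.
Variable T : eqType.

(** The well-ordering theorem, recast as a strict order with an induction principle. It will order
    the basis of a free module, so that linear combinations have leading terms. *)
Lemma exists_well_founded_total_order : exists lt : rel T,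
  [/\ irreflexive lt, transitive lt, (forall x y, x != y -> lt x y || lt y x) &
      forall P : T -> Prop,
        (forall x, (forall y, lt y x -> P y) -> P x) -> forall x, P x].
Proof.
have [le leW] := well_ordering_principle T.
have leW' : wo_chain le predT by move=> A _; exact: leW.
have tot x y : le x y || le y x by exact: (wo_chainW leW').
have refl x : le x x by exact: (wo_chain_reflexive leW').
have anti : antisymmetric le.
  by move=> x y; apply: (wo_chain_antisymmetric leW').
(* Transitivity of [le] is read off from the least element of a three-element set. *)
have min3 x y z : exists2 m, m \in [:: x; y; z] &
    forall u, u \in [:: x; y; z] -> le m u.
  have [|m [[mA mL] _]] := leW [pred u | u \in [:: x; y; z]].
    by exists x; rewrite !inE eqxx.
  by exists m => // u uA; apply: mL.
have trans : transitive le.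
  move=> y x z xy yz; have [m] := min3 x y z.
  rewrite !inE => /or3P[] /eqP-> mL; first by apply: mL; rewrite !inE eqxx !orbT.
    by rewrite (anti x y) // xy mL // !inE eqxx.
  by rewrite -(anti y z) // yz mL // !inE eqxx !orbT.
exists (fun x y => (x != y) && le x y); split.
- by move=> x; rewrite eqxx.
- move=> y x z /andP[xy lxy] /andP[yz lyz]; rewrite (trans y) // andbT.
  by apply: contraNneq xy => xz; subst z; apply/eqP/anti; rewrite lxy.
- by move=> x y xy; rewrite xy eq_sym xy tot.
move=> P IH x; apply: contrapT => nPx.
have [|m [[mA mL] _]] := leW [pred u | `[< ~ P u >]].
  by exists x; rewrite inE; apply/asboolP.
move: (mA); rewrite inE => /asboolP; apply; apply: IH => y /andP[ym lym].
apply: contrapT => nPy; move/eqP: ym; apply; apply: anti; rewrite lym /=.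
by apply: mL; rewrite inE; apply/asboolP.
Qed.

End WellOrder.

Lemma exists_max (T : eqType) (lt : rel T) (s : seq T) :
  irreflexive lt -> transitive lt -> (forall x y, x != y -> lt x y || lt y x) ->
  s != [::] -> exists2 m, m \in s & forall x, x \in s -> ~~ lt m x.
Proof.
move=> irr tr tot; elim: s => // x s IH _.
have [->|s0] := eqVneq s [::].
  by exists x; rewrite ?mem_head // => y; rewrite inE => /eqP->; rewrite irr.
have [m ms mmax] := IH s0; have [lmx|nlmx] := boolP (lt m x).
  exists x; rewrite ?mem_head // => y; rewrite inE => /predU1P[->|ys].
    by rewrite irr.
  by apply: contra (mmax y ys) => /(tr _ _ _ lmx).
exists m; first by rewrite inE ms orbT.
by move=> y; rewrite inE => /predU1P[->|/mmax].
Qed.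

Section LinearExtras.
Variable R : idomainType.
Implicit Types U V W : lmodType R.

(** Two values at one point differ by a value at 0, so the relation is single-valued. Hence the
    symmetry of Tor and beta can be described by diagram chases and become linear maps
    afterwards. *)
Lemma linear_of_rel U V (P : U -> V -> Prop) :
  (forall u, exists v, P u v) ->
  (forall a u u' v v', P u v -> P u' v' -> P (a *: u + u') (a *: v + v')) ->
  (forall v, P 0 v -> v = 0) ->
  exists f : {linear U -> V}, forall u v, P u v <-> v = f u.
Proof.
move=> tot lin zero.
have uniq u v v' : P u v -> P u v' -> v' = v.
  move=> Pv /(lin (-1) _ _ _ _ Pv); rewrite !scaleN1r addNr => /zero /eqP.
  by rewrite addrC subr_eq0 => /eqP.
have [f Pf] := choice tot.
have fL : linear f.
  by move=> a u u'; apply: (@uniq (a *: u + u')) => //; exact: lin.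
by exists (mklin fL) => u v; split=> [/(uniq _ _ _ (Pf u)) | ->]; [|exact: Pf].
Qed.

Lemma linear_inverse U V (f : {linear U -> V}) : bijective f ->
  exists g : {linear V -> U}, cancel f g /\ cancel g f.
Proof.
move=> [g fK gK]; have gL : linear g.
  by move=> a x y; apply: (can_inj fK); rewrite linearP !gK.
by exists (mklin gL); split.
Qed.

Lemma injective0 U V (f : {linear U -> V}) :
  (forall x, f x = 0 -> x = 0) -> injective f.
Proof.
move=> f0 x y /eqP; rewrite -subr_eq0 -linearB => /eqP /f0 /eqP.
by rewrite subr_eq0 => /eqP.
Qed.

Lemma bijective_inj_surj (U V : choiceType) (f : U -> V) :
  injective f -> (forall y, exists x, f x = y) -> bijective f.
Proof.
move=> fI fS; have [g gK] := choice fS; exists g => // x.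
by apply: fI; rewrite gK.
Qed.

Lemma bijective_surj (U V : Type) (f : U -> V) : bijective f ->
  forall y, exists x, f x = y.
Proof. by case=> g _ gK y; exists (g y). Qed.

End LinearExtras.

Section PID.
Variable R : idomainType.
Hypothesis R_pid : @is_pid R.

(** Dividing [g = u * a + v * b] by the generator [g] makes the cofactors coprime; the matrix with
    rows [(u, v)] and [(- b', a')] has determinant 1 and serves as a row operation. *)
Lemma pid_bezout (a b : R) : exists g a' b' u v,
  [/\ a = a' * g, b = b' * g & u * a' + v * b' = 1].
Proof.
have IP : submod_closed [pred x : R^o | `[< exists u v, x = u * a + v * b >]].
  split=> [|c x y]; rewrite !inE; first by apply/asboolP; exists 0, 0; rewrite !mul0r addr0.
  move=> /asboolP[u [v ->]] /asboolP[u' [v' ->]]; apply/asboolP.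
  exists (c * u + u'), (c * v + v').
  by rewrite /GRing.scale /= !mulrDl mulrDr !mulrA addrACA.
have [g gP] := R_pid (Submodule IP).
have [a' aE] : exists r, a = r * g.
  by apply/gP; rewrite inE; apply/asboolP; exists 1, 0; rewrite mul0r mul1r addr0.
have [b' bE] : exists r, b = r * g.
  by apply/gP; rewrite inE; apply/asboolP; exists 0, 1; rewrite mul0r mul1r add0r.
have /gP : exists r, g = r * g by exists 1; rewrite mul1r.
rewrite inE => /asboolP[u [v gE]].
have [g0|gN0] := eqVneq g 0.
  (* If [g] is 0 nothing can be cancelled, but then [a] and [b] vanish and the cofactors 1 and 0
     do. *)
  by exists 0, 1, 0, 1, 0; rewrite aE bE g0 !mulr0 mulr1 addr0.
exists g, a', b', u, v; split=> //; apply: (mulIf gN0).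
by rewrite mul1r mulrDl -!mulrA -aE -bE -gE.
Qed.

Definition rdvd (a b : R) : Prop := exists r, b = r * a.

Lemma rdvd_trans b a c : rdvd a b -> rdvd b c -> rdvd a c.
Proof. by move=> [r ->] [s ->]; exists (s * r); rewrite mulrA. Qed.

(* Ascending chain condition: the union of an infinite chain of principal ideals
   is principal, so the chain is stationary. *)
Lemma pid_ind (P : R -> Prop) :
  (forall d, (forall g, rdvd g d -> ~ rdvd d g -> P g) -> P d) -> forall d, P d.
Proof.
move=> IH d; apply: contrapT => nPd.
have next (x : {x | ~ P x}) :
    exists y : {x | ~ P x}, rdvd (sval y) (sval x) /\ ~ rdvd (sval x) (sval y).
  case: x => x nPx; apply: contrapT => H; apply: (nPx); apply: IH => g gx xg.
  by apply: contrapT => nPg; apply: H; exists (exist _ g nPg).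
have [f fP] := choice next.
pose c n := sval (iter n f (exist _ d nPd)).
have cS n : rdvd (c n.+1) (c n) /\ ~ rdvd (c n) (c n.+1) by exact: fP.
have cle m n : (m <= n)%N -> rdvd (c n) (c m).
  move=> /subnK <-; elim: (n - m)%N => [|k IHk]; first by exists 1; rewrite mul1r.
  by apply: rdvd_trans IHk; rewrite addSn; exact: (cS _).1.
have IP : submod_closed [pred x : R^o | `[< exists n, rdvd (c n) x >]].
  split=> [|a x y]; rewrite !inE; first by apply/asboolP; exists 0, 0; rewrite mul0r.
  move=> /asboolP[m mx] /asboolP[n ny]; apply/asboolP; exists (maxn m n).
  have [r ->] := rdvd_trans (cle m _ (leq_maxl m n)) mx.
  have [s ->] := rdvd_trans (cle n _ (leq_maxr m n)) ny.
  by exists (a * r + s); rewrite mulrDl -mulrA.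
have [g gP] := R_pid (Submodule IP).
have /gP : exists r, g = r * g by exists 1; rewrite mul1r.
rewrite inE => /asboolP[n ng]; apply: (cS n).2; apply: rdvd_trans ng _.
by apply/gP; rewrite inE; apply/asboolP; exists n.+1, 1; rewrite mul1r.
Qed.

End PID.

Section FreeModules.
Variable R : idomainType.
Implicit Types U V W : lmodType R.

Lemma freem_free (X : eqType) : is_free (freem R X).
Proof. by exists X, (lid _); exists id. Qed.

Lemma free_lift (P : lmodType R) V W (g : {linear V -> W}) (h : {linear P -> W}) :
  is_free P -> (forall x, exists v, g v = h x) ->
  exists k : {linear P -> V}, forall x, g (k x) = h x.
Proof.
move=> [X [e eB]] gh; have [f [ef fe]] := linear_inverse eB.
have [v vP] := choice (fun x : X => gh (e (fgen R x))).
exists (lcomp (flift v) f) => x; rewrite -{2}[x]fe.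
apply: (@freem_ext _ _ _ (lcomp g (flift v)) (lcomp h e)) => y.
by change (g (flift v (fgen R y)) = h (e (fgen R y))); rewrite flift_fgen.
Qed.

Lemma free_section (P : lmodType R) V (g : {linear V -> P}) :
  is_free P -> (forall x, exists v, g v = x) ->
  exists s : {linear P -> V}, forall x, g (s x) = x.
Proof. by move=> Pf gS; have [s sP] := free_lift (h := lid P) Pf gS; exists s. Qed.

Lemma flift_eval (X : eqType) V (h : X -> V) (s : seq X) (u : freem R X) : uniq s ->
  (forall x, x \notin s -> u x = 0) ->
  flift h u = \sum_(x <- s) (u x : R) *: h x.
Proof. exact: dlift_funE. Qed.

(** * Submodules of free modules over a PID *)

Section SubmoduleFree.
Hypothesis R_pid : @is_pid R.
Variables (V : lmodType R) (X : eqType) (c : {linear V -> freem R X}).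
Hypothesis c_inj : injective c.
Variable S : submodule V.
Variable lt : rel X.
Hypotheses (lt_irr : irreflexive lt) (lt_tr : transitive lt)
  (lt_tot : forall x y, x != y -> lt x y || lt y x)
  (lt_ind : forall P : X -> Prop,
        (forall x, (forall y, lt y x -> P y) -> P x) -> forall x, P x).

Let below (v : V) x := forall y, lt x y -> c v y = 0.

(** This ideal of leading coefficients at [x] is principal; elements of [S] realising its generators
    are the candidate basis. *)
Let leading_subproof x : submod_closed [pred r : R^o |
  `[< exists v, [/\ v \in smem S, below v x & c v x = r] >]].
Proof.
split=> [|a r r']; rewrite !inE.
  by apply/asboolP; exists 0; split=> [|y _|]; rewrite ?rpred0 ?linear0.
move=> /asboolP[v [vS vx <-]] /asboolP[v' [v'S v'x <-]]; apply/asboolP.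
exists (a *: v + v'); split; first by rewrite rpredD ?rpredZ.
  by move=> y xy; rewrite linearP /= vx ?v'x // scaler0 addr0.
by rewrite linearP.
Qed.

Let leading_basis : exists (a : X -> R) (u : X -> V), forall x,
  [/\ u x \in smem S, below (u x) x, c (u x) x = a x &
      forall v, v \in smem S -> below v x -> exists r, c v x = r * a x :> R].
Proof.
have aP x : exists p : R * V,
  [/\ p.2 \in smem S, below p.2 x, c p.2 x = p.1 &
      forall v, v \in smem S -> below v x -> exists r, c v x = r * p.1 :> R].
  have [a aE] := R_pid (Submodule (leading_subproof x)).
  have /aE : exists r, a = r * a by exists 1; rewrite mul1r.
  rewrite inE => /asboolP[u [uS ux ua]]; exists (a, u); split=> // v vS vx.
  by apply/aE; rewrite inE; apply/asboolP; exists v.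
by have [p pP] := choice aP; exists (fun x => (p x).1), (fun x => (p x).2).
Qed.

Lemma leading_term v : v != 0 -> exists2 x, c v x != 0 & below v x.
Proof.
move=> v0; pose s := [seq x <- dsupp (c v) | c v x != 0].
have sP x : (x \in s) = (c v x != 0).
  rewrite mem_filter; have [_|/dsupp_out ->] := boolP (x \in dsupp (c v)).
    by rewrite andbT.
  by rewrite eqxx.
have [|m ms mmax] := @exists_max X lt s lt_irr lt_tr lt_tot.
  apply: contra v0 => /eqP s0; apply/eqP/c_inj; rewrite linear0.
  by apply: dsum_eq => x; apply/eqP; rewrite -[_ == _]negbK -sP s0.
exists m; first by rewrite -sP.
by move=> y my; apply/eqP; apply: contraTT my; rewrite -sP => /mmax.
Qed.

(** The [u x] with [a x != 0] form a basis: their leading positions are distinct, which gives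
    independence, and subtracting a multiple of [u x] lowers the leading position, which gives
    generation by well-founded induction. *)
Lemma submodule_free_coord : is_free (subm S).
Proof.
have [a [u uP]] := leading_basis.
pose Y : eqType := {x : X | a x != 0}.
have uS (y : Y) : u (val y) \in smem S by have [] := uP (val y).
pose b : {linear freem R Y -> subm S} := flift (fun y => Subm (uS y)).
have bE (w : freem R Y) s x : uniq s -> (forall y, y \notin s -> w y = 0) ->
    c (incl S (b w)) x = \sum_(y <- s) (w y : R) * c (u (val y)) x.
  move=> us sw; rewrite (flift_eval _ us sw) !linear_sum dsum_sum.
  by apply: eq_bigr => y _; rewrite !linearZ.
exists Y, b; apply: bijective_inj_surj.
- apply: injective0 => w bw0; apply: contrapT => w0.
  pose s := [seq y <- dsupp w | w y != 0].
  have us : uniq s by rewrite filter_uniq ?undup_uniq.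
  have sP y : (y \in s) = (w y != 0).
    rewrite mem_filter; have [_|/dsupp_out ->] := boolP (y \in dsupp w).
      by rewrite andbT.
    by rewrite eqxx.
  have [||||m ms mmax] :=
      @exists_max Y (fun y z => lt (val y) (val z)) s.
  + by move=> y; exact: lt_irr.
  + by move=> y x z; exact: lt_tr.
  + by move=> y z yz; exact: (lt_tot (yz : val y != val z)).
  + apply: contra_notN w0 => /eqP s0; apply: dsum_eq => y.
    by apply/eqP; apply: contraT; rewrite -sP s0.
  have sw y : y \notin s -> w y = 0 by rewrite sP negbK => /eqP.
  (* At the largest index [m] of the support only [u m] contributes, the other leading positions
     lying below [m]. *)
  have := bE w s (val m) us sw; rewrite bw0 !linear0 (bigD1_seq m) //= big1_seq.
    have [_ _ -> _] := uP (val m); rewrite addr0 => /esym/eqP.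
    by rewrite mulf_eq0 (negPf (valP m)) orbF; apply/negP; rewrite -sP.
  move=> y /andP[ym ys]; have [_ ub _ _] := uP (val y).
  rewrite ub ?mulr0 //; have /orP[//|my] := lt_tot (ym : val y != val m).
  by rewrite (negPf (mmax _ ys)) in my.
- suff H x : forall v (vS : v \in smem S), below v x -> exists w, b w = Subm vS.
    case=> v vS; have [v0|/leading_term[x _ vx]] := eqVneq v 0.
      by exists 0; rewrite linear0; apply: incl_inj.
    exact: H vx.
  elim/lt_ind: x => x IH v vS vx.
  have [uxS ub ua /(_ v vS vx)[r vr]] := uP x.
  (* The induction hypothesis in usable form: once all coefficients at and above [x] vanish, the
     leading position is below [x]. *)
  have lower v' (v'S : v' \in smem S) : (forall y, lt x y \/ y = x -> c v' y = 0) ->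
      exists w, b w = Subm v'S.
    move=> v'b; have [v'0|/leading_term[y v'y yb]] := eqVneq v' 0.
      by exists 0; rewrite linear0; apply: incl_inj.
    apply: (IH y) => //; have [yx|yx] := eqVneq y x.
      by rewrite v'b ?eqxx in v'y; [|right].
    have /orP[//|xy] := lt_tot yx.
    by rewrite v'b ?eqxx in v'y; [|left].
  (* If the ideal at [x] is zero, no basis element sits there, but the coefficient of [v] at [x] is
     already 0. *)
  have [a0|a0] := eqVneq (a x) 0.
    by apply: lower => y [/vx //|->]; rewrite vr a0 mulr0.
  have v'S : v - r *: u x \in smem S by rewrite rpredB ?rpredZ.
  have [y xy|w wE] := lower _ v'S.
    rewrite linearB linearZ /=; case: xy => [xy|->].
      by rewrite vx // ub // scaler0 oppr0 addr0.
    by rewrite vr ua subrr.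
  exists (w + r *: fgen R (exist _ x a0 : Y)); rewrite linearD linearZ wE flift_fgen.
  by apply: incl_inj; rewrite [LHS]linearD [X in _ + X]linearZ; exact: subrK.
Qed.

End SubmoduleFree.

Lemma submodule_free V (S : submodule V) :
  @is_pid R -> is_free V -> is_free (subm S).
Proof.
move=> R_pid [X [e /linear_inverse[c [_ cK]]]].
have [lt [irr tr tot ind]] := exists_well_founded_total_order X.
by apply: (submodule_free_coord R_pid (c := c) (can_inj cK) S irr tr tot ind).
Qed.

End FreeModules.

(** * Tensor products and flatness *)

Section TensorFacts.
Variable R : idomainType.
Implicit Types K L M N P U V W F G : lmodType R.

Lemma din_fgen (X : eqType) (x : X) (r : R) :
  din (fun _ : X => R^o) x r = r *: fgen R x.
Proof.
rewrite /fgen -[in RHS]linearZ; congr (din (fun _ : X => R^o) x _).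
by rewrite -[LHS]mulr1.
Qed.

Lemma tensor_sum M N (u : tensor M N) :
  exists s : seq (M * N), u = \sum_(p <- s) tens p.1 p.2.
Proof.
have [v ->] := qproj_surj u; exists [seq ((v p : R) *: p.1, p.2) | p <- dsupp v].
rewrite {1}[v]dsumE linear_sum big_map; apply: eq_bigr => -[m n] _.
by rewrite [X in qproj _ X]din_fgen linearZ [RHS]tensZl.
Qed.

Lemma tmap_id M N (f : {linear M -> M}) (g : {linear N -> N}) u :
  f =1 id -> g =1 id -> tmap f g u = u.
Proof.
move=> f1 g1; apply: (@tensor_ext _ _ _ _ (tmap f g) (lid _)) => m n.
by rewrite tmap_tens f1 g1.
Qed.

Lemma tmap_square M N M1 N1 M2 N2 M3 N3
  (c : {linear M -> M1}) (c' : {linear N -> N1})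
  (d : {linear M1 -> M3}) (d' : {linear N1 -> N3})
  (a : {linear M -> M2}) (a' : {linear N -> N2})
  (b : {linear M2 -> M3}) (b' : {linear N2 -> N3}) u :
  (forall x, b (a x) = d (c x)) -> (forall y, b' (a' y) = d' (c' y)) ->
  tmap b b' (tmap a a' u) = tmap d d' (tmap c c' u).
Proof. by move=> e e'; rewrite !tmap_comp; exact: tmap_eq. Qed.

Lemma tmap_lcompl M N M1 M2 N1 (h : {linear M1 -> M2}) (f : {linear M -> M1})
  (g : {linear N -> N1}) u :
  tmap (lcomp h f) g u = tmap h g (tmap f (lid N) u).
Proof. by rewrite tmap_comp; exact: tmap_eq. Qed.

Lemma tmap_addl M N M' N' (f f' : {linear M -> M'}) (g : {linear N -> N'}) u :
  tmap (ladd f f') g u = tmap f g u + tmap f' g u.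
Proof.
apply: (@tensor_ext _ _ _ _ (tmap _ _) (ladd (tmap f g) (tmap f' g))) => m n.
change (tmap (ladd f f') g (tens m n) = tmap f g (tens m n) + tmap f' g (tens m n)).
rewrite !tmap_tens; exact: (linearD (tensl M' (g n))).
Qed.

Lemma tswapK M N u : tswap N M (tswap M N u) = u.
Proof.
apply: (@tensor_ext _ _ _ _ (lcomp (tswap N M) (tswap M N)) (lid _)) => m n.
by change (tswap N M (tswap M N (tens m n)) = tens m n); rewrite !tswap_tens.
Qed.

Lemma tmap_surj M N M' N' (f : {linear M -> M'}) (g : {linear N -> N'}) :
  (forall y, exists x, f x = y) -> (forall y, exists x, g x = y) ->
  forall u, exists v, tmap f g v = u.
Proof.
move=> fS gS u; have [s ->] := tensor_sum u.
elim: s => [|[m n] s [v vE]]; first by exists 0; rewrite linear0 big_nil.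
have [x xE] := fS m; have [y yE] := gS n; exists (tens x y + v).
by rewrite linearD tmap_tens xE yE vE big_cons.
Qed.

Lemma range_subproof U V (f : {linear U -> V}) :
  submod_closed [pred y | `[< exists x, f x = y >]].
Proof.
split=> [|a x y]; rewrite !inE; first by apply/asboolP; exists 0; rewrite linear0.
move=> /asboolP[x' <-] /asboolP[y' <-]; apply/asboolP.
by exists (a *: x' + y'); rewrite linearP.
Qed.

Definition lrange U V (f : {linear U -> V}) : submodule V :=
  Submodule (range_subproof f).

Lemma lrangeP U V (f : {linear U -> V}) y :
  reflect (exists x, f x = y) (y \in smem (lrange f)).
Proof. exact: asboolP. Qed.

Lemma factor_inj U V W (i : {linear V -> W}) (f : {linear U -> W}) :
  injective i -> (forall x, exists y, i y = f x) ->
  exists h : {linear U -> V}, forall x, i (h x) = f x.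
Proof.
move=> iI iS; have [|||h hP] := @linear_of_rel _ U V (fun x y => i y = f x).
- exact: iS.
- by move=> a u u' v v' vu v'u'; rewrite !linearP vu v'u'.
- by move=> v; rewrite linear0 -(linear0 i) => /iI.
by exists h => x; apply/hP.
Qed.

Section RightExact.
Variables (K F M N : lmodType R) (f : {linear K -> F}) (p : {linear F -> M}).
Hypotheses (p_surj : forall y, exists x, p x = y)
  (p_ker : forall x, p x = 0 -> exists k, f k = x).

(** The map from the cokernel of [f (x) 1] to [M (x) N] is inverted: [m (x) n] goes to the class of
    [s m (x) n] for a set-theoretic section [s] of [p]. Exactness makes this class independent of
    the lift, hence bilinear. *)
Lemma tensor_right_exactl (u : tensor F N) : tmap p (lid N) u = 0 ->
  exists k, tmap f (lid N) k = u.
Proof.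
pose S := lrange (tmap f (lid N)); have [s sP] := choice p_surj.
pose b m n := qproj S (tens (s m) n).
have bE x n : b (p x) n = qproj S (tens x n).
  apply/eqP; rewrite -subr_eq0 -linearB; apply/eqP/qproj0/lrangeP.
  have [|k kE] := p_ker (x := s (p x) - x); first by rewrite linearB sP subrr.
  by exists (tens k n); rewrite tmap_tens kE; exact: (linearB (tensl F n)).
have bl n : linear (b^~ n).
  move=> a y y'; have [x <-] := p_surj y; have [x' <-] := p_surj y'.
  by rewrite -linearP !bE tens_linearl linearP.
have br m : linear (b m) by move=> a n n'; rewrite /b tens_linearr linearP.
move=> u0; apply/lrangeP/qproj0.
suff <- : tlift bl br (tmap p (lid N) u) = qproj S u by rewrite u0 linear0.
apply: (@tensor_ext _ _ _ _ (lcomp (tlift bl br) (tmap p (lid N))) (qproj S)) => x n.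
change (tlift bl br (tmap p (lid N) (tens x n)) = qproj S (tens x n)).
by rewrite tmap_tens tlift_tens bE.
Qed.

End RightExact.

Lemma tmap_swapl M N M' N' (f : {linear M -> M'}) (g : {linear N -> N'}) u :
  tmap f g u = tswap _ _ (tmap g f (tswap _ _ u)).
Proof. by rewrite tswap_tmap tswapK. Qed.

Definition flat V := forall U U' (f : {linear U -> U'}),
  injective f -> injective (tmap f (lid V)).

Lemma flatr V : flat V -> forall U U' (f : {linear U -> U'}),
  injective f -> injective (tmap (lid V) f).
Proof.
move=> Vf U U' f fI; apply: injective0 => u; rewrite tmap_swapl => /eqP.
rewrite -(linear0 (tswap U' V)) (inj_eq (can_inj (@tswapK _ _))) => /eqP.
rewrite -(linear0 (tmap f (lid V))) => /(Vf _ _ f fI) /eqP.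
by rewrite -(linear0 (tswap V U)) (inj_eq (can_inj (@tswapK _ _))) => /eqP.
Qed.

Lemma tensor_right_exactr K F M N (f : {linear K -> F}) (p : {linear F -> M}) :
  (forall y, exists x, p x = y) -> (forall x, p x = 0 -> exists k, f k = x) ->
  forall u : tensor N F, tmap (lid N) p u = 0 -> exists k, tmap (lid N) f k = u.
Proof.
move=> pS pK u u0; have [|k kE] := tensor_right_exactl (N := N) pS pK (u := tswap _ _ u).
  by rewrite -tswap_tmap u0 linear0.
by exists (tswap _ _ k); rewrite -tswap_tmap kE tswapK.
Qed.

(** Tensoring [U] with a free module embeds, by [gam] with left inverse [del], into a direct sum of
    copies of [U], naturally in [U]; there injectivity is checked componentwise. *)
Lemma freem_flat (X : eqType) : flat (freem R X).
Proof.
pose b U (m : U) (v : freem R X) : dsum (fun _ : X => U) :=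
  dmap (fun _ : X => scale_at m) v.
have bE U m v x : b U m v x = v x *: m by rewrite [LHS]dmapE.
have bl U v : linear ((b U)^~ v).
  by move=> a m m'; apply: dsum_eq => x; rewrite /= !bE scalerDr !scalerA mulrC.
have br U m : linear (b U m) by move=> a v v'; rewrite /b linearP.
pose gam U := tlift (bl U) (br U).
pose del U : {linear dsum (fun _ : X => U) -> tensor U (freem R X)} :=
  dlift (fun x => tensl U (fgen R x)).
have gamK U u : del U (gam U u) = u.
  apply: (@tensor_ext _ _ _ _ (lcomp (del U) (gam U)) (lid _)) => m.
  apply: (@freem_ext _ _ _ (lcomp (lcomp (del U) (gam U)) (tensr _ m)) (tensr _ m)) => x.
  change (del U (gam U (tens m (fgen R x))) = tens m (fgen R x)).
  by rewrite tlift_tens /b /fgen dmap_din dlift_din /= scale1r.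
move=> U U' f fI; apply: injective0 => u u0; rewrite -[u]gamK.
suff -> : gam U u = 0 by rewrite linear0.
apply: dsum_eq => x; apply: fI; rewrite linear0.
transitivity (gam U' (tmap f (lid _) u) x); last by rewrite u0 linear0.
apply: (@tensor_ext _ _ _ _ (lcomp f (lcomp (dcomp _ x) (gam U)))
  (lcomp (lcomp (dcomp _ x) (gam U')) (tmap f (lid _)))) => m v.
change (f (gam U (tens m v) x) = gam U' (tmap f (lid _) (tens m v)) x).
by rewrite tmap_tens !tlift_tens !bE linearZ.
Qed.

Lemma free_flat V : is_free V -> flat V.
Proof.
move=> [X [e /linear_inverse[c [eK cK]]]] U U' f fI; apply: injective0 => u.
move=> /(congr1 (tmap (lid U') c)); rewrite linear0 tmap_comp.
rewrite (@tmap_eq _ _ _ _ _ _ (lcomp f (lid U)) _ (lcomp (lid _) c)) // -tmap_comp.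
rewrite -(linear0 (tmap f (lid (freem R X)))) => /(@freem_flat X _ _ _ fI).
move=> /(congr1 (tmap (lid U) e)); rewrite linear0 tmap_comp tmap_id //.
Qed.

Section FlatExact.
Variables (K F M V : lmodType R) (f : {linear K -> F}) (g : {linear F -> M}).
Hypotheses (Vflat : flat V) (g_ker : forall x, g x = 0 -> exists k, f k = x).

(** Right exactness applies to [g] corestricted to its range, and flatness takes care of the
    inclusion of the range. *)
Lemma flat_exactl (u : tensor F V) : tmap g (lid V) u = 0 ->
  exists k, tmap f (lid V) k = u.
Proof.
have gP x : g x \in smem (lrange g) by apply/lrangeP; exists x.
move=> u0; apply: (@tensor_right_exactl _ _ _ _ f (corestr gP)).
- by case=> y yP; have /lrangeP[x xy] := yP; exists x; apply: incl_inj.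
- by move=> x /(congr1 (incl _)) /=; exact: g_ker.
apply: (Vflat (f := incl (lrange g)) (@incl_inj _ _ _)).
by rewrite linear0 tmap_comp -[RHS]u0; apply: tmap_eq.
Qed.

Lemma flat_exactr (u : tensor V F) : tmap (lid V) g u = 0 ->
  exists k, tmap (lid V) f k = u.
Proof.
move=> u0; have [|k kE] := @flat_exactl (tswap _ _ u).
  by rewrite -tswap_tmap u0 linear0.
by exists (tswap _ _ k); rewrite -tswap_tmap kE tswapK.
Qed.

End FlatExact.
End TensorFacts.

(** * The torsion product *)

Section Presentations.
Variable R : idomainType.
Implicit Types K L M N P U V W F G : lmodType R.

Record free_presentation K F M (i : {linear K -> F}) (p : {linear F -> M}) :
    Prop := FreePresentation {
  pres_inj : injective i;
  pres_comp : forall k, p (i k) = 0;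
  pres_exact : forall x, p x = 0 -> exists k, i k = x;
  pres_surj : forall y, exists x, p x = y;
  pres_free : is_free F }.

Lemma frel_presentation M : free_presentation (incl (frel M)) (faug M).
Proof.
split; first exact: incl_inj.
- exact: faug_frel.
- by move=> x /lkerP xP; exists (Subm xP).
- by move=> m; exists (fgen R m); rewrite faug_fgen.
exact: freem_free.
Qed.

Lemma comparison_exists K F M (i : {linear K -> F}) (p : {linear F -> M})
    K' F' M' (i' : {linear K' -> F'}) (p' : {linear F' -> M'}) (f : {linear M -> M'}) :
  free_presentation i p -> free_presentation i' p' ->
  exists (phi : {linear F -> F'}) (psi : {linear K -> K'}),
    (forall x, p' (phi x) = f (p x)) /\ (forall k, i' (psi k) = phi (i k)).
Proof.
move=> iP i'P.
have [phi phiP] := free_lift (h := lcomp f p) (pres_free iP)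
  (fun x => pres_surj i'P (f (p x))).
have [|psi psiP] := factor_inj (f := lcomp phi i) (pres_inj i'P).
  by move=> k; apply: (pres_exact i'P); rewrite phiP /= (pres_comp iP) linear0.
by exists phi, psi.
Qed.

(** The difference of [phi] and [phi'] lands in the kernel of [p'], so it factors through a homotopy
    [h] with [psi - psi' = h i], and this vanishes on the kernel of [i (x) 1]. *)
Lemma comparison_unique K F (i : {linear K -> F})
    K' F' M' (i' : {linear K' -> F'}) (p' : {linear F' -> M'})
    (phi phi' : {linear F -> F'}) (psi psi' : {linear K -> K'})
    N N' (g : {linear N -> N'}) u :
  free_presentation i' p' ->
  (forall k, i' (psi k) = phi (i k)) -> (forall k, i' (psi' k) = phi' (i k)) ->
  (forall x, p' (phi x) = p' (phi' x)) ->
  tmap i (lid N) u = 0 -> tmap psi g u = tmap psi' g u.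
Proof.
move=> i'P psiE psi'E phiE u0.
have [|h hE] := factor_inj (f := ladd phi (lscale (-1) phi')) (pres_inj i'P).
  move=> x; apply: (pres_exact i'P).
  change (p' (phi x + -1 *: phi' x) = 0).
  by rewrite linearD linearZ_LR phiE scaleN1r subrr.
have psiD : psi =1 ladd psi' (lcomp h i).
  move=> k; apply: (pres_inj i'P); rewrite psiE.
  change (phi (i k) = i' (psi' k + h (i k))).
  rewrite linearD psi'E hE; change (phi (i k) = phi' (i k) + (phi (i k) + -1 *: phi' (i k))).
  by rewrite scaleN1r addrC subrK.
rewrite (tmap_eq psiD (g' := g)) // tmap_addl tmap_lcompl u0.
by rewrite [X in _ + X]linear0 addr0.
Qed.

Section TorComparison.
Variables (K F M : lmodType R) (i : {linear K -> F}) (p : {linear F -> M}).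
Hypothesis iP : free_presentation i p.

Lemma tor_incl M' N' (t : tor M' N') :
  tmap (incl (frel M')) (lid N') (incl (tor_ker M' N') t) = 0.
Proof. by apply/lkerP; exact: smvalP. Qed.

Lemma tor_comparison_tot N (u : tensor K N) : tmap i (lid N) u = 0 ->
  exists t : tor M N, tor_comparison i p u t.
Proof.
move=> u0.
have [phi [psi [phiE psiE]]] := comparison_exists (lid M) iP (frel_presentation M).
have tP : tmap psi (lid N) u \in smem (tor_ker M N).
  apply/lkerP; rewrite (tmap_square (d := phi) (c := i) (d' := lid N) (c' := lid N)) //.
  by rewrite u0 linear0.
by exists (Subm tP); split=> //; exists phi, psi; split.
Qed.

Lemma tor_comparisonE N (u : tensor K N) (t : tor M N)
    (phi : {linear F -> freem R M}) (psi : {linear K -> subm (frel M)}) :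
  tor_comparison i p u t -> (forall x, faug M (phi x) = p x) ->
  (forall k, incl (frel M) (psi k) = phi (i k)) ->
  incl (tor_ker M N) t = tmap psi (lid N) u.
Proof.
move=> [u0 [phi' [psi' [phi'E psi'E ->]]]] phiE psiE.
refine (comparison_unique (lid N) (frel_presentation M) psi'E psiE _ u0) => x.
by rewrite phiE phi'E.
Qed.

Lemma tor_comparison_lin N a (u u' : tensor K N) (t t' : tor M N) :
  tor_comparison i p u t -> tor_comparison i p u' t' ->
  tor_comparison i p (a *: u + u') (a *: t + t').
Proof.
move=> ut u't'; split; first by rewrite linearP ut.1 u't'.1 scaler0 addr0.
have [phi [psi [phiE psiE tE]]] := ut.2.
exists phi, psi; split=> //; rewrite [LHS]linearP tE linearP.
by congr (_ + _); exact: tor_comparisonE u't' _ _.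
Qed.

Lemma tor_comparison0 N : tor_comparison i p (0 : tensor K N) (0 : tor M N).
Proof.
have [|t ut] := @tor_comparison_tot N 0; first by rewrite linear0.
by have := tor_comparison_lin (-1) ut ut; rewrite !scaleN1r !addNr.
Qed.

Lemma tor_comparison_zero N (t : tor M N) : tor_comparison i p (0 : tensor K N) t -> t = 0.
Proof.
by move=> [_ [phi [psi [_ _ tE]]]]; apply: incl_inj; rewrite tE !linear0.
Qed.

(** Comparison maps in the two directions are inverse to each other on the kernels, by
    [comparison_unique]. A single [psi] serves every [N], which embeds Tor into [K (x) N] by a map
    natural in [N]. *)
Lemma tor_comparison_inv : exists psi : {linear subm (frel M) -> K},
  forall N u (t : tor M N), tor_comparison i p u t <-> u = tmap psi (lid N) (incl _ t).
Proof.
have [phi [psi [phiE psiE]]] := comparison_exists (lid M) (frel_presentation M) iP.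
exists psi => N u t; split=> [[u0 [phi' [psi' [phi'E psi'E ->]]]]|->].
  rewrite tmap_comp; transitivity (tmap (lid K) (lcomp (lid N) (lid N)) u).
    by rewrite tmap_id.
  refine (@comparison_unique _ _ i _ _ _ _ _
    (lid _) (lcomp phi phi') (lid _) _ _ _ (lcomp (lid N) (lid N)) _ iP _ _ _ u0) => // x.
    change (i (psi (psi' x)) = phi (phi' (i x))).
    by rewrite psiE psi'E.
  change (p x = p (phi (phi' x))).
  by rewrite phiE phi'E.
have u0 : tmap i (lid N) (tmap psi (lid N) (incl _ t)) = 0.
  rewrite (tmap_square (d := phi) (c := incl _) (d' := lid N) (c' := lid N)) //.
  by rewrite tor_incl linear0.
split=> //.
have [phi' [psi' [phi'E psi'E]]] := comparison_exists (lid M) iP (frel_presentation M).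
exists phi', psi'; split=> //; rewrite tmap_comp.
have -> : tmap (lcomp psi' psi) (lcomp (lid N) (lid N)) (incl (tor_ker M N) t) =
    tmap (lid _) (lcomp (lid N) (lid N)) (incl (tor_ker M N) t).
  refine (@comparison_unique _ _ (incl (frel M)) _ _ _ _ _
    (lcomp phi' phi) (lid _) _ (lid _) _ _ (lcomp (lid N) (lid N)) _
    (frel_presentation M) _ _ _ (tor_incl t)) => [k|//|x].
    change (incl (frel M) (psi' (psi k)) = phi' (phi (incl (frel M) k))).
    by rewrite psi'E psiE.
  change (faug M (phi' (phi x)) = faug M x).
  by rewrite phi'E phiE.
by rewrite tmap_id.
Qed.

(** Both ways around the square are comparison maps covering [f], so they agree on the kernel. *)
Lemma tor_comparison_nat K' F' M' (i' : {linear K' -> F'}) (p' : {linear F' -> M'})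
    (l : {linear K -> K'}) (k : {linear F -> F'}) (f : {linear M -> M'})
    N N' (g : {linear N -> N'}) (u : tensor K N) t :
  free_presentation i' p' ->
  (forall x, i' (l x) = k (i x)) -> (forall x, p' (k x) = f (p x)) ->
  tor_comparison i p u t -> tor_comparison i' p' (tmap l g u) (tor_map f g t).
Proof.
move=> i'P lE kE [u0 [phi [psi [phiE psiE tE]]]]; split.
  rewrite (tmap_square (d := k) (c := i) (d' := g) (c' := lid N)) //.
  by rewrite u0 linear0.
have [phi' [psi' [phi'E psi'E]]] := comparison_exists (lid M') i'P (frel_presentation M').
exists phi', psi'; split=> //; rewrite incl_tor_map tE !tmap_comp.
refine (@comparison_unique _ _ i _ _ _ _ _
    (lcomp (fmap f) phi) (lcomp phi' k) _ _ _ _ (lcomp g (lid N)) _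
    (frel_presentation M') _ _ _ u0) => x.
- change (incl (frel M') (rmap f (psi x)) = fmap f (phi (i x))).
  by rewrite incl_rmap psiE.
- change (incl (frel M') (psi' (l x)) = phi' (k (i x))).
  by rewrite psi'E lE.
- change (faug M' (fmap f (phi x)) = faug M' (phi' (k x))).
  by rewrite faug_fmap phiE phi'E kE.
Qed.

End TorComparison.

Lemma tor_free M N : is_free N -> forall t : tor M N, t = 0.
Proof.
move=> /free_flat Nf t; apply: incl_inj; rewrite linear0.
apply: (Nf _ _ (incl (frel M)) (@incl_inj _ _ _)).
by rewrite linear0 tor_incl.
Qed.

(* The symmetry of Tor: chase u in K (x) N to K (x) G, then through F (x) G to
   F (x) L and to M (x) L. *)
Definition balanced K F M L G N (i : {linear K -> F}) (p : {linear F -> M})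
    (j : {linear L -> G}) (q : {linear G -> N}) (u : tensor K N) (v : tensor L M) :=
  exists (w : tensor K G) (x : tensor F L),
    [/\ tmap i (lid G) w = tmap (lid F) j x, tmap (lid K) q w = u &
        tswap _ _ (tmap p (lid L) x) = v].

Definition tor_sym M N (t : tor M N) (t' : tor N M) :=
  balanced (incl (frel M)) (faug M) (incl (frel N)) (faug N) (incl _ t) (incl _ t').

(** Comparison maps carry one chase to the other, so the symmetry may be computed on any two
    presentations, such as boundaries inside cycles for homology. *)
Lemma balanced_tor_sym K F M L G N (i : {linear K -> F}) (p : {linear F -> M})
    (j : {linear L -> G}) (q : {linear G -> N}) (u : tensor K N) (v : tensor L M) t t' :
  tor_comparison i p u t -> tor_comparison j q v t' -> balanced i p j q u v ->
  tor_sym t t'.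
Proof.
move=> [_ [phi [psi [phiE psiE tE]]]] [_ [phi' [psi' [phi'E psi'E t'E]]]].
move=> [w [x [wx wu xv]]]; exists (tmap psi phi' w), (tmap phi psi' x); split.
- rewrite (tmap_square (d := phi) (c := i) (d' := phi') (c' := lid _)) // wx.
  exact: tmap_square.
- by rewrite tE -wu; exact: tmap_square.
- by rewrite t'E -xv -[RHS]tswap_tmap; congr (tswap _ _ _); apply: tmap_square.
Qed.

Lemma balanced_sym K F M L G N (i : {linear K -> F}) (p : {linear F -> M})
    (j : {linear L -> G}) (q : {linear G -> N}) (u : tensor K N) (v : tensor L M) :
  balanced i p j q u v -> balanced j q i p v u.
Proof.
move=> [w [x [wx wu xv]]]; exists (tswap _ _ x), (tswap _ _ w); split.
- by rewrite -!tswap_tmap wx.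
- by rewrite -tswap_tmap.
- by rewrite -tswap_tmap tswapK.
Qed.

(** Right exactness supplies both lifts, in the notation of [balanced]: [w] over the surjection from
    [G] to [N], then [x] because the image of [w] in [F (x) N] is 0. *)
Lemma tor_sym_tot M N (t : tor M N) : exists t', tor_sym t t'.
Proof.
have [||w wE] := tmap_surj (f := lid (subm (frel M))) (g := faug N) _ _ (incl _ t).
- by move=> y; exists y.
- exact: pres_surj (frel_presentation N).
have [|||x xE] := tensor_right_exactr (f := incl (frel N)) (p := faug N)
    (N := freem R M) _ _ (u := tmap (incl (frel M)) (lid _) w).
- exact: pres_surj (frel_presentation N).
- exact: pres_exact (frel_presentation N).
- rewrite (tmap_square (d := incl _) (c := lid _) (d' := lid _) (c' := faug N)) //.
  by rewrite wE tor_incl.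
have tP : tswap _ _ (tmap (faug M) (lid (subm (frel N))) x) \in smem (tor_ker N M).
  apply/lkerP; rewrite -tswap_tmap.
  rewrite (tmap_square (d := faug M) (c := lid _) (d' := lid _) (c' := incl _)) //.
  rewrite xE tmap_comp tmap0l ?linear0 // => k; exact: faug_frel.
by exists (Subm tP), w, x; split.
Qed.

Lemma tor_sym_lin M N a (t t1 : tor M N) t' t1' :
  tor_sym t t' -> tor_sym t1 t1' -> tor_sym (a *: t + t1) (a *: t' + t1').
Proof.
move=> [w [x [wx wu xv]]] [w1 [x1 [wx1 wu1 xv1]]].
exists (a *: w + w1), (a *: x + x1); split.
- by rewrite !linearP wx wx1.
- by rewrite [RHS]linearP !linearP wu wu1.
- by rewrite [RHS]linearP !linearP xv xv1.
Qed.

(** In the notation of [balanced], if [u] is 0 then [w] comes from some [y] in [K (x) L]; flatness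
    of [F] forces [x] to be the image of the same [y], which dies in [M (x) L]. *)
Lemma tor_sym_zero M N (t' : tor N M) : tor_sym (0 : tor M N) t' -> t' = 0.
Proof.
move=> [w [x [wx wu xv]]]; apply: incl_inj; rewrite -xv !linear0.
have [|||y yE] := tensor_right_exactr (f := incl (frel N)) (p := faug N)
    (N := subm (frel M)) _ _ (u := w).
- exact: pres_surj (frel_presentation N).
- exact: pres_exact (frel_presentation N).
- by rewrite wu linear0.
have -> : x = tmap (incl (frel M)) (lid _) y.
  apply: (flatr (free_flat (freem_free R M)) (f := incl (frel N)) (@incl_inj _ _ _)).
  by rewrite -wx -yE; apply: tmap_square.
rewrite tmap_comp tmap0l ?linear0 // => k; exact: faug_frel.
Qed.

Lemma tor_sym_sym M N (t : tor M N) t' : tor_sym t t' -> tor_sym t' t.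
Proof. exact: balanced_sym. Qed.

Lemma tor_sym_nat M M' N N' (f : {linear M -> M'}) (g : {linear N -> N'}) t t' :
  tor_sym t t' -> tor_sym (tor_map f g t) (tor_map g f t').
Proof.
move=> [w [x [wx wu xv]]]; exists (tmap (rmap f) (fmap g) w), (tmap (fmap f) (rmap g) x).
split.
- rewrite (tmap_square (d := fmap f) (c := incl _) (d' := fmap g) (c' := lid _)) //.
  by rewrite wx; exact: tmap_square.
- by rewrite incl_tor_map -wu; apply: tmap_square => // y; exact: faug_fmap.
- rewrite incl_tor_map -xv -[RHS]tswap_tmap; congr (tswap _ _ _).
  by apply: tmap_square => // y; exact: faug_fmap.
Qed.

(** The middle element is [r] times the tensor product of two generators; [w] absorbs [r] on the
    left and [x] on the right. *)
Lemma tor_sym_etor M N (a : M) (r : R) (b : N) (ra : r *: a = 0) (rb : r *: b = 0) :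
  tor_sym (etor ra rb) (etor rb ra).
Proof.
exists (tens (Subm (lift_frel ra (faug_fgen a))) (fgen R b)).
exists (tens (fgen R a) (Subm (lift_frel rb (faug_fgen b)))); split.
- by rewrite !tmap_tens /= tensZl -tensZr.
- by rewrite tmap_tens faug_fgen.
- by rewrite tmap_tens faug_fgen tswap_tens.
Qed.

End Presentations.

(** * Generation of Tor by elementary tors *)

Section TorGeneration.
Variable R : idomainType.
Hypothesis R_pid : @is_pid R.
Variables (M N P : lmodType R) (H : {linear tor M N -> P}).
Hypothesis H0 : forall a r b (ra : r *: a = 0) (rb : r *: b = 0), H (etor ra rb) = 0.

Local Notation pairs := (seq (subm (frel M) * N)).
Let sumt (s : pairs) : tensor (subm (frel M)) N := \sum_(p <- s) tens p.1 p.2.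

(* Bezout row operations make all values of [f] but the first vanish. *)
Lemma reduce_pairs (f : {linear freem R M -> R^o}) k0 n0 (s : pairs) :
  exists k n (s' : pairs), [/\ size s' = size s,
    sumt ((k, n) :: s') = sumt ((k0, n0) :: s),
    forall p, p \in s' -> f (incl _ p.1) = 0 &
    rdvd (f (incl _ k)) (f (incl _ k0))].
Proof.
elim: s k0 n0 => [|[k1 n1] s IH] k0 n0.
  by exists k0, n0, [::]; split=> //; exists 1; rewrite mul1r.
have [k [n [s' [ss' sE s'0 kd]]]] := IH k0 n0.
have [g [a [b [u [v [aE bE uv]]]]]] := pid_bezout R_pid (f (incl _ k)) (f (incl _ k1)).
have uvg : u * f (incl _ k) + v * f (incl _ k1) = g.
  by rewrite aE bE !mulrA -mulrDl uv mul1r.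
have fE c c' : f (incl _ (c *: k + c' *: k1)) =
    c * f (incl _ k) + c' * f (incl _ k1).
  by rewrite [incl _ _]linearP [LHS]linearP [incl _ (c' *: k1)]linearZ [f (c' *: _)]linearZ.
(* The matrix with rows [(u, v)] and [(- b, a)] acts on the first factors and its inverse transpose
   on the second ones, which preserves the sum of tensors. *)
exists (u *: k + v *: k1), (a *: n + b *: n1).
exists ((- b *: k + a *: k1, - v *: n + u *: n1) :: s'); split.
- by rewrite /= ss'.
- move: sE; rewrite /sumt !big_cons => sE; rewrite [RHS]addrCA -sE [RHS]addrCA.
  rewrite [LHS]addrA [RHS]addrA; congr (_ + _).
  change (tens (u *: k + v *: k1) (a *: n + b *: n1) +
    tens (- b *: k + a *: k1) (- v *: n + u *: n1) = tens k n + tens k1 n1).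
  rewrite !tens_linearl !tensZl !tens_linearr !tensZr !scalerDr !scalerA.
  rewrite [LHS](AC ((2*2)*(2*2)) ((1*5)*(2*6)*(3*7)*(4*8))) /= -!scalerDl.
  rewrite mulrNN [b * v]mulrC uv mulNr [b * u]mulrC subrr mulrN [v * a]mulrC subrr.
  by rewrite [v * b + _]addrC [a * u]mulrC uv !scale0r !addr0 !scale1r.
- move=> p; rewrite inE => /predU1P[-> /=|/s'0 //].
  by rewrite fE aE bE mulNr !mulrA [b * a]mulrC addNr.
- by apply: rdvd_trans kd; rewrite fE uvg; exists a.
Qed.

(* Make the ideal generated by [f k] maximal: then [k] is divisible by [f k] in
   the free module, hence [k (x) n] is an elementary tor and can be split off. *)
Lemma tor_gen_aux (s : pairs) (t : tor M N) : incl _ t = sumt s -> H t = 0.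
Proof.
have [m] := ubnP (size s); elim: m s t => // m IHm s t sm tE.
(* Inner induction along proper divisors of [d], the value of [f] at the first pair, all other pairs
   having value 0. *)
have inner d : d != 0 -> forall (f : {linear freem R M -> R^o}) k n (s' : pairs),
    (size s' < m)%N -> f (incl _ k) = d ->
    (forall p, p \in s' -> f (incl _ p.1) = 0) ->
    forall t', incl _ t' = sumt ((k, n) :: s') -> H t' = 0.
  elim/(pid_ind R_pid): d => d IHd d0 f k n s' ss' fk fs t' t'E.
  have [dvd|/existsNP[y ny]] :=
      pselect (forall y, rdvd d ((incl _ k : freem R M) y)).
    have [e eE] := choice dvd.
    have eP : exists s1 : seq M, forall y, y \notin s1 -> e y = 0.
      exists (dsupp (incl _ k : freem R M)) => y /dsupp_out; rewrite eE => /eqP.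
      by rewrite mulf_eq0 (negPf d0) orbF => /eqP.
    pose e0 : freem R M := DSum (M := fun=> R^o) eP.
    have ke : incl _ k = d *: e0 by apply: dsum_eq => y; rewrite eE mulrC.
    have da : d *: faug M e0 = 0 by rewrite -linearZ -ke faug_frel.
    have cl (x : N) : linear (fun v : freem R M => (f v : R) *: x).
      by move=> a v v'; rewrite linearP scalerDl scalerA.
    have cr (v : freem R M) : linear (fun x : N => (f v : R) *: x).
      by move=> a x x'; rewrite scalerDr !scalerA mulrC.
    (* The image of [t'] in the tensor product of the free module with [N] is 0; applying [f (x) 1]
       to it leaves only the first pair. *)
    have dn : d *: n = 0.
      pose c := lcomp (tlift cl cr) (tmap (incl (frel M)) (lid N)).
      have cE k1 n1 : c (tens k1 n1) = (f (incl _ k1) : R) *: n1.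
        change (tlift cl cr (tmap (incl (frel M)) (lid N) (tens k1 n1)) =
          (f (incl _ k1) : R) *: n1).
        by rewrite tmap_tens tlift_tens.
      have : c (incl _ t') = 0.
        change (tlift cl cr (tmap (incl (frel M)) (lid N) (incl _ t')) = 0).
        by rewrite tor_incl linear0.
      rewrite t'E /sumt (linear_sum c) big_cons big1_seq => [|p /andP[_ ps]].
        by rewrite addr0 cE fk.
      by rewrite cE fs // scale0r.
    have eE' : incl _ (etor da dn) = tens k n.
      rewrite (etor_lift _ _ (erefl (faug M e0))).
      by congr (tens _ _); apply: incl_inj; rewrite ke.
    rewrite -[t'](subrK (etor da dn)) linearD H0 addr0; apply: (IHm s') => //.
    by rewrite linearB t'E eE' /sumt big_cons addrC addKr.
  have [g [a [b [u [v [aE bE uv]]]]]] :=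
    pid_bezout R_pid d ((incl _ k : freem R M) y).
  (* If [d] does not divide the coordinate of [k] at [y], their greatest common divisor [g] is a
     proper divisor of [d] and is the value of this functional at [k]. *)
  pose f' : {linear freem R M -> R^o} :=
    ladd (lscale u f) (lscale v (dcomp (fun=> R^o) y)).
  have f'k : f' (incl _ k) = g.
    change (u * f (incl _ k) + v * ((incl _ k : freem R M) y) = g).
    by rewrite fk aE bE !mulrA -mulrDl uv mul1r.
  have [k' [n' [s2 [ss2 sE s20 kd]]]] := reduce_pairs f' k n s'.
  rewrite f'k in kd.
  apply: (IHd (f' (incl _ k')) _ _ _ f' k' n' s2) => //.
  - by apply: rdvd_trans kd _; exists a.
  - move=> dk; apply: ny; rewrite bE; apply: rdvd_trans dk (rdvd_trans kd _).
    by exists b.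
  - by apply: contraNneq d0 => k'0; case: kd => r; rewrite k'0 mulr0 aE => ->; rewrite mulr0.
  - by rewrite ss2.
  - by rewrite t'E sE.
case: s => [|[k0 n0] s] in sm tE *.
  by rewrite (_ : t = 0) ?linear0 //; apply: incl_inj; rewrite tE linear0 /sumt big_nil.
have {}sm : (size s < m)%N by [].
have [k00|/eqP k0N0] := pselect (k0 = 0).
  by apply: (IHm s) => //; rewrite tE /sumt big_cons /= k00 tens0l add0r.
have [x kx] : exists x, (incl _ k0 : freem R M) x != 0.
  apply: contrapT => nx; case/eqP: k0N0; apply: incl_inj; apply: dsum_eq => x.
  by apply/eqP; apply: contraT => kx; case: nx; exists x.
have [k [n [s' [ss' sE s'0 kd]]]] := reduce_pairs (dcomp (fun=> R^o) x) k0 n0 s.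
apply: (inner _ _ (dcomp (fun=> R^o) x) k n s') => //; last 2 first.
- by rewrite ss'.
- by rewrite tE sE.
apply: contraNneq kx => kx0; case: kd => r; rewrite kx0 mulr0 => k0x.
exact/eqP.
Qed.

(** Generation is phrased through linear maps that vanish on elementary tors, as the uniqueness of
    the swap requires. *)
Lemma tor_generation (t : tor M N) : H t = 0.
Proof.
have [s sE] := tensor_sum (incl _ t); exact: (@tor_gen_aux s).
Qed.

End TorGeneration.

Section TorSwap.
Variable R : idomainType.
Hypothesis R_pid : @is_pid R.
Implicit Types M N : lmodType R.

(** [tor_sym] is the graph of a linear map with the prescribed values on elementary tors, and
    generation leaves no other one, so the definite description selects it. *)
Lemma tor_swapP M N (t : tor M N) t' : tor_sym t t' <-> t' = tor_swap M N t.
Proof.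
have [I IP] := linear_of_rel (@tor_sym_tot _ M N) (@tor_sym_lin _ M N) (@tor_sym_zero _ M N).
rewrite IP /tor_swap /the_linear; case: pselect => [ex|[]]; last first.
  by exists I => a r b ra rb; apply/esym/IP; exact: tor_sym_etor.
case: cid => J JP /=; suff -> : J t = I t by [].
apply/eqP; rewrite -subr_eq0 -scaleN1r; apply/eqP.
apply: (@tor_generation _ R_pid _ _ _ (ladd J (lscale (-1) I))) => a r b ra rb.
have Ie : etor rb ra = I (etor ra rb) by apply/IP; exact: tor_sym_etor.
change (J (etor ra rb) + -1 *: I (etor ra rb) = 0).
by rewrite JP -Ie scaleN1r subrr.
Qed.

Lemma tor_swapK M N (t : tor M N) : tor_swap N M (tor_swap M N t) = t.
Proof. by apply/esym/tor_swapP/tor_sym_sym/tor_swapP. Qed.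

Lemma tor_swap_nat M M' N N' (f : {linear M -> M'}) (g : {linear N -> N'}) t :
  tor_swap M' N' (tor_map f g t) = tor_map g f (tor_swap M N t).
Proof. by apply/esym/tor_swapP/tor_sym_nat/tor_swapP. Qed.

End TorSwap.

(** * Components of total complexes *)

(** Every integer is a predecessor. Degrees written as [m - 1] match the target of a differential
    without casts. *)
Lemma int_pred_ind (P : int -> Type) : (forall m, P (m - 1)) -> forall n, P n.
Proof. by move=> H n; have := H (n + 1); rewrite addrK. Qed.

Lemma bideg_eq n (p q : bideg n) : deg1 p = deg1 q -> p = q.
Proof.
case: p q => [i j e] [i' j' e'] /= ii; subst i'.
have jj : j' = j by apply: (addrI i); rewrite e e'.
by subst j'; rewrite (eq_irrelevance e e').
Qed.

Section Bidegrees.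
Variable n : int.

Lemma bideg_pred_ind (P : bideg (n - 1) -> Prop) :
  (forall i j (e : i - 1 + (j - 1) = n - 1), P (Bideg e)) -> forall p, P p.
Proof.
by move=> H [i j]; elim/int_pred_ind: i => i; elim/int_pred_ind: j => j e.
Qed.

Lemma bideg_predl (p : bideg (n - 1)) : exists q : bideg n, p = bidegl q.
Proof.
case: p => i j; elim/int_pred_ind: i => i e.
have e' : i + j = n by apply: (addIr (-1)); rewrite -e addrAC.
by exists (Bideg e'); exact: bideg_eq.
Qed.

Lemma bidegl_inj : injective (@bidegl n).
Proof. by move=> p q /(congr1 (@deg1 _)) e; apply: bideg_eq; exact: addIr e. Qed.

Lemma bidegr_inj : injective (@bidegr n).
Proof. by move=> p q /(congr1 (@deg1 _)) e; apply: bideg_eq; exact: e. Qed.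

Lemma bidegl_can : exists g, cancel (@bidegl n) g.
Proof.
have [g gE] := choice bideg_predl; exists g => p.
by apply: bidegl_inj; rewrite -gE.
Qed.

End Bidegrees.

Section DirectSums.
Variable R : idomainType.

(** Injectivity of [s] leaves a single summand in the component at [s i]. *)
Lemma dlift_shift (I J : eqType) (s : I -> J) (M : I -> lmodType R)
    (N : J -> lmodType R) (F : forall i, {linear M i -> N (s i)})
    (G : forall i, {linear M i -> dsum N}) (x : dsum M) i :
  injective s -> (forall i y, G i y = din N (s i) (F i y)) ->
  dlift G x (s i) = F i (x i).
Proof.
move=> sI GE; apply: (@dsum_ext _ _ _ _
  (lcomp (dcomp N (s i)) (dlift G)) (lcomp (F i) (dcomp M i))) => j y.
change (dlift G (din M j y) (s i) = F i (din M j y i)).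
rewrite dlift_din GE; change (din N (s j) (F j y) (s i) = F i (din M j y i)).
have [e|ij] := eqVneq j i; first by case: _ / e; rewrite !din_same.
by rewrite !din_other ?linear0 // (inj_eq sI).
Qed.

(** Choosing 0 outside [s] keeps the family finitely supported. *)
Lemma dsum_choice (I : eqType) (M : I -> lmodType R) (s : seq I)
    (Q : forall i, M i -> Prop) :
  (forall i, i \notin s -> Q i 0) -> (forall i, exists x, Q i x) ->
  exists x : dsum M, forall i, Q i (x i).
Proof.
move=> Q0 Qx; have Qx' i : exists x, Q i x /\ (i \notin s -> x = 0).
  have [si|si] := boolP (i \in s); last by exists 0; split=> //; exact: Q0.
  by have [x xQ] := Qx i; exists x.
pose f i := projT1 (cid (Qx' i)).
have fP i : Q i (f i) /\ (i \notin s -> f i = 0) by exact: projT2 (cid (Qx' i)).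
have fS : exists s : seq I, forall i, i \notin s -> f i = 0 by exists s => i /(fP i).2.
by exists (DSum fS) => i; exact: (fP i).1.
Qed.

Lemma dsum_pullback (I J : eqType) (s : I -> J) (g : J -> I)
    (N : J -> lmodType R) (z : dsum N) : cancel s g ->
  exists y : dsum (fun i => N (s i)), forall i, y i = z (s i).
Proof.
move=> sK; have yS : exists t : seq I, forall i, i \notin t -> z (s i) = 0.
  exists (map g (dsupp z)) => i gi; apply: dsupp_out; apply: contra gi => si.
  by rewrite -[i]sK map_f.
by exists (DSum yS).
Qed.

Lemma dmap_exact (I : eqType) (M N : I -> lmodType R)
    (F : forall i, {linear M i -> N i}) (y : dsum N) :
  (forall i, exists x, F i x = y i) -> exists x, dmap F x = y.
Proof.
move=> FE; have [i /dsupp_out yi|x xE] :=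
    @dsum_choice _ _ (dsupp y) (fun i x => F i x = y i) _ FE.
  by rewrite yi linear0.
by exists x; apply: dsum_eq => i; rewrite dmapE; exact: xE.
Qed.

End DirectSums.

Section TotalComponents.
Variable R : idomainType.

(** Only two components of [x] reach a given bidegree; with the target written as [(i - 1, j - 1)]
    their contributions have the same type without a cast. *)
Lemma tdiff_comp (D : doubleComplex R) n i j (e : i - 1 + (j - 1) = n - 1)
    (e1 : i + (j - 1) = n) (e2 : i - 1 + j = n) (x : tobj D n) :
  tdiff D n x (Bideg e) = dh D i (j - 1) (x (Bideg e1)) +
    ksign R (i - 1) *: dv D (i - 1) j (x (Bideg e2)).
Proof.
pose L := dlift (fun p : bideg n => lcomp (tin D (bidegl p)) (dh D (deg1 p) (deg2 p))).
pose F (p : bideg n) := lscale (ksign R (deg1 p)) (dv D (deg1 p) (deg2 p)).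
pose L' := dlift (fun p : bideg n => lcomp (tin D (bidegr p)) (F p)).
have -> : tdiff D n x = L x + L' x.
  apply: (@dsum_ext _ _ _ _ (tdiff D n) (ladd L L')) => p y.
  change (tdiff D n (tin D p y) = L (tin D p y) + L' (tin D p y)).
  rewrite tdiff_tin !dlift_din; congr (_ + _).
  by change (ksign R (deg1 p) *: tin D (bidegr p) (dv D (deg1 p) (deg2 p) y) =
    tin D (bidegr p) (ksign R (deg1 p) *: dv D (deg1 p) (deg2 p) y)); rewrite linearZ.
change (L x (Bideg e) + L' x (Bideg e) = dh D i (j - 1) (x (Bideg e1)) +
    ksign R (i - 1) *: dv D (i - 1) j (x (Bideg e2))).
congr (_ + _).
  rewrite (eq_irrelevance e (bidegl_subproof (Bideg e1))).
  by apply: (dlift_shift (F := fun p : bideg n => dh D (deg1 p) (deg2 p)) x (Bideg e1) (@bidegl_inj n)).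
rewrite (eq_irrelevance e (bidegr_subproof (Bideg e2))).
by apply: (dlift_shift (F := F) x (Bideg e2) (@bidegr_inj n)).
Qed.

Variables A B : chainComplex R.

Lemma partial_tensor_comp n (x : tensorC A B n) (q : bideg n) :
  partial_tensor A B n x (bidegl q) = tmap (bdry A (deg1 q)) (lid (B (deg2 q))) (x q).
Proof.
by apply: (dlift_shift
  (F := fun p : bideg n => tmap (bdry A (deg1 p)) (lid (B (deg2 p)))) x q (@bidegl_inj n)).
Qed.

Lemma bidegs_inj n : injective (@bidegs n).
Proof.
move=> p q /(congr1 (@deg2 _)) e; apply: bideg_eq; exact: e.
Qed.

Lemma twist_comp n (x : tensorC A B n) (q : bideg n) :
  twist A B n x (bidegs q) = ksign R (deg1 q * deg2 q) *: tswap _ _ (x q).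
Proof.
apply: (dlift_shift (F := fun p : bideg n => lscale (ksign R (deg1 p * deg2 p))
  (tswap (A (deg1 p)) (B (deg2 p)))) x q (@bidegs_inj n)) => p y.
change (ksign R (deg1 p * deg2 p) *: tin (tensorD B A) (bidegs p) (tswap _ _ y) =
  tin (tensorD B A) (bidegs p) (ksign R (deg1 p * deg2 p) *: tswap _ _ y)).
by rewrite linearZ.
Qed.

Lemma torH_swap_comp n (x : torH A B n) (q : bideg n) :
  torH_swap A B n x (bidegs q) = ksign R (deg1 q * deg2 q + 1) *: tor_swap _ _ (x q).
Proof.
apply: (dlift_shift (F := fun p : bideg n => lscale (ksign R (deg1 p * deg2 p + 1))
  (tor_swap (homology A (deg1 p)) (homology B (deg2 p)))) x q (@bidegs_inj n)) => p y.
pose I := din (fun q : bideg n => tor (homology B (deg1 q)) (homology A (deg2 q))).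
change (ksign R (deg1 p * deg2 p + 1) *: I (bidegs p) (tor_swap _ _ y) =
  I (bidegs p) (ksign R (deg1 p * deg2 p + 1) *: tor_swap _ _ y)).
by rewrite linearZ.
Qed.

End TotalComponents.

(** * Chain complexes *)

Section Complexes.
Variable R : idomainType.
Implicit Types A B C K F T : chainComplex R.

Lemma boundaryE A n (x : A (n - 1)) :
  is_boundary x <-> exists y : A n, x = cdiff A n y.
Proof.
split=> [/is_boundaryP [m [e [y ->]]]|[y ->]]; last exact: Boundary.
have mn : m = n by exact: addIr e.
by subst m; rewrite (eq_irrelevance e erefl); exists y.
Qed.

Lemma bdry_surj A n (b : subm (bnd A (n - 1))) : exists y, bdry A n y = b.
Proof.
case: b => b bP; have /bndP/boundaryE[y yE] := bP.
by exists y; apply: incl_inj; rewrite [RHS]/= yE.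
Qed.

Lemma cyc_diff A n (z : subm (cyc A n)) : cdiff A n (incl _ z) = 0.
Proof. by apply/lkerP; exact: smvalP. Qed.

Lemma cyc_mem A n (z : A n) : cdiff A n z = 0 ->
  exists z' : subm (cyc A n), incl _ z' = z.
Proof. by move=> /lkerP zP; exists (Subm zP). Qed.

Lemma hclass_surj A n (h : homology A n) : exists z, hclass A n z = h.
Proof. by have [z ->] := qproj_surj h; exists z. Qed.

Lemma acyclic_boundary A n (z : A n) : acyclic A -> cdiff A n z = 0 -> is_boundary z.
Proof. by move=> Aac /cyc_mem[z' <-]; apply/hclass0; exact: Aac. Qed.

Lemma boundary_acyclic A :
  (forall n (z : A n), cdiff A n z = 0 -> is_boundary z) -> acyclic A.
Proof.
by move=> H n h; have [z <-] := hclass_surj h; apply/hclass0/H; exact: cyc_diff.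
Qed.

Lemma incl_cycmap A B (f : chainMap A B) n z :
  incl _ (cycmap f n z) = f n (incl _ z).
Proof. by []. Qed.

Lemma quasi_iso_surj A B (f : chainMap A B) n (z : B n) : quasi_iso f ->
  cdiff B n z = 0 -> exists z0 : A n, cdiff A n z0 = 0 /\ is_boundary (f n z0 - z).
Proof.
move=> fq /cyc_mem[z' <-].
have [h hE] := bijective_surj (fq n) (hclass B n z').
have [z0 z0E] := hclass_surj h; exists (incl _ z0); split; first exact: cyc_diff.
by rewrite -incl_cycmap -linearB; apply/hclass0; rewrite linearB -hmap_hclass z0E hE subrr.
Qed.

Lemma quasi_iso_inj A B (f : chainMap A B) n (z : A n) : quasi_iso f ->
  cdiff A n z = 0 -> is_boundary (f n z) -> is_boundary z.
Proof.
move=> fq /cyc_mem[z' <-]; rewrite -incl_cycmap => /hclass0 fz0; apply/hclass0.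
by apply: (bij_inj (fq n)); rewrite hmap_hclass fz0 linear0.
Qed.

Lemma quasi_iso_intro A B (f : chainMap A B) :
  (forall n (z : B n), cdiff B n z = 0 ->
     exists z0 : A n, cdiff A n z0 = 0 /\ is_boundary (f n z0 - z)) ->
  (forall n (z : A (n - 1)), cdiff A (n - 1) z = 0 -> is_boundary (f (n - 1) z) ->
     is_boundary z) ->
  quasi_iso f.
Proof.
move=> fS fI n; apply: bijective_inj_surj.
  elim/int_pred_ind: n => n; apply: injective0 => h.
  have [z <-] := hclass_surj h; rewrite hmap_hclass => /hclass0 zB.
  by apply/hclass0; apply: fI zB; exact: cyc_diff.
move=> h; have [z <-] := hclass_surj h.
have [z0 [/cyc_mem[z1 <-] z1B]] := fS n (incl _ z) (cyc_diff z).
exists (hclass A n z1); rewrite hmap_hclass; apply/eqP; rewrite -subr_eq0 -linearB.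
by apply/eqP/hclass0; rewrite linearB.
Qed.

(** The kernel of [f] is the quotient of [K] by [T], hence acyclic, and a surjection with acyclic
    kernel is a quasi-isomorphism. *)
Lemma quasi_iso_of_exact T K F A (th : chainMap T K) (io : chainMap K F)
    (f : chainMap F A) :
  (forall n, injective (th n)) ->
  (forall n t, io n (th n t) = 0) ->
  (forall n k, io n k = 0 -> exists t, th n t = k) ->
  (forall n k, f n (io n k) = 0) ->
  (forall n x, f n x = 0 -> exists k, io n k = x) ->
  (forall n y, exists x, f n x = y) ->
  acyclic T -> acyclic K -> quasi_iso f.
Proof.
move=> thI ioth ioK fio fK fS Tac Kac.
(* Acyclicity of the image of [io]: the differential of [k] comes from a cycle of [T], hence from a
   boundary, and subtracting the image of a primitive makes [k] a cycle. *)
have correct n (k : K (n - 1)) : io _ (cdiff K _ k) = 0 ->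
    exists k' : K n, cdiff F n (io n k') = io (n - 1) k.
  move=> /ioK[t tE].
  have /(acyclic_boundary Tac) /boundaryE[t' t'E] : cdiff T _ t = 0.
    by apply: thI; rewrite linear0 -cmapd tE cdiffK.
  have /(acyclic_boundary Kac) /boundaryE[k' k'E] : cdiff K _ (k - th _ t') = 0.
    by rewrite linearB cmapd -t'E tE subrr.
  by exists k'; rewrite cmapd -k'E linearB ioth subr0.
apply: quasi_iso_intro => [n z z0|n z z0 /boundaryE[x xE]].
  have [y yE] := fS n z.
  have [|k kE] := fK _ (cdiff F n y); first by rewrite -cmapd yE z0.
  have [|k' k'E] := correct n k; first by rewrite -cmapd kE cdiffK.
  exists (y - io n k'); split; first by rewrite linearB k'E kE subrr.
  by rewrite linearB fio yE subr0 subrr; apply/bndP; rewrite rpred0.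
have [x' x'E] := fS n x.
have [|k kE] := fK (n - 1) (z - cdiff F n x').
  by rewrite linearB -cmapd x'E -xE subrr.
have [|k' k'E] := correct n k; first by rewrite -cmapd kE linearB z0 cdiffK subr0.
apply/boundaryE; exists (x' + io n k').
by rewrite linearD k'E kE [RHS]addrC subrK.
Qed.

Lemma cid_subproof A n (x : A n) : cdiff A n (lid (A n) x) = lid (A (n - 1)) (cdiff A n x).
Proof. by []. Qed.
Definition chain_id A : chainMap A A := ChainMap (@cid_subproof A).

Lemma ccomp_subproof A B C (g : chainMap B C) (f : chainMap A B) n (x : A n) :
  cdiff C n (lcomp (g n) (f n) x) = lcomp (g (n - 1)) (f (n - 1)) (cdiff A n x).
Proof. by change (cdiff C n (g n (f n x)) = g (n - 1) (f (n - 1) (cdiff A n x))); rewrite !cmapd. Qed.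
Definition chain_comp A B C (g : chainMap B C) (f : chainMap A B) : chainMap A C :=
  ChainMap (ccomp_subproof g f).

Lemma hmap_comp A B C (g : chainMap B C) (f : chainMap A B) n h :
  hmap (chain_comp g f) n h = hmap g n (hmap f n h).
Proof.
have [z <-] := hclass_surj h; rewrite !hmap_hclass; congr (hclass _ _ _).
exact: incl_inj.
Qed.

Lemma hmap_eq A B (f g : chainMap A B) n : f n =1 g n -> hmap f n =1 hmap g n.
Proof.
move=> fg h; have [z <-] := hclass_surj h; rewrite !hmap_hclass.
by congr (hclass _ _ _); apply: incl_inj; rewrite !incl_cycmap.
Qed.

Lemma quasi_iso_comp A B C (g : chainMap B C) (f : chainMap A B) :
  quasi_iso g -> quasi_iso f -> quasi_iso (chain_comp g f).
Proof.
move=> gq fq n; apply: (eq_bij (bij_comp (gq n) (fq n))) => h.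
exact/esym/hmap_comp.
Qed.

Lemma quasi_iso_eq A B (f g : chainMap A B) : (forall n, f n =1 g n) ->
  quasi_iso f -> quasi_iso g.
Proof. by move=> fg fq n; apply: (eq_bij (fq n)); exact: hmap_eq. Qed.

Lemma bij_quasi_iso A B (f : chainMap A B) : (forall n, bijective (f n)) -> quasi_iso f.
Proof.
move=> fB; apply: quasi_iso_intro => [n z z0|n z z0 /boundaryE[y yE]].
  have [y yE] := bijective_surj (fB n) z; exists y; split.
    by apply: (bij_inj (fB (n - 1))); rewrite -cmapd yE z0 linear0.
  by rewrite yE subrr; apply/bndP; rewrite rpred0.
have [x xE] := bijective_surj (fB n) y; apply/boundaryE; exists x.
by apply: (bij_inj (fB (n - 1))); rewrite -cmapd xE.
Qed.

Section KernelComplex.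
Variables (F A : chainComplex R) (f : chainMap F A).

Definition ker_obj n : lmodType R := subm (lker (f n)).

Lemma ker_diff_subproof n (k : ker_obj n) :
  lcomp (cdiff F n) (incl (lker (f n))) k \in smem (lker (f (n - 1))).
Proof.
apply/lkerP; change (f (n - 1) (cdiff F n (incl (lker (f n)) k)) = 0).
by rewrite -cmapd (elimT (lkerP _ _) (smvalP k)) linear0.
Qed.

Definition ker_diff n : {linear ker_obj n -> ker_obj (n - 1)} :=
  corestr (@ker_diff_subproof n).

Lemma ker_diffK n x : ker_diff (n - 1) (ker_diff n x) = 0.
Proof. by apply: incl_inj; rewrite linear0; exact: cdiffK. Qed.

Definition kerC : chainComplex R := ChainComplex ker_diffK.

Lemma ker_incl_subproof n (x : kerC n) :
  cdiff F n (incl (lker (f n)) x) = incl (lker (f (n - 1))) (cdiff kerC n x).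
Proof. by []. Qed.

Definition ker_incl : chainMap kerC F := ChainMap ker_incl_subproof.

Hypotheses (f_surj : forall n y, exists x, f n x = y) (f_qi : quasi_iso f).

Lemma boundary_cycle B n (b : B n) : is_boundary b -> cdiff B n b = 0.
Proof. by case=> m y; rewrite cdiffK. Qed.

Lemma boundary_lift n (b : A n) : is_boundary b ->
  exists b' : F n, is_boundary b' /\ f n b' = b.
Proof.
case=> m y; have [x <-] := f_surj y.
by exists (cdiff F m x); split; [exact: Boundary | rewrite -cmapd].
Qed.

(** A cycle in the right class is off by a boundary, and boundaries lift along a surjection. *)
Lemma surj_quasi_iso_cycle n (z : A n) : cdiff A n z = 0 ->
  exists w, cdiff F n w = 0 /\ f n w = z.
Proof.
move=> z0; have [w [w0 /boundary_lift[b [bB bE]]]] := quasi_iso_surj f_qi z0.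
exists (w - b); rewrite !linearB w0 (boundary_cycle bB) subrr; split=> //.
by rewrite bE opprB addrC subrK.
Qed.

(** [x] bounds because its image does; the primitive is then corrected by a lifted cycle. Both the
    acyclicity of the kernel and strict lifting rest on this. *)
Lemma surj_quasi_iso_lift n (x : F (n - 1)) (y : A n) :
  cdiff F (n - 1) x = 0 -> f (n - 1) x = cdiff A n y ->
  exists w, cdiff F n w = x /\ f n w = y.
Proof.
move=> x0 xy; have /boundaryE[w wE] : is_boundary x.
  by apply: (quasi_iso_inj f_qi x0); rewrite xy; exact: Boundary.
have [|z [z0 zE]] := @surj_quasi_iso_cycle n (f n w - y).
  by rewrite linearB cmapd -wE xy subrr.
exists (w - z); rewrite !linearB z0 subr0 zE wE; split=> //.
by rewrite opprB addrC subrK.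
Qed.

Lemma ker_acyclic : acyclic kerC.
Proof.
apply: boundary_acyclic; elim/int_pred_ind => n k k0.
have kf : f (n - 1) (incl _ k) = cdiff A n 0.
  by rewrite linear0; apply/lkerP; exact: smvalP.
have [|w [wE w0]] := surj_quasi_iso_lift _ kf.
  by rewrite (ker_incl_subproof k) k0 linear0.
move/lkerP: w0 => w0; apply/boundaryE; exists (Subm w0).
by apply: incl_inj; rewrite -ker_incl_subproof.
Qed.

End KernelComplex.

(** * Splittings and contractions of free complexes *)

Section FreeComplex.
Hypothesis R_pid : @is_pid R.
Variable F : chainComplex R.
Hypothesis F_free : is_free_complex F.

Lemma cyc_free n : is_free (subm (cyc F n)).
Proof. exact: submodule_free. Qed.

Lemma bnd_free n : is_free (subm (bnd F n)).
Proof. exact: submodule_free. Qed.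

Lemma bdry_section n : exists s : {linear subm (bnd F (n - 1)) -> F n},
  forall b, bdry F n (s b) = b.
Proof. by apply: free_section; [exact: bnd_free | exact: bdry_surj]. Qed.

(** For a section [s] of the differential, [1 - s d] is a retraction onto the cycles. *)
Lemma cyc_splitting n : exists (r : {linear F n -> subm (cyc F n)})
    (s : {linear subm (bnd F (n - 1)) -> F n}),
  [/\ forall z, r (incl _ z) = z, forall b, bdry F n (s b) = b &
      forall x, incl _ (r x) + s (bdry F n x) = x].
Proof.
have [s sE] := bdry_section n.
have rP x : ladd (lid (F n)) (lscale (-1) (lcomp s (bdry F n))) x \in smem (cyc F n).
  apply/lkerP; change (cdiff F n (x + -1 *: s (bdry F n x)) = 0).
  rewrite scaleN1r linearB; apply/eqP; rewrite subr_eq0; apply/eqP.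
  exact: (congr1 (incl _) (esym (sE (bdry F n x)))).
exists (corestr rP), s; split=> // [z|x].
  apply: incl_inj; change (incl _ z + -1 *: s (bdry F n (incl _ z)) = incl _ z).
  have -> : bdry F n (incl _ z) = 0 by apply: incl_inj; rewrite linear0; exact: cyc_diff.
  by rewrite linear0 scaler0 addr0.
change (x + -1 *: s (bdry F n x) + s (bdry F n x) = x).
by rewrite scaleN1r subrK.
Qed.

(** The cycles are free as a submodule of a free module. On this presentation [beta_free] computes
    Tor of homology. *)
Lemma homology_presentation n :
  free_presentation (bnd_cyc F n) (hclass F n).
Proof.
split; last exact: cyc_free.
- by move=> x y /(congr1 (incl _)) xy; apply: incl_inj.
- by move=> b; apply/hclass0/bndP; exact: (smvalP b).
- by move=> z /hclass0/bndP zB; exists (Subm zB); apply: incl_inj.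
- exact: hclass_surj.
Qed.

(** The contraction is [s (1 - s d)]: the values of [1 - s d] are cycles, hence boundaries by
    acyclicity, so [s] applies to them. *)
Lemma free_acyclic_contraction : acyclic F ->
  exists h : forall n, {linear F (n - 1) -> F n},
    forall n x, cdiff F n (h n x) + h (n - 1) (cdiff F (n - 1) x) = x.
Proof.
move=> Fac; pose s n := projT1 (cid (bdry_section n)).
have sE n b : bdry F n (s n b) = b by exact: projT2 (cid (bdry_section n)) b.
pose r n := ladd (lid (F (n - 1))) (lscale (-1) (lcomp (s (n - 1)) (bdry F (n - 1)))).
have rE n x : r n x = x - s (n - 1) (bdry F (n - 1) x).
  by change (x + -1 *: s (n - 1) (bdry F (n - 1) x) = x - s (n - 1) (bdry F (n - 1) x)); rewrite scaleN1r.
have rP n x : r n x \in smem (bnd F (n - 1)).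
  apply/bndP/(acyclic_boundary Fac); rewrite rE linearB; apply/eqP.
  rewrite subr_eq0; apply/eqP.
  exact: (congr1 (incl _) (esym (sE _ (bdry F (n - 1) x)))).
exists (fun n => lcomp (s n) (corestr (rP n))) => n x.
change (incl _ (bdry F n (s n (corestr (rP n) x))) +
  s (n - 1) (corestr (rP (n - 1)) (cdiff F (n - 1) x)) = x).
rewrite sE -[incl _ _]/(r n x) rE.
have -> : corestr (rP (n - 1)) (cdiff F (n - 1) x) = bdry F (n - 1) x.
  apply: incl_inj; rewrite -[LHS]/(r (n - 1) (cdiff F (n - 1) x)) rE.
  have -> : bdry F (n - 1 - 1) (cdiff F (n - 1) x) = 0.
    by apply: incl_inj; rewrite linear0; exact: cdiffK.
  by rewrite linear0 subr0.
by rewrite subrK.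
Qed.

End FreeComplex.

(** A cycle [z] is the boundary of [(h (x) 1) z]: the cycle equation turns the term with [1 (x) d]
    into [(h d (x) 1) z], the sign changing with the first degree. *)
Lemma tensor_contractible K B (h : forall n, {linear K (n - 1) -> K n}) :
  (forall n x, cdiff K n (h n x) + h (n - 1) (cdiff K (n - 1) x) = x) ->
  acyclic (tensorC K B).
Proof.
move=> hE; apply: boundary_acyclic; elim/int_pred_ind => n z z0; apply/boundaryE.
pose H (p : bideg n) := tmap (h (deg1 p)) (lid (B (deg2 p))).
have [g gK] := bidegl_can n; have [y0 y0E] := dsum_pullback z gK.
exists (dmap H y0); apply: dsum_eq; elim/bideg_pred_ind => i j e.
have e1 : i + (j - 1) = n by apply: (addIr (-1)); rewrite -e addrAC.
have e2 : i - 1 + j = n by apply: (addIr (-1)); rewrite -e addrA.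
have e3 : i - 1 - 1 + (j - 1) = n - 1 - 1 by rewrite -e addrAC.
have e4 : i - 1 - 1 + j = n - 1 by rewrite -e2 addrAC.
rewrite [RHS](tdiff_comp e e1 e2) !dmapE !y0E.
have -> : z (bidegl (Bideg e1)) = z (Bideg e) :> tensor (K (i - 1)) (B (j - 1)).
  by rewrite (eq_irrelevance e (bidegl_subproof (Bideg e1))).
have -> : z (bidegl (Bideg e2)) = z (Bideg e4) :> tensor (K (i - 1 - 1)) (B j).
  by rewrite (eq_irrelevance e4 (bidegl_subproof (Bideg e2))).
have := congr1 (fun w : dsum _ => w (Bideg e3)) z0.
rewrite [X in X = _ -> _](tdiff_comp e3 e e4).
move: (z (Bideg e)) (z (Bideg e4)) => u v {y0 y0E z0 z}.
change (tmap (cdiff K (i - 1)) (lid (B (j - 1))) u +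
  ksign R (i - 1 - 1) *: tmap (lid (K (i - 1 - 1))) (cdiff B j) v = 0 ->
  u = tmap (cdiff K i) (lid (B (j - 1))) (tmap (h i) (lid (B (j - 1))) u) +
    ksign R (i - 1) *: tmap (lid (K (i - 1))) (cdiff B j) (tmap (h (i - 1)) (lid (B j)) v)).
move=> uv.
rewrite (tmap_square (c := lid _) (c' := cdiff B j) (d := h (i - 1)) (d' := lid _)) //.
rewrite -[ksign R (i - 1)]opprK -ksignB1 scaleNr -linearZ -linearN.
rewrite -[- (_ *: _)]add0r -uv addrK.
rewrite -tmap_lcompl tmap_comp -tmap_addl tmap_id // => x.
exact: hE.
Qed.

End Complexes.

(** * Tensor products of quasi-isomorphisms *)

Section TotalMaps.
Variables (R : idomainType) (D E : doubleComplex R).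
Variable F : forall i j, {linear D i j -> E i j}.
Hypotheses (Fh : forall i j x, dh E i j (F i j x) = F (i - 1) j (dh D i j x))
  (Fv : forall i j x, dv E i j (F i j x) = F i (j - 1) (dv D i j x)).

Definition total_map_fun n : {linear Defs.total D n -> Defs.total E n} :=
  dmap (fun p : bideg n => F (deg1 p) (deg2 p)).

Lemma total_map_subproof n x : cdiff (Defs.total E) n (total_map_fun n x) =
  total_map_fun (n - 1) (cdiff (Defs.total D) n x).
Proof.
apply: (@dsum_ext _ _ _ _ (lcomp (cdiff (Defs.total E) n) (total_map_fun n))
  (lcomp (total_map_fun (n - 1)) (cdiff (Defs.total D) n))) => p y.
have tinE m (q : bideg m) u : total_map_fun m (tin D q u) = tin E q (F (deg1 q) (deg2 q) u).
  exact: dmap_din.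
change (tdiff E n (total_map_fun n (tin D p y)) =
  total_map_fun (n - 1) (tdiff D n (tin D p y))).
rewrite tinE !tdiff_tin linearD linearZ_LR !tinE.
congr (_ + _ *: _); apply: (congr1 (tin E _)); [exact: Fh | exact: Fv].
Qed.

Definition total_map : chainMap (Defs.total D) (Defs.total E) := ChainMap total_map_subproof.

End TotalMaps.

Section TensorQuasiIso.
Variable R : idomainType.
Hypothesis R_pid : @is_pid R.
Implicit Types A B F : chainComplex R.

Lemma tensor_cmapE A A' B B' (f : chainMap A A') (g : chainMap B B') n x (p : bideg n) :
  tensor_cmap f g n x p = tmap (f (deg1 p)) (g (deg2 p)) (x p).
Proof. exact: dmapE. Qed.

(** [quasi_iso_of_exact] applies with [K (x) B] in the middle: [K] is free and acyclic, hence
    contractible, and so is its tensor product with [B]. *)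
Lemma tensor_quasi_isol A B F (f : chainMap F A) :
  is_free_complex F -> (forall n y, exists x, f n x = y) -> quasi_iso f ->
  acyclic (torC A B) -> quasi_iso (tensor_cmap f (chain_id B)).
Proof.
move=> Ff fS fq Tac; pose K := kerC f.
have Kp i : free_presentation (incl (lker (f i))) (f i).
  split=> //; first exact: incl_inj.
  - by move=> k; apply/lkerP; exact: smvalP.
  - by move=> x /lkerP xP; exists (Subm xP).
pose psi i := projT1 (cid (tor_comparison_inv (Kp i))).
have psiP i N u (t : tor (A i) N) :
    tor_comparison (incl (lker (f i))) (f i) u t <-> u = tmap (psi i) (lid N) (incl _ t).
  exact: (projT2 (cid (tor_comparison_inv (Kp i)))).
(* The embedding of Tor into [K (x) B]; as [tor_comparison] characterises it, naturality makes it
   commute with both differentials. *)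
pose th i j : {linear tor (A i) (B j) -> tensor (K i) (B j)} :=
  lcomp (tmap (psi i) (lid (B j))) (incl (tor_ker (A i) (B j))).
have thP i j u t : tor_comparison (incl (lker (f i))) (f i) u t <-> u = th i j t.
  exact: psiP.
have thh i j t : dh (tensorD K B) i j (th i j t) = th (i - 1) j (dh (torD A B) i j t).
  have /thP ut := erefl (th i j t); apply/thP.
  apply: (tor_comparison_nat (k := cdiff F i) (lid (B j)) (Kp (i - 1)) _ _ ut) => // x.
  by rewrite cmapd.
have thv i j t : dv (tensorD K B) i j (th i j t) = th i (j - 1) (dv (torD A B) i j t).
  have /thP ut := erefl (th i j t); apply/thP.
  exact: (tor_comparison_nat (k := lid _) (cdiff B j) (Kp i) _ _ ut).
pose thC : chainMap (torC A B) (tensorC K B) :=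
  @total_map R (torD A B) (tensorD K B) th thh thv.
have thCE n t (p : bideg n) : thC n t p = th (deg1 p) (deg2 p) (t p).
  exact: (dmapE (fun p : bideg n => th (deg1 p) (deg2 p)) t p).
apply: (@quasi_iso_of_exact _ _ _ _ _ thC (tensor_cmap (ker_incl f) (chain_id B))).
- move=> n; apply: injective0 => t t0; apply: dsum_eq => p.
  have := congr1 (fun x : dsum _ => x p) t0; rewrite [LHS]thCE => /esym/thP.
  exact: tor_comparison_zero.
- move=> n t; apply: dsum_eq => p; rewrite tensor_cmapE.
  rewrite [X in tmap _ _ X](thCE _ t p).
  by have /thP[] := erefl (th _ _ (t p)).
- move=> n u u0; apply: dmap_exact => p.
  have [|t ut] := @tor_comparison_tot _ _ _ _ _ _ (Kp (deg1 p)) _ (u p).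
    by rewrite -[LHS](tensor_cmapE (ker_incl f) (chain_id B)) u0.
  by exists t; apply/esym/thP.
- move=> n u; apply: dsum_eq => p; rewrite !tensor_cmapE tmap_comp tmap0l //= => x.
  exact: pres_comp (Kp _) _.
- move=> n u u0; apply: dmap_exact => p; apply: tensor_right_exactl.
  + exact: fS.
  + exact: pres_exact (Kp _).
  + by rewrite -[LHS](tensor_cmapE f (chain_id B)) u0.
- move=> n u; apply: dmap_exact => p; apply: tmap_surj; first exact: fS.
  by move=> y; exists y.
- exact: Tac.
have [||h hE] := @free_acyclic_contraction _ R_pid K.
- by move=> n; exact: submodule_free.
- exact: ker_acyclic.
exact: tensor_contractible hE.
Qed.

Lemma twistK A B n (x : tensorC A B n) : twist B A n (twist A B n x) = x.
Proof.
apply: (@dsum_ext _ _ _ _ (lcomp (twist B A n) (twist A B n)) (lid _)) => p y.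
change (twist_fun B A n (twist_fun A B n (tin (tensorD A B) p y)) = tin (tensorD A B) p y).
rewrite twist_tin linearZ_LR twist_tin tswapK scalerA.
rewrite [deg1 (bidegs p) * _]mulrC ksign2 scale1r.
by case: p y => i j e y; exact: (@tin_eq _ (tensorD A B)).
Qed.

Lemma twist_bij A B n : bijective (twist A B n).
Proof. by exists (twist B A n) => x; exact: twistK. Qed.

Lemma twist_nat A A' B B' (f : chainMap A A') (g : chainMap B B') n x :
  twist A' B' n (tensor_cmap f g n x) = tensor_cmap g f n (twist A B n x).
Proof.
apply: (@dsum_ext _ _ _ _ (lcomp (twist A' B' n) (tensor_cmap f g n))
  (lcomp (tensor_cmap g f n) (twist A B n))) => p y.
change (twist_fun A' B' n (tensor_cmap_fun f g n (tin (tensorD A B) p y)) =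
  tensor_cmap_fun g f n (twist_fun A B n (tin (tensorD A B) p y))).
rewrite tensor_cmap_tin !twist_tin linearZ_LR tensor_cmap_tin.
by congr (_ *: tin _ _ _); rewrite tswap_tmap.
Qed.

(** [f (x) g] is [1 (x) g] followed by [f (x) 1], and [1 (x) g] is [g (x) 1] conjugated by twists.
    For the latter the Tor complex is 0 because [F] is free. *)
Lemma tensor_quasi_iso A B F G (f : chainMap F A) (g : chainMap G B) :
  is_free_complex F -> (forall n y, exists x, f n x = y) -> quasi_iso f ->
  is_free_complex G -> (forall n y, exists x, g n x = y) -> quasi_iso g ->
  acyclic (torC A B) -> quasi_iso (tensor_cmap f g).
Proof.
move=> Ff fS fq Gf gS gq Tac.
have qf := tensor_quasi_isol Ff fS fq Tac.
have qg : quasi_iso (tensor_cmap g (chain_id F)).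
  apply: tensor_quasi_isol => //; apply: boundary_acyclic => n z _.
  have -> : z = 0 by apply: dsum_eq => p; exact: tor_free.
  by apply/bndP; rewrite rpred0.
have q := quasi_iso_comp qf (quasi_iso_comp (bij_quasi_iso (@twist_bij B F))
  (quasi_iso_comp qg (bij_quasi_iso (@twist_bij F G)))).
apply: quasi_iso_eq q => n x.
change (tensor_cmap f (chain_id B) n (twist B F n (tensor_cmap g (chain_id F) n
  (twist F G n x))) = tensor_cmap f g n x).
rewrite -(twist_nat (chain_id F) g) twistK; apply: dsum_eq => p; rewrite !tensor_cmapE.
by rewrite tmap_comp; apply: tmap_eq.
Qed.

End TensorQuasiIso.

(** * Free resolutions of complexes *)

Section Products.
Variable R : idomainType.
Implicit Types U V W : lmodType R.

Lemma lpair_subproof W U V (f : {linear W -> U}) (g : {linear W -> V}) :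
  linear (fun x => (f x, g x) : (U * V)%type).
Proof. by move=> a x y; rewrite !linearP. Qed.

Definition lpair W U V (f : {linear W -> U}) (g : {linear W -> V}) :
  {linear W -> (U * V)%type} := mklin (lpair_subproof f g).

Lemma lfst_subproof U V : linear (fun x : (U * V)%type => x.1).
Proof. by []. Qed.
Definition lfst U V : {linear (U * V)%type -> U} := mklin (@lfst_subproof U V).

Lemma lsnd_subproof U V : linear (fun x : (U * V)%type => x.2).
Proof. by []. Qed.
Definition lsnd U V : {linear (U * V)%type -> V} := mklin (@lsnd_subproof U V).

Lemma prod_free U V : is_free U -> is_free V -> is_free (U * V)%type.
Proof.
move=> [X [e /linear_inverse[c [eK cK]]]] [Y [e' /linear_inverse[c' [e'K c'K]]]].
pose f : {linear freem R (X + Y)%type -> (U * V)%type} :=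
  flift (fun z => match z with
    | inl x => (e (fgen R x), 0) | inr y => (0, e' (fgen R y)) end).
pose i1 : {linear freem R X -> freem R (X + Y)%type} :=
  flift (fun x => fgen R (inl x : (X + Y)%type)).
pose i2 : {linear freem R Y -> freem R (X + Y)%type} :=
  flift (fun y => fgen R (inr y : (X + Y)%type)).
have f1 u : f (i1 u) = (e u, 0).
  apply: (@freem_ext _ _ _ (lcomp f i1) (lpair e (lzero _ _))) => x.
  change (f (i1 (fgen R x)) = (e (fgen R x), 0)).
  by rewrite /i1 flift_fgen /f flift_fgen.
have f2 v : f (i2 v) = (0, e' v).
  apply: (@freem_ext _ _ _ (lcomp f i2) (lpair (lzero _ _) e')) => y.
  change (f (i2 (fgen R y)) = (0, e' (fgen R y))).
  by rewrite /i2 flift_fgen /f flift_fgen.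
exists (X + Y)%type, f; exists (fun p => i1 (c p.1) + i2 (c' p.2)) => [z|[u v]].
  pose g := ladd (lcomp i1 (lcomp c (@lfst U V))) (lcomp i2 (lcomp c' (@lsnd U V))).
  apply: (@freem_ext _ _ _ (lcomp g f) (lid _)) => -[x|y].
    change (i1 (c (f (fgen R (inl x))).1) + i2 (c' (f (fgen R (inl x))).2) =
      fgen R (inl x : (X + Y)%type)).
    rewrite [f _]flift_fgen.
    change (i1 (c (e (fgen R x))) + i2 (c' 0) = fgen R (inl x : (X + Y)%type)).
    by rewrite eK (linear0 c') (linear0 i2) addr0 [LHS]flift_fgen.
  change (i1 (c (f (fgen R (inr y))).1) + i2 (c' (f (fgen R (inr y))).2) =
    fgen R (inr y : (X + Y)%type)).
  rewrite [f _]flift_fgen.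
  change (i1 (c 0) + i2 (c' (e' (fgen R y))) = fgen R (inr y : (X + Y)%type)).
  by rewrite e'K (linear0 c) (linear0 i1) add0r [LHS]flift_fgen.
by rewrite linearD f1 f2 cK c'K /=; congr (_, _); rewrite ?addr0 ?add0r.
Qed.

End Products.

Section Resolution.
Variable R : idomainType.
Hypothesis R_pid : @is_pid R.
Variable A : chainComplex R.

Definition cyc_gen n : lmodType R := freem R (subm (cyc A n)).

Definition bnd_rel n : submodule (cyc_gen n) :=
  lker (lcomp (hclass A n) (faug (subm (cyc A n)))).

(** The sum of shifted two-term free resolutions of the homology modules: generators for degree [n]
    homology sit in degree [n], together with the relations for degree [n - 1]. *)
Definition res_obj n : lmodType R := (cyc_gen n * subm (bnd_rel (n - 1)))%type.

Definition res_diff n : {linear res_obj n -> res_obj (n - 1)} :=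
  lpair (lcomp (incl (bnd_rel (n - 1))) (@lsnd R _ _)) (lzero _ _).

Lemma res_diffK n x : res_diff (n - 1) (res_diff n x) = 0.
Proof.
by change ((incl (bnd_rel (n - 1 - 1)) 0, 0) = 0 :> res_obj (n - 1 - 1)); rewrite linear0.
Qed.

Definition resolution : chainComplex R := ChainComplex res_diffK.

Lemma bnd_relP n (q : subm (bnd_rel n)) :
  is_boundary (incl _ (faug _ (incl _ q))).
Proof. by apply/hclass0; exact: (elimT (lkerP _ _) (smvalP q)). Qed.

Lemma resolution_free : is_free_complex resolution.
Proof.
move=> n; apply: prod_free; first exact: freem_free.
by apply: submodule_free => //; exact: freem_free.
Qed.

(** The relations form a free module, so the boundaries they represent have linearly chosen
    primitives; these define the resolution map on the second summand. *)
Lemma bnd_rel_lift n : exists l : {linear subm (bnd_rel (n - 1)) -> A n},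
  forall q, cdiff A n (l q) = incl _ (faug _ (incl _ q)).
Proof.
have hP (q : subm (bnd_rel (n - 1))) :
    lcomp (incl (cyc A (n - 1))) (lcomp (faug _) (incl (bnd_rel (n - 1)))) q
      \in smem (bnd A (n - 1)).
  by apply/bndP; exact: bnd_relP.
have [||l lE] := free_lift (g := bdry A n) (h := corestr hP).
- by apply: submodule_free => //; exact: freem_free.
- by move=> q; exact: bdry_surj.
by exists l => q; exact: (congr1 (incl _) (lE q)).
Qed.

Lemma exists_free_resolution : exists (F : chainComplex R) (f : chainMap F A),
  [/\ is_free_complex F, forall n y, exists x, f n x = y & quasi_iso f].
Proof.
pose l n := projT1 (cid (bnd_rel_lift n)).
have lE n q : cdiff A n (l n q) = incl _ (faug _ (incl _ q)).
  exact: projT2 (cid (bnd_rel_lift n)) q.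
pose f n : {linear resolution n -> A n} :=
  ladd (lcomp (lcomp (incl (cyc A n)) (faug _)) (@lfst R _ _))
       (lcomp (l n) (@lsnd R _ _)).
have fE n p q : f n (p, q) = incl _ (faug _ p) + l n q by [].
have fP n x : cdiff A n (f n x) = f (n - 1) (cdiff resolution n x).
  case: x => p q; rewrite fE linearD cyc_diff add0r lE.
  by change (cdiff resolution n (p, q)) with (incl (bnd_rel (n - 1)) q, 0 : subm (bnd_rel (n - 1 - 1)));
    rewrite fE linear0 addr0.
exists resolution, (ChainMap fP); split; first exact: resolution_free.
(* Surjectivity: the generator at the cycle [cdiff A n a] is a relation; subtracting its chosen
   primitive from [a] leaves a cycle, which a generator hits. *)
- move=> n a.
  have [z zE] := cyc_mem (cdiffK a).
  have qP : fgen R z \in smem (bnd_rel (n - 1)).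
    apply/lkerP; change (hclass A (n - 1) (faug _ (fgen R z)) = 0).
    by rewrite faug_fgen; apply/hclass0; rewrite zE; exact: Boundary.
  have [|z' z'E] := @cyc_mem _ A n (a - l n (Subm qP)).
    by rewrite linearB lE faug_fgen zE subrr.
  exists (fgen R z', Subm qP); change (f n (fgen R z', Subm qP) = a).
  by rewrite fE faug_fgen z'E subrK.
apply: quasi_iso_intro => [n z /cyc_mem[z' <-]|n [p q] /(congr1 fst) /= q0].
  exists (fgen R z', 0); split.
    by change ((incl (bnd_rel (n - 1)) 0, 0) = 0 :> res_obj (n - 1)); rewrite linear0.
  change (is_boundary (f n (fgen R z', 0) - incl _ z')).
  by rewrite fE faug_fgen linear0 addr0 subrr; apply/bndP; rewrite rpred0.
have {q0} -> : q = 0 by apply: incl_inj; rewrite linear0; exact: q0.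
change (is_boundary (f (n - 1) (p, 0)) ->
  is_boundary (A := resolution) (n := n - 1) (p, 0)).
rewrite fE linear0 addr0 => pB.
have pP : p \in smem (bnd_rel (n - 1)).
  by apply/lkerP; change (hclass A (n - 1) (faug _ p) = 0); apply/hclass0.
by apply/boundaryE; exists (0, Subm pP).
Qed.

End Resolution.

(** * Strict lifting of chain maps *)

Section Lifting.
Variable R : idomainType.
Hypothesis R_pid : @is_pid R.
Variables (A F F0 : chainComplex R) (f : chainMap F A) (f0 : chainMap F0 A).
Hypotheses (F_free : is_free_complex F)
  (f0_surj : forall n y, exists x, f0 n x = y) (f0_qi : quasi_iso f0).

(** The lift is fixed on cycles first, in each degree separately; on the complement given by a
    splitting its boundary is then prescribed. No induction over degrees occurs, so unbounded
    complexes are covered. *)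
Lemma chain_lift : exists a : chainMap F F0, forall n x, f0 n (a n x) = f n x.
Proof.
have zP n : exists z : {linear subm (cyc F n) -> subm (cyc F0 n)},
    forall x, f0 n (incl _ (z x)) = f n (incl _ x).
  have [||z zE] := free_lift (g := cycmap f0 n) (h := cycmap f n).
  - exact: cyc_free.
  - move=> x; have [|w [/cyc_mem[w' <-] wE]] :=
        surj_quasi_iso_cycle f0_surj f0_qi (z := f n (incl _ x)).
      by rewrite cmapd cyc_diff linear0.
    by exists w'; apply: incl_inj; rewrite incl_cycmap.
  by exists z => x; exact: (congr1 (incl _) (zE x)).
pose z n := projT1 (cid (zP n)).
have zE n x : f0 n (incl _ (z n x)) = f n (incl _ x) by exact: (projT2 (cid (zP n)) x).
have aP n : exists a : {linear F n -> F0 n}, [/\ forall x, f0 n (a x) = f n x,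
    forall y, a (incl _ y) = incl _ (z n y) &
    forall x, cdiff F0 n (a x) = incl _ (z (n - 1) (bnd_cyc F (n - 1) (bdry F n x)))].
  have [r [s [rK sK rs]]] := cyc_splitting R_pid F_free n.
  (* [h] prescribes at once the boundary of the lift in [F0] and its image in [A]. *)
  pose h : {linear subm (bnd F (n - 1)) -> (F0 (n - 1) * A n)%type} :=
    lpair (lcomp (incl _) (lcomp (z (n - 1)) (bnd_cyc F (n - 1)))) (lcomp (f n) s).
  have [||l lE] := free_lift (g := lpair (cdiff F0 n) (f0 n)) (h := h).
  - exact: bnd_free.
  - move=> b; have [||w [w1 w2]] := surj_quasi_iso_lift f0_surj f0_qi
      (x := incl _ (z (n - 1) (bnd_cyc F (n - 1) b))) (y := f n (s b)).
    + exact: cyc_diff.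
    + rewrite zE cmapd; congr (f _ _); exact: (congr1 (incl _) (esym (sK b))).
    by exists w; rewrite /= w1 w2.
  have l1 b : cdiff F0 n (l b) = incl _ (z (n - 1) (bnd_cyc F (n - 1) b)).
    exact: (congr1 fst (lE b)).
  have l2 b : f0 n (l b) = f n (s b) by exact: (congr1 snd (lE b)).
  pose a := ladd (lcomp (incl _) (lcomp (z n) r)) (lcomp l (bdry F n)).
  have aE x : a x = incl _ (z n (r x)) + l (bdry F n x) by [].
  exists a; split=> x; rewrite aE.
  - by rewrite linearD zE l2 -linearD rs.
  - rewrite rK (_ : bdry F n (incl _ x) = 0) ?linear0 ?addr0 //.
    by apply: incl_inj; rewrite linear0; exact: cyc_diff.
  - by rewrite linearD cyc_diff add0r l1.
pose a n := projT1 (cid (aP n)).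
have [a1 a2 a3] : [/\ forall n x, f0 n (a n x) = f n x,
    forall n y, a n (incl _ y) = incl _ (z n y) &
    forall n x, cdiff F0 n (a n x) =
      incl _ (z (n - 1) (bnd_cyc F (n - 1) (bdry F n x)))].
  by split=> n x; have [h1 h2 h3] := projT2 (cid (aP n)); [exact: h1|exact: h2|exact: h3].
have aC n x : cdiff F0 n (a n x) = a (n - 1) (cdiff F n x).
  by rewrite a3 -a2.
by exists (ChainMap aC).
Qed.

End Lifting.

(** * The map beta for free complexes *)

Section BetaAt.
Variable R : idomainType.
Hypothesis R_pid : @is_pid R.

(* The part of [beta_free] that does not depend on the class of the cycle [z]. *)
Definition beta_at (A B : chainComplex R) n (z : tensorC A B n) (t : torH A B (n - 1)) :=
  exists w : dsum (fun p : bideg (n - 1) =>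
                tensor (subm (bnd A (deg1 p))) (subm (cyc B (deg2 p)))),
    dmap (fun p => tmap (lid (subm (bnd A (deg1 p)))) (incl (cyc B (deg2 p)))) w
      = partial_tensor A B n z /\
    forall p, tor_comparison (bnd_cyc A (deg1 p)) (hclass A (deg1 p))
      (tmap (lid (subm (bnd A (deg1 p)))) (hclass B (deg2 p)) (w p)) (t p).

Lemma beta_freeP (A B : chainComplex R) n c (t : torH A B (n - 1)) :
  beta_free c t <-> exists z, hclass (tensorC A B) n z = c /\ beta_at (incl _ z) t.
Proof.
split=> [[z [w [zc wz wt]]]|[z [zc [w [wz wt]]]]]; last by exists z, w; split.
by exists z; split=> //; exists w.
Qed.

Variables A B : chainComplex R.
Hypotheses (A_free : is_free_complex A) (B_free : is_free_complex B).

Lemma beta_comp_cycle n i j (z : tensorC A B n) (e : i - 1 + (j - 1) = n - 1)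
    (e1 : i + (j - 1) = n) (e2 : i - 1 + j = n) : cdiff (tensorC A B) n z = 0 ->
  tmap (cdiff A i) (lid (B (j - 1))) (z (Bideg e1)) =
  - ksign R (i - 1) *: tmap (lid (A (i - 1))) (cdiff B j) (z (Bideg e2)).
Proof.
move=> /(congr1 (fun x : dsum _ => x (Bideg e))).
rewrite [X in X = _ -> _](tdiff_comp e e1 e2) => /eqP; rewrite addr_eq0 -scaleNr.
by move/eqP.
Qed.

Lemma partial_tensor_compE n i j (z : tensorC A B n) (e : i - 1 + (j - 1) = n - 1)
    (e1 : i + (j - 1) = n) :
  partial_tensor A B n z (Bideg e) = tmap (bdry A i) (lid (B (j - 1))) (z (Bideg e1)).
Proof.
rewrite -[RHS](partial_tensor_comp z (Bideg e1)).
by rewrite (eq_irrelevance e (bidegl_subproof (Bideg e1))).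
Qed.

(** The cycle equation replaces [(d (x) 1) z] by a multiple of [(1 (x) d) z], so [1 (x) d] kills it;
    the boundaries of [A] are free, and flatness brings the second factors into the cycles. *)
Lemma beta_comp_lift n i j (z : tensorC A B n) (e : i - 1 + (j - 1) = n - 1) :
  cdiff (tensorC A B) n z = 0 ->
  exists w, tmap (lid (subm (bnd A (i - 1)))) (incl (cyc B (j - 1))) w =
    partial_tensor A B n z (Bideg e).
Proof.
move=> z0.
have e1 : i + (j - 1) = n by apply: (addIr (-1)); rewrite -e addrAC.
have e2 : i - 1 + j = n by apply: (addIr (-1)); rewrite -e addrA.
rewrite (partial_tensor_compE z e e1).
apply: (@flat_exactr _ _ _ _ _ _ (cdiff B (j - 1)) (free_flat (bnd_free R_pid A_free _))).
  by move=> x /cyc_mem[y <-]; exists y.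
(* Flatness of [B] in degree [j - 2] allows the vanishing to be tested after enlarging the
   boundaries to [A]. *)
apply: (free_flat (B_free (j - 1 - 1)) (f := incl (bnd A (i - 1))) (@incl_inj _ _ _)).
rewrite linear0.
transitivity (tmap (lid (A (i - 1))) (cdiff B (j - 1))
  (tmap (cdiff A i) (lid (B (j - 1))) (z (Bideg e1)))).
  by rewrite !tmap_comp; apply: tmap_eq.
rewrite (beta_comp_cycle e e1 e2 z0) linearZ_LR tmap_comp tmap0r ?scaler0 // => x.
exact: cdiffK.
Qed.

Lemma cyc_tensor_inj i j : injective (tmap (incl (cyc A i)) (incl (cyc B j))).
Proof.
apply: (@eq_inj _ _ (tmap (incl (cyc A i)) (lid (B j)) \o
    tmap (lid (subm (cyc A i))) (incl (cyc B j)))).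
  apply: inj_comp; first exact: (free_flat (B_free j) (@incl_inj _ _ _)).
  exact: (flatr (free_flat (cyc_free R_pid A_free i)) (@incl_inj _ _ _)).
by move=> x; rewrite [LHS]tmap_comp; apply: tmap_eq.
Qed.

(** This yields the torsion condition on the class of [w], since boundaries of [B] vanish in
    homology. *)
Lemma beta_comp_balance n i j (z : tensorC A B n) (e : i - 1 + (j - 1) = n - 1) w :
  cdiff (tensorC A B) n z = 0 ->
  tmap (lid (subm (bnd A (i - 1)))) (incl (cyc B (j - 1))) w =
    partial_tensor A B n z (Bideg e) ->
  exists x, tmap (bnd_cyc A (i - 1)) (lid (subm (cyc B (j - 1)))) w =
    tmap (lid (subm (cyc A (i - 1)))) (bnd_cyc B (j - 1)) x.
Proof.
move=> z0.
have e1 : i + (j - 1) = n by apply: (addIr (-1)); rewrite -e addrAC.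
have e2 : i - 1 + j = n by apply: (addIr (-1)); rewrite -e addrA.
rewrite (partial_tensor_compE z e e1) => wE.
have [r [_ [rK _ _]]] := cyc_splitting R_pid A_free (i - 1).
(* The neighbouring component of [z], moved into the cycles of [A] by the retraction [r], with the
   coefficient of the cycle equation. *)
exists (- ksign R (i - 1) *: tmap r (bdry B j) (z (Bideg e2))).
apply: (flatr (free_flat (cyc_free R_pid A_free (i - 1))) (@incl_inj _ _ (cyc B (j - 1)))).
transitivity (tmap (bnd_cyc A (i - 1)) (lid (B (j - 1)))
    (tmap (lid (subm (bnd A (i - 1)))) (incl (cyc B (j - 1))) w)).
  exact: tmap_square.
rewrite wE; transitivity (tmap r (lid (B (j - 1)))
    (tmap (cdiff A i) (lid (B (j - 1))) (z (Bideg e1)))).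
  apply: tmap_square => // x.
  exact: esym (rK (bnd_cyc A (i - 1) (bdry A i x))).
rewrite (beta_comp_cycle e e1 e2 z0) !linearZ_LR; congr (_ *: _).
by rewrite !tmap_comp; apply: tmap_eq.
Qed.

Lemma balance_torsion i j (w : tensor (subm (bnd A i)) (subm (cyc B j))) x :
  tmap (bnd_cyc A i) (lid (subm (cyc B j))) w =
    tmap (lid (subm (cyc A i))) (bnd_cyc B j) x ->
  tmap (bnd_cyc A i) (lid _) (tmap (lid _) (hclass B j) w) = 0.
Proof.
move=> wx; rewrite (tmap_square (c := bnd_cyc A i) (c' := lid _) (d := lid _) (d' := hclass B j)) //.
rewrite wx tmap_comp tmap0r // => y.
exact: pres_comp (homology_presentation R_pid B_free j) y.
Qed.

Lemma beta_at_tot n z : cdiff (tensorC A B) n z = 0 ->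
  exists t, beta_at z t.
Proof.
move=> z0; have [p|w wE] := @dmap_exact _ _ _ _
    (fun p => tmap (lid (subm (bnd A (deg1 p)))) (incl (cyc B (deg2 p))))
    (partial_tensor A B n z).
  by elim/bideg_pred_ind: p => i j e; exact: beta_comp_lift.
have [p wp|p|t tE] := @dsum_choice _ _ _ (dsupp w) (fun p t =>
    tor_comparison (bnd_cyc A (deg1 p)) (hclass A (deg1 p))
      (tmap (lid (subm (bnd A (deg1 p)))) (hclass B (deg2 p)) (w p)) t).
- rewrite (dsupp_out wp) linear0; apply: tor_comparison0.
  exact: homology_presentation.
- apply: tor_comparison_tot; first exact: homology_presentation.
  have := congr1 (fun x : dsum _ => x p) wE; rewrite [X in X = _ -> _]dmapE.
  elim/bideg_pred_ind: p => i j e wpE.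
  by have [x xE] := beta_comp_balance z0 wpE; apply: balance_torsion xE.
by exists t, w.
Qed.

Lemma beta_at_lin n a (z z' : tensorC A B n) t t' :
  beta_at z t -> beta_at z' t' -> beta_at (a *: z + z') (a *: t + t').
Proof.
move=> [w [wE wt]] [w' [w'E w't']]; exists (a *: w + w'); split.
  by rewrite [LHS]linearP wE w'E linearP.
move=> p; change (tor_comparison (bnd_cyc A (deg1 p)) (hclass A (deg1 p))
  (tmap (lid (subm (bnd A (deg1 p)))) (hclass B (deg2 p)) (a *: w p + w' p))
  (a *: t p + t' p)).
by rewrite linearP; apply: tor_comparison_lin.
Qed.

Lemma bnd_tensor_inj i j : injective (tmap (lid (subm (bnd A i))) (incl (cyc B j))).
Proof. exact: (flatr (free_flat (bnd_free R_pid A_free i)) (@incl_inj _ _ _)). Qed.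

(** If [z] is the boundary of [y], the term with [d d (x) 1] drops out and the component becomes a
    multiple of [(d (x) d) y]; so the second factors of [w] are boundaries and die in homology. *)
Lemma beta_at_boundary n (z : tensorC A B n) t : is_boundary z -> beta_at z t -> t = 0.
Proof.
elim/int_pred_ind: n => n in z t *; move=> /boundaryE[y zE] [w [wE wt]].
apply: dsum_eq; elim/bideg_pred_ind => i.
elim/int_pred_ind: i => i j e.
have e1 : i - 1 + (j - 1) = n - 1 by apply: (addIr (-1)); rewrite -e addrAC.
have e2 : i + (j - 1) = n by apply: (addIr (-1)); rewrite -e1 addrAC.
have e3 : i - 1 + j = n by apply: (addIr (-1)); rewrite -e1 addrA.
have := congr1 (fun x : dsum _ => x (Bideg e)) wE; rewrite [X in X = _ -> _]dmapE.
rewrite (partial_tensor_compE z e e1) zE [X in _ = tmap _ _ X -> _](tdiff_comp e1 e2 e3).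
have := wt (Bideg e); move: (w (Bideg e)) (y (Bideg e2)) (y (Bideg e3)) => w' u v ut wE'.
have {}wE' : w' = ksign R (i - 1) *: tmap (bdry A (i - 1)) (lcomp (bnd_cyc B (j - 1)) (bdry B j)) v.
  apply: bnd_tensor_inj; rewrite [LHS]wE' linearD !linearZ_LR.
  have -> : tmap (bdry A (i - 1)) (lid (B (j - 1))) (dh (tensorD A B) i (j - 1) u) = 0.
    rewrite [LHS]tmap_comp tmap0l // => x; apply: incl_inj; rewrite linear0.
    exact: cdiffK.
  rewrite add0r; congr (_ *: _); exact: tmap_square.
apply: (tor_comparison_zero (i := bnd_cyc A (i - 1 - 1)) (p := hclass A (i - 1 - 1))).
move: ut; congr (tor_comparison _ _ _ _); rewrite wE' linearZ_LR tmap_comp tmap0r ?scaler0 //.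
move=> x; exact: pres_comp (homology_presentation R_pid B_free (j - 1)) (bdry B j x).
Qed.

Lemma exists_beta n : exists b : {linear homology (tensorC A B) n -> torH A B (n - 1)},
  forall c t, beta_free c t <-> t = b c.
Proof.
apply: linear_of_rel.
- move=> c; have [z <-] := hclass_surj c.
  have [t zt] := beta_at_tot (cyc_diff z).
  by exists t; apply/beta_freeP; exists z.
- move=> a c c' t t' /beta_freeP[z [<- zt]] /beta_freeP[z' [<- z't']].
  apply/beta_freeP; exists (a *: z + z'); split; first exact: linearP.
  by rewrite linearP; exact: beta_at_lin.
- move=> t /beta_freeP[z [/hclass0 zB]]; exact: beta_at_boundary.
Qed.

End BetaAt.

(** * Naturality, symmetry and sections of beta *)

Section BetaNatural.
Variable R : idomainType.
Hypothesis R_pid : @is_pid R.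

Section BoundaryMap.
Variables (A A' : chainComplex R) (f : chainMap A A') (n : int).

Lemma bndmap_subproof (b : subm (bnd A n)) :
  lcomp (f n) (incl (bnd A n)) b \in smem (bnd A' n).
Proof. by apply/bndP/cmap_boundary/bndP; exact: smvalP. Qed.

Definition bndmap : {linear subm (bnd A n) -> subm (bnd A' n)} :=
  corestr bndmap_subproof.

End BoundaryMap.

Lemma beta_free_nat (A A' B B' : chainComplex R) (f : chainMap A A')
    (g : chainMap B B') n c (t : torH A B (n - 1)) :
  is_free_complex A -> is_free_complex A' -> beta_free c t ->
  beta_free (hmap (tensor_cmap f g) n c)
    (dmap (fun p => tor_map (hmap f (deg1 p)) (hmap g (deg2 p))) t).
Proof.
move=> A_free A'_free /beta_freeP[z [<- [w [wE wt]]]]; apply/beta_freeP.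
exists (cycmap (tensor_cmap f g) n z); split; first by rewrite hmap_hclass.
exists (dmap (fun p => tmap (bndmap f (deg1 p)) (cycmap g (deg2 p))) w); split.
  apply: dsum_eq => p; have [q ->] := bideg_predl p.
  rewrite !dmapE partial_tensor_comp incl_cycmap tensor_cmapE.
  transitivity (tmap (bndmap f (deg1 (bidegl q))) (g (deg2 q)) (partial_tensor A B n (incl _ z) (bidegl q))).
    by rewrite -wE dmapE; apply: tmap_square.
  rewrite partial_tensor_comp; apply: tmap_square => // x.
  by apply: incl_inj; exact: esym (cmapd f x).
move=> p; rewrite !dmapE.
rewrite (tmap_square (c := lid _) (c' := hclass B (deg2 p)) (d := bndmap f (deg1 p))
  (d' := hmap g (deg2 p))) //; last by move=> y; rewrite hmap_hclass.
apply: (tor_comparison_nat (k := cycmap f (deg1 p)) _ _ _ _ (wt p)).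
- exact: homology_presentation.
- by move=> x; apply: incl_inj.
- by move=> x; rewrite hmap_hclass.
Qed.

Variables A B : chainComplex R.
Hypotheses (A_free : is_free_complex A) (B_free : is_free_complex B).

(** The lifts for [z] and for its twist come from adjacent components of [z], related by the cycle
    equation. In the tensor product of the cycles they agree up to swap and sign, and such a pair is
    a chase computing the symmetry of Tor. *)
Lemma beta_at_twist n (z : tensorC A B n) t t' : cdiff (tensorC A B) n z = 0 ->
  beta_at z t -> beta_at (twist A B n z) t' -> t' = torH_swap A B (n - 1) t.
Proof.
move=> z0 [w [wE wt]] [w' [w'E w't']]; apply: dsum_eq => p'.
have -> : p' = bidegs (bidegs p') by exact: bideg_eq.
move: (bidegs p') => {p'}; elim/bideg_pred_ind => i j e.
rewrite torH_swap_comp; pose c := ksign R ((i - 1) * (j - 1) + 1).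
change (t' (bidegs (Bideg e)) = c *: tor_swap _ _ (t (Bideg e))).
have e1 : i + (j - 1) = n by apply: (addIr (-1)); rewrite -e addrAC.
have e2 : i - 1 + j = n by apply: (addIr (-1)); rewrite -e addrA.
have {wE} := congr1 (fun x : dsum _ => x (Bideg e)) wE; rewrite [X in X = _ -> _]dmapE.
rewrite (partial_tensor_compE z e e1) => wE.
have {w'E} := congr1 (fun x : dsum _ => x (bidegs (Bideg e))) w'E.
rewrite [X in X = _ -> _]dmapE.
rewrite [X in _ = X -> _](partial_tensor_compE _ (bidegs_subproof (Bideg e))
  (bidegs_subproof (Bideg e2))).
rewrite [X in _ = tmap _ _ X -> _](twist_comp z (Bideg e2)) => w'E.
have := w't' (bidegs (Bideg e)); have := wt (Bideg e).
move: (w (Bideg e)) (w' (bidegs (Bideg e))) (t (Bideg e)) (t' (bidegs (Bideg e))) wE w'E.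
have := beta_comp_cycle e e1 e2 z0.
move: (z (Bideg e1)) (z (Bideg e2)) => u v uv w1 w1' t1 t1' wE w'E wt1 w't1'.
(* Tested in [A (x) B], where the tensor product of the cycles embeds by flatness. *)
have w1E : tmap (bnd_cyc A (i - 1)) (lid _) w1 =
    c *: tmap (lid _) (bnd_cyc B (j - 1)) (tswap _ _ w1').
  apply: (cyc_tensor_inj R_pid A_free B_free).
  transitivity (tmap (incl (bnd A (i - 1))) (lid (B (j - 1))) (tmap (lid _) (incl _) w1)).
    exact: tmap_square.
  rewrite wE; transitivity (tmap (cdiff A i) (lid (B (j - 1))) u).
    by rewrite tmap_comp; apply: tmap_eq.
  rewrite uv linearZ_LR.
  transitivity (c *: tswap _ _ (tmap (incl (bnd B (j - 1))) (lid (A (i - 1))) (tmap (lid _) (incl _) w1'))).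
    pose L := lcomp (tswap _ _) (lcomp (tmap (incl (bnd B (j - 1))) (lid (A (i - 1))))
      (tmap (bdry B j) (lid (A (i - 1))))).
    have LE : L (tswap _ _ v) = tmap (lid (A (i - 1))) (cdiff B j) v.
      change (tswap _ _ (tmap (incl (bnd B (j - 1))) (lid (A (i - 1)))
        (tmap (bdry B j) (lid (A (i - 1))) (tswap _ _ v))) = tmap (lid (A (i - 1))) (cdiff B j) v).
      by rewrite !tswap_tmap tswapK tmap_comp; apply: tmap_eq.
    rewrite w'E.
    change (- ksign R (i - 1) *: tmap (lid (A (i - 1))) (cdiff B j) v =
      c *: L (ksign R ((i - 1) * j) *: tswap _ _ v)).
    rewrite (linearZ_LR L) LE scalerA; congr (_ *: _).
    (* Sign count: the twist contributes [k j], the cycle equation [k + 1], and the sum is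
       [k (j - 1) + 1] modulo 2. *)
    rewrite /c; move: (i - 1) => k; rewrite ksignD ksign1 mulrBr mulr1 ksignD ksignN mulrN1 mulNr mulrAC.
    by rewrite ksign2 mul1r.
  by congr (_ *: _); rewrite !tswap_tmap; apply: tmap_square.
suff ct1' : c *: t1' = tor_swap _ _ t1 by rewrite -ct1' scalerA ksign2 scale1r.
apply/(tor_swapP R_pid).
have := tor_comparison_lin c w't1'
  (tor_comparison0 (homology_presentation R_pid B_free (j - 1)) _).
rewrite !addr0 => cwt; apply: (balanced_tor_sym wt1 cwt).
exists w1, (c *: tswap _ _ w1'); split=> //; first by rewrite linearZ_LR.
by rewrite !linearZ_LR -tswap_tmap tswapK.
Qed.

Lemma beta_free_twist n c (t : torH A B (n - 1)) : beta_free c t ->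
  beta_free (hmap (twist A B) n c) (torH_swap A B (n - 1) t).
Proof.
move=> /beta_freeP[z [<- zt]]; apply/beta_freeP.
exists (cycmap (twist A B) n z); split; first by rewrite hmap_hclass.
have [t' zt'] := beta_at_tot R_pid B_free A_free (cyc_diff (cycmap (twist A B) n z)).
by rewrite -(beta_at_twist (cyc_diff z) zt zt').
Qed.

Section SectionChain.
Variables (n i j : int) (e : i - 1 + (j - 1) = n - 1)
  (e1 : i + (j - 1) = n) (e2 : i - 1 + j = n).
Variables (sA : {linear subm (bnd A (i - 1)) -> A i})
  (sB : {linear subm (bnd B (j - 1)) -> B j}).
Hypotheses (sAE : forall b, bdry A i (sA b) = b) (sBE : forall b, bdry B j (sB b) = b).

Local Notation wT := (tensor (subm (bnd A (i - 1))) (subm (cyc B (j - 1)))).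
Local Notation xT := (tensor (subm (cyc A (i - 1))) (subm (bnd B (j - 1)))).

(** The sign makes the two contributions to the differential in bidegree [(i - 1, j - 1)] cancel for
    a balanced pair. *)
Definition section_chain (w : wT) (x : xT) : tensorC A B n :=
  tin (tensorD A B) (Bideg e1) (tmap sA (incl _) w) -
  ksign R (i - 1) *: tin (tensorD A B) (Bideg e2) (tmap (incl _) sB x).

Definition balance (w : wT) (x : xT) :=
  tmap (bnd_cyc A (i - 1)) (lid _) w = tmap (lid _) (bnd_cyc B (j - 1)) x.

Lemma section_chain_lin a w w' x x' :
  section_chain (a *: w + w') (a *: x + x') =
  a *: section_chain w x + section_chain w' x'.
Proof.
rewrite /section_chain.
rewrite [tmap sA _ _]linearP [tmap _ sB _]linearP.
rewrite [tin _ (Bideg e1) (_ + _)]linearP [tin _ (Bideg e2) (_ + _)]linearP.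
by rewrite scalerBr scalerDr opprD addrACA !scalerA [a * _]mulrC.
Qed.

Lemma section_chain_cycle w x : balance w x -> cdiff (tensorC A B) n (section_chain w x) = 0.
Proof.
move=> wx; rewrite linearB linearZ_LR.
change (tdiff (tensorD A B) n (tin (tensorD A B) (Bideg e1) (tmap sA (incl _) w)) -
  ksign R (i - 1) *: tdiff (tensorD A B) n
     (tin (tensorD A B) (Bideg e2) (tmap (incl _) sB x)) = 0).
rewrite !tdiff_tin.
have -> : dv (tensorD A B) i (j - 1) (tmap sA (incl _) w) = 0.
  by rewrite [LHS]tmap_comp tmap0r // => y; exact: cyc_diff.
have -> : dh (tensorD A B) (i - 1) j (tmap (incl _) sB x) = 0.
  by rewrite [LHS]tmap_comp tmap0l // => y; exact: cyc_diff.
have -> : dh (tensorD A B) i (j - 1) (tmap sA (incl _) w) =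
    dv (tensorD A B) (i - 1) j (tmap (incl _) sB x).
  transitivity (tmap (incl (cyc A (i - 1))) (incl (cyc B (j - 1)))
      (tmap (bnd_cyc A (i - 1)) (lid _) w)).
    by apply: tmap_square => // b; exact: (congr1 (incl _) (sAE b)).
  rewrite wx; apply: tmap_square => // b; exact: esym (congr1 (incl _) (sBE b)).
rewrite !linear0 addr0 add0r scalerA ksign2 scale1r.
apply/eqP; rewrite subr_eq0; apply/eqP; exact: (@tin_eq _ (tensorD A B)).
Qed.

Lemma section_chain_beta w x t :
  tor_comparison (bnd_cyc A (i - 1)) (hclass A (i - 1)) (tmap (lid _) (hclass B (j - 1)) w) t ->
  beta_at (section_chain w x)
    (din (fun p : bideg (n - 1) => tor (homology A (deg1 p)) (homology B (deg2 p))) (Bideg e) t).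
Proof.
move=> wt.
pose W := din (fun p : bideg (n - 1) =>
  tensor (subm (bnd A (deg1 p))) (subm (cyc B (deg2 p)))).
exists (W (Bideg e) w); split.
  rewrite [LHS]dmap_din /section_chain linearB linearZ_LR.
  rewrite [partial_tensor _ _ _ (tin _ (Bideg e1) _)]dlift_din.
  rewrite [partial_tensor _ _ _ (tin _ (Bideg e2) _)]dlift_din.
  pose M (p : bideg (n - 1)) := tensor (subm (bnd A (deg1 p))) (B (deg2 p)).
  change (din M (Bideg e) (tmap (lid _) (incl _) w) =
    din M (bidegl (Bideg e1)) (tmap (bdry A i) (lid _) (tmap sA (incl _) w)) -
    ksign R (i - 1) *: din M (bidegl (Bideg e2))
      (tmap (bdry A (i - 1)) (lid _) (tmap (incl _) sB x))).
  have -> : tmap (bdry A (i - 1)) (lid (B j)) (tmap (incl _) sB x) = 0.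
    rewrite tmap_comp tmap0l // => y; apply: incl_inj; rewrite linear0.
    exact: cyc_diff.
  rewrite linear0 scaler0 subr0 (eq_irrelevance e (bidegl_subproof (Bideg e1))).
  apply: (congr1 (din M (bidegl (Bideg e1)))); rewrite [RHS]tmap_comp.
  by apply: tmap_eq => // b; exact: esym (sAE b).
move=> q; have [|pq] := eqVneq (Bideg e) q.
  by case: q /; rewrite !din_same.
rewrite !din_other // linear0; apply: tor_comparison0; exact: homology_presentation.
Qed.

End SectionChain.

(** Up to the sign of [i] this chain is the boundary of [(sA (x) sB) y]. Hence pairs representing 0
    in Tor give the zero class. *)
Lemma section_chain_boundary n i j (e1 : i + (j - 1) = n - 1) (e2 : i - 1 + j = n - 1)
    (sA : {linear subm (bnd A (i - 1)) -> A i})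
    (sB : {linear subm (bnd B (j - 1)) -> B j}) (y : tensor (subm (bnd A (i - 1))) (subm (bnd B (j - 1)))) :
  (forall b, bdry A i (sA b) = b) -> (forall b, bdry B j (sB b) = b) ->
  is_boundary (A := tensorC A B)
    (section_chain e1 e2 sA sB (tmap (lid _) (bnd_cyc B (j - 1)) y)
                               (tmap (bnd_cyc A (i - 1)) (lid _) y)).
Proof.
move=> sAE sBE.
have e0 : i + j = n by apply: (addIr (-1)); rewrite -e1 addrA.
apply/boundaryE.
exists (ksign R i *: tin (tensorD A B) (Bideg e0) (tmap sA sB y)).
rewrite linearZ_LR.
change (section_chain e1 e2 sA sB (tmap (lid _) (bnd_cyc B (j - 1)) y)
                               (tmap (bnd_cyc A (i - 1)) (lid _) y) =
  ksign R i *: tdiff (tensorD A B) n (tin (tensorD A B) (Bideg e0) (tmap sA sB y))).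
rewrite tdiff_tin scalerDr scalerA ksign2 scale1r [RHS]addrC /section_chain.
rewrite ksignB1 scaleNr opprK; congr (_ + _ *: _).
- have -> : tmap sA (incl _) (tmap (lid _) (bnd_cyc B (j - 1)) y) =
      dv (tensorD A B) i j (tmap sA sB y).
    by apply: tmap_square => // b; exact: (congr1 (incl _) (esym (sBE b))).
  exact: (@tin_eq _ (tensorD A B)).
- have -> : tmap (incl _) sB (tmap (bnd_cyc A (i - 1)) (lid _) y) =
      dh (tensorD A B) i j (tmap sA sB y).
    by apply: tmap_square => // b; exact: (congr1 (incl _) (esym (sAE b))).
  exact: (@tin_eq _ (tensorD A B)).
Qed.

(** The pair [(w, x)] is not chosen linearly in the element of Tor, but the class of its chain is
    linear, because pairs for 0 come from the tensor product of the boundaries. *)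
Lemma beta_section_comp n (p : bideg (n - 1)) :
  exists s : {linear tor (homology A (deg1 p)) (homology B (deg2 p)) ->
                     homology (tensorC A B) n},
    forall t, beta_free (s t) (din (fun p : bideg (n - 1) =>
      tor (homology A (deg1 p)) (homology B (deg2 p))) p t).
Proof.
elim/int_pred_ind: n p => n; elim/bideg_pred_ind => i j e.
have e1 : i + (j - 1) = n - 1 by apply: (addIr (-1)); rewrite -e addrAC.
have e2 : i - 1 + j = n - 1 by apply: (addIr (-1)); rewrite -e addrA.
have [sA sAE] := bdry_section R_pid A_free i.
have [sB sBE] := bdry_section R_pid B_free j.
have Ap := homology_presentation R_pid A_free (i - 1).
have Bp := homology_presentation R_pid B_free (j - 1).
pose rel (t : tor (homology A (i - 1)) (homology B (j - 1)))
    (c : homology (tensorC A B) (n - 1)) := exists w x z,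
  [/\ balance w x, tor_comparison (bnd_cyc A (i - 1)) (hclass A (i - 1))
        (tmap (lid _) (hclass B (j - 1)) w) t,
      incl _ z = section_chain e1 e2 sA sB w x & hclass _ _ z = c].
have [|||s sE] := @linear_of_rel _ _ _ rel.
- move=> t; have [psi psiE] := tor_comparison_inv Ap.
  have /psiE ut := erefl (tmap psi (lid _) (incl _ t)).
  have [||w wE] := tmap_surj (f := lid (subm (bnd A (i - 1))))
      (g := hclass B (j - 1)) _ _ (tmap psi (lid _) (incl _ t)).
  + by move=> y; exists y.
  + exact: hclass_surj.
  rewrite -wE in ut.
  have [|||x xE] := tensor_right_exactr (f := bnd_cyc B (j - 1)) (p := hclass B (j - 1))
    _ _ (u := tmap (bnd_cyc A (i - 1)) (lid _) w).
  + exact: hclass_surj.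
  + exact: pres_exact Bp.
  + by rewrite -[RHS]ut.1; apply: tmap_square.
  have wx : balance w x by rewrite /balance xE.
  have [z zE] := cyc_mem (section_chain_cycle e1 e2 sAE sBE wx).
  by exists (hclass _ _ z), w, x, z.
- move=> a t t' c c' [w [x [z [wx wt zE <-]]]] [w' [x' [z' [wx' wt' zE' <-]]]].
  exists (a *: w + w'), (a *: x + x'), (a *: z + z'); split.
  + by rewrite /balance !linearP wx wx'.
  + by rewrite linearP; exact: tor_comparison_lin.
  + by rewrite linearP section_chain_lin zE zE'.
  + exact: linearP.
- move=> c [w [x [z [wx wt zE <-]]]]; apply/hclass0.
  have [psi psiE] := tor_comparison_inv Ap.
  move/psiE: wt; rewrite !linear0 => w0.
  have [||y yE] := tensor_right_exactr (f := bnd_cyc B (j - 1)) _ _ w0.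
  + exact: hclass_surj.
  + exact: pres_exact Bp.
  (* Flatness of the cycles of [A] makes [w] determine [x]. *)
  have xE : x = tmap (bnd_cyc A (i - 1)) (lid _) y.
    apply: (flatr (free_flat (cyc_free R_pid A_free _)) (pres_inj Bp)).
    by rewrite -wx -yE; apply: tmap_square.
  rewrite zE xE -yE; exact: section_chain_boundary.
exists s => t; apply/beta_freeP.
have [_ /(_ erefl)[w [x [z [wx wt zE zc]]]]] := sE t (s t).
exists z; split=> //; rewrite zE; exact: section_chain_beta wt.
Qed.

Lemma beta_section n (b : {linear homology (tensorC A B) n -> torH A B (n - 1)}) :
  (forall c t, beta_free c t <-> t = b c) ->
  exists s : {linear torH A B (n - 1) -> homology (tensorC A B) n},
    forall t, b (s t) = t.
Proof.
move=> bE; pose s (p : bideg (n - 1)) := projT1 (cid (beta_section_comp p)).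
have sE p t : b (s p t) = din (fun p : bideg (n - 1) =>
      tor (homology A (deg1 p)) (homology B (deg2 p))) p t.
  by apply/esym/bE; exact: (projT2 (cid (beta_section_comp p)) t).
exists (dlift s); apply: (@dsum_ext _ _ _ _ (lcomp b (dlift s)) (lid _)) => p t.
change (b (dlift s (din _ p t)) = din _ p t).
by rewrite dlift_din sE.
Qed.

End BetaNatural.

(** * The Künneth sequence *)

Section Kunneth.
Variable R : idomainType.

Lemma kunneth_cross_twist (A B : chainComplex R) n (h : tensorH A B n) :
  hmap (twist A B) n (kunneth_cross A B n h) =
  kunneth_cross B A n (tensorH_swap A B n h).
Proof.
apply: (@dsum_ext _ _ _ _ (lcomp (hmap (twist A B) n) (kunneth_cross A B n))
  (lcomp (kunneth_cross B A n) (tensorH_swap A B n))) => p.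
pose I (A' B' : chainComplex R) := din (fun q : bideg n =>
  tensor (homology A' (deg1 q)) (homology B' (deg2 q))).
refine (@tensor_ext _ _ _ _ (lcomp (lcomp (hmap (twist A B) n) (kunneth_cross A B n)) (I A B p))
  (lcomp (lcomp (kunneth_cross B A n) (tensorH_swap A B n)) (I A B p)) _) => h1 h2.
have [z <-] := hclass_surj h1; have [w <-] := hclass_surj h2.
change (hmap (twist A B) n (kunneth_cross A B n (I A B p (tens (hclass _ _ z) (hclass _ _ w)))) =
  kunneth_cross B A n (tensorH_swap A B n (I A B p (tens (hclass _ _ z) (hclass _ _ w))))).
rewrite kunneth_cross_hclass hmap_hclass.
have -> : tensorH_swap A B n (I A B p (tens (hclass _ _ z) (hclass _ _ w))) =
    ksign R (deg1 p * deg2 p) *: I B A (bidegs p) (tens (hclass _ _ w) (hclass _ _ z)).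
  rewrite [LHS]dlift_din.
  change (ksign R (deg1 p * deg2 p) *: I B A (bidegs p) (tswap _ _ (tens (hclass _ _ z) (hclass _ _ w))) =
    ksign R (deg1 p * deg2 p) *: I B A (bidegs p) (tens (hclass _ _ w) (hclass _ _ z))).
  by rewrite tswap_tens.
rewrite linearZ_LR [kunneth_cross _ _ _ _](kunneth_cross_hclass (p := bidegs p) w z).
rewrite -linearZ_LR; congr (hclass _ _ _); apply: incl_inj; rewrite [RHS]linearZ_LR.
change (twist_fun A B n (tin (tensorD A B) p (tens (incl _ z) (incl _ w))) =
  ksign R (deg1 p * deg2 p) *: tin (tensorD B A) (bidegs p) (tens (incl _ w) (incl _ z))).
by rewrite twist_tin tswap_tens.
Qed.

Hypothesis R_pid : @is_pid R.

Section BetaGraph.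
Variables (A B FA FB : chainComplex R) (f : chainMap FA A) (g : chainMap FB B) (n : int).
Hypotheses (FA_free : is_free_complex FA) (FB_free : is_free_complex FB)
  (f_surj : forall n y, exists x, f n x = y) (g_surj : forall n y, exists x, g n x = y)
  (f_qi : quasi_iso f) (g_qi : quasi_iso g) (fg_qi : quasi_iso (tensor_cmap f g)).
Variable b : {linear homology (tensorC FA FB) n -> torH FA FB (n - 1)}.
Hypothesis bE : forall c t, beta_free c t <-> t = b c.

Local Notation tor_fg :=
  (dmap (fun p : bideg (n - 1) => tor_map (hmap f (deg1 p)) (hmap g (deg2 p)))).

(* Every other pair of free resolutions maps to (FA, FB) over (A, B). *)
Lemma beta_graphP c t : beta_graph (hmap (tensor_cmap f g) n c) t <-> t = tor_fg (b c).
Proof.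
split=> [[FA' [FB' [f' [g' [c' [t' [[FA'f FB'f] _ ct' c'E <-]]]]]]]|->]; last first.
  by exists FA, FB, f, g, c, (b c); split=> //; apply/bE.
have [a1 a1E] := chain_lift R_pid f' FA'f f_surj f_qi.
have [a2 a2E] := chain_lift R_pid g' FB'f g_surj g_qi.
have <- : hmap (tensor_cmap a1 a2) n c' = c.
  apply: (bij_inj (fg_qi n)); rewrite -c'E -hmap_comp; apply: hmap_eq => x.
  change (tensor_cmap f g n (tensor_cmap a1 a2 n x) = tensor_cmap f' g' n x).
  apply: dsum_eq => p; rewrite !tensor_cmapE tmap_comp; apply: tmap_eq => y.
    exact: a1E.
  exact: a2E.
have /bE <- := beta_free_nat R_pid a1 a2 FA'f FA_free ct'.
apply: dsum_eq => p; rewrite !dmapE tor_map_comp; apply: tor_map_eq => h.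
  transitivity (hmap (chain_comp f a1) (deg1 p) h); last exact: hmap_comp.
  by apply: hmap_eq => y; exact: esym (a1E _ y).
transitivity (hmap (chain_comp g a2) (deg2 p) h); last exact: hmap_comp.
by apply: hmap_eq => y; exact: esym (a2E _ y).
Qed.

(** [beta_graph] is the graph of the map transported along the resolutions; this map satisfies the
    definite description, which therefore does not fall back on 0. *)
Lemma kunneth_betaE c :
  kunneth_beta A B n (hmap (tensor_cmap f g) n c) = tor_fg (b c).
Proof.
apply/beta_graphP; move: (hmap _ _ c) => {}c; rewrite /kunneth_beta /the_linear.
case: pselect => [ex|[]]; first by case: cid => J JP /=.
have [G [_ GK]] := linear_inverse (fg_qi n).
exists (lcomp tor_fg (lcomp b G)) => c0; rewrite -{1}[c0]GK.
exact/beta_graphP.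
Qed.

End BetaGraph.

Lemma tor_map_bij (M M' N N' : lmodType R) (f : {linear M -> M'}) (g : {linear N -> N'}) :
  bijective f -> bijective g -> exists h : {linear tor M' N' -> tor M N},
    cancel h (tor_map f g).
Proof.
move=> /linear_inverse[f' [_ f'K]] /linear_inverse[g' [_ g'K]].
exists (tor_map f' g') => t; rewrite tor_map_comp.
transitivity (tor_map (lid M') (lid N') t); first exact: tor_map_eq.
by apply: incl_inj; rewrite incl_tor_map tmap_id // => k; apply: incl_inj;
  rewrite incl_rmap; apply: (@freem_ext _ _ _ (fmap (lid M')) (lid _)) => m; rewrite fmap_fgen.
Qed.

Lemma torH_swap_nat (A A' B B' : chainComplex R) (f : chainMap A A') (g : chainMap B B') n
    (t : torH A B n) :
  torH_swap A' B' n (dmap (fun p => tor_map (hmap f (deg1 p)) (hmap g (deg2 p))) t) =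
  dmap (fun p => tor_map (hmap g (deg1 p)) (hmap f (deg2 p))) (torH_swap A B n t).
Proof.
apply: dsum_eq => p; have -> : p = bidegs (bidegs p) by exact: bideg_eq.
rewrite torH_swap_comp !dmapE torH_swap_comp linearZ_LR; congr (_ *: _).
exact: tor_swap_nat.
Qed.

Lemma torH_swapK (A B : chainComplex R) n (t : torH A B n) :
  torH_swap B A n (torH_swap A B n t) = t.
Proof.
apply: dsum_eq => -[i j e].
rewrite (eq_irrelevance e (bidegs_subproof (bidegs (Bideg e)))).
rewrite [LHS](torH_swap_comp _ (bidegs (Bideg e))).
rewrite [X in tor_swap _ _ X](torH_swap_comp t (Bideg e)) linearZ_LR tor_swapK // scalerA.
rewrite [deg1 (bidegs _) * _]mulrC ksign2 scale1r.
by move: (bidegs_subproof _) => e'; rewrite (eq_irrelevance e e').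
Qed.

End Kunneth.

Theorem corollary7p2 (R : idomainType) (R_pid : is_pid R)
    (A B : chainComplex R) (AB_acyclic : acyclic (torC A B)) (n : int) :
  [/\ (forall h : tensorH A B n,
         hmap (twist A B) n (kunneth_cross A B n h) =
         kunneth_cross B A n (tensorH_swap A B n h)),
      (forall c : homology (tensorC A B) n,
         kunneth_beta B A n (hmap (twist A B) n c) =
         torH_swap A B (n - 1) (kunneth_beta A B n c)) &
      exists (sigma : {linear torH A B (n - 1) -> homology (tensorC A B) n})
             (sigma' : {linear torH B A (n - 1) -> homology (tensorC B A) n}),
        [/\ forall t, kunneth_beta A B n (sigma t) = t,
            forall t, kunneth_beta B A n (sigma' t) = t &
            forall t, hmap (twist A B) n (sigma t) =
                      sigma' (torH_swap A B (n - 1) t)]].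
Proof.
have [FA [f [FAf fS fq]]] := exists_free_resolution R_pid A.
have [FB [g [FBf gS gq]]] := exists_free_resolution R_pid B.
have fgq := tensor_quasi_iso R_pid FAf fS fq FBf gS gq AB_acyclic.
(* Obtained from [fgq] by conjugation with twists, as the acyclicity hypothesis concerns the order
   [A], [B]. *)
have gfq : quasi_iso (tensor_cmap g f).
  have q := quasi_iso_comp (bij_quasi_iso (@twist_bij _ A B))
    (quasi_iso_comp fgq (bij_quasi_iso (@twist_bij _ FB FA))).
  apply: quasi_iso_eq q => m x.
  change (twist A B m (tensor_cmap f g m (twist FB FA m x)) = tensor_cmap g f m x).
  by rewrite twist_nat twistK.
have [b bE] := exists_beta R_pid FAf FBf n.
have [b' b'E] := exists_beta R_pid FBf FAf n.
have betaE := kunneth_betaE R_pid FAf FBf fS gS fq gq fgq bE.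
have beta'E := kunneth_betaE R_pid FBf FAf gS fS gq fq gfq b'E.
(* Every class comes from the resolutions, where [beta_free_twist] applies; naturality of the twist
   and of the signed swap carries the identity over. *)
have betaT c : kunneth_beta B A n (hmap (twist A B) n c) =
    torH_swap A B (n - 1) (kunneth_beta A B n c).
  have [c0 <-] := bijective_surj (fgq n) c.
  rewrite betaE torH_swap_nat //.
  have /bE/(beta_free_twist R_pid FAf FBf)/b'E -> := erefl (b c0).
  rewrite -beta'E; congr (kunneth_beta _ _ _ _); rewrite -!hmap_comp.
  by apply: hmap_eq => x; exact: twist_nat.
split=> //; first exact: kunneth_cross_twist.
have [s sE] := beta_section R_pid FAf FBf bE.
have [q qE] : exists q : {linear torH A B (n - 1) -> torH FA FB (n - 1)}, forall t,
    dmap (fun p => tor_map (hmap f (deg1 p)) (hmap g (deg2 p))) (q t) = t.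
  pose q (p : bideg (n - 1)) := projT1 (cid (tor_map_bij (fq (deg1 p)) (gq (deg2 p)))).
  exists (dmap q) => t; apply: dsum_eq => p; rewrite !dmapE.
  exact: (projT2 (cid (tor_map_bij (fq (deg1 p)) (gq (deg2 p)))) (t p)).
pose sigma : {linear torH A B (n - 1) -> homology (tensorC A B) n} :=
  lcomp (hmap (tensor_cmap f g) n) (lcomp s q).
have sigmaE t : kunneth_beta A B n (sigma t) = t.
  by rewrite [kunneth_beta _ _ _ _]betaE sE qE.
(* The second section is [T sigma I^-1]; the inverse of the signed swap is the signed swap in the
   other order. *)
exists sigma, (lcomp (hmap (twist A B) n) (lcomp sigma (torH_swap B A (n - 1)))).
split=> // t.
  change (kunneth_beta B A n (hmap (twist A B) n (sigma (torH_swap B A (n - 1) t))) = t).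
  by rewrite betaT sigmaE torH_swapK.
change (hmap (twist A B) n (sigma t) = hmap (twist A B) n (sigma
  (torH_swap B A (n - 1) (torH_swap A B (n - 1) t)))).
by rewrite torH_swapK.
Qed.
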